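(* There exist absolute constants $0 < \eta_1 < \eta_2$ and $\eta > 0$, a sequence of polynomials $$P_{2n}(z) = \sum_{j=0}^{2n} a_{j,n} z^j, \qquad a_{j,n} \in \{-1,1\}, \quad j=0,1,\ldots,2n, \quad n=1,2,\ldots,$$ and integers $m_n$ with $0 \leq \eta n \leq m_n \leq n$ ($n=1,2,\ldots$), such that for every $n \ge 1$: (i) $\eta_1 \sqrt{2n} \leq |P_{2n}(z)| \leq \eta_2 \sqrt{2n}$ for all $z \in \mathbb{C}$ with $|z|=1$; (ii) $a_{j,n} = -a_{2n-j,n}$ for all integers $j$ with $0 \leq j < n-m_n$; (iii) $a_{j,n} = (-1)^{n-j} a_{2n-j,n}$ for all integers $j$ with $n-m_n \leq j \leq n$.
   Context: The constants $\eta_1,\eta_2,\eta$ do not depend on $n$. Polynomials with all coefficients in $\{-1,1\}$ are called Littlewood polynomials. *)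

(* Defs.v *)
From HB Require Import structures.
From mathcomp Require Import all_boot all_order all_algebra.
From mathcomp Require Import reals.
From mathcomp Require Import complex.

Set Implicit Arguments.
Unset Strict Implicit.
Unset Printing Implicit Defensive.

Import Order.TTheory GRing.Theory Num.Theory.

Local Open Scope ring_scope.
Local Open Scope complex_scope.

Definition poly_of_coefs (R : realType) (a : nat -> int) (d : nat) : {poly R[i]} :=
  \sum_(j < d.+1) (a j)%:~R *: 'X^j.

(* Main.v *)
Require Import Defs.
From HB Require Import structures.
From mathcomp Require Import all_boot all_order all_algebra.
From mathcomp Require Import ring lra zify.
From mathcomp Require Import boolp classical_sets functions reals topology.
From mathcomp Require Import normedtype derive realfun sequences exp trigo.
From mathcomp Require Import complex.

(** The polynomial z^(-n) P(z) has real part 2 Re F(z^2) - 1 or 2 Re F(z^2) + 1, with F a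
    Rudin-Shapiro polynomial of length 2T, T = 2^t comparable to a small multiple of n,
    and imaginary part a sum of sines, whose signs are still free. The mean of (Re F)^2 against a
    Fejer kernel of width 1/T is at least of order T, so Re F is large somewhere in
    each window of length O(1/T); as Re F is band-limited, Lagrange interpolation then
    bounds the number of separated points of such a window where Re F is tiny. Hence
    the points where the real part is smaller than c sqrt(n) are covered by few cells
    of length 1/n, which fall into short clusters that are far from each other. The
    sines are chosen to be large there: prescribe +- sqrt(n) on each cluster by a sum
    of positive kernels, choose the signs of the clusters by Spencer's partial
    colouring method so that all the resulting sine coefficients lie in [-1, 1], and
    round these coefficients to +-1, again by partial colouring, at a uniform cost
    O(sqrt n) that the prescribed value absorbs. *)

Set Implicit Arguments.
Unset Strict Implicit.
Unset Printing Implicit Defensive.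

Import Order.TTheory GRing.Theory Num.Theory.
Import numFieldNormedType.Exports.

Local Open Scope ring_scope.
Local Open Scope complex_scope.
Local Notation "z ^*" := (conjc z) : ring_scope.
Local Notation Re := complex.Re.
Local Notation Im := complex.Im.

(** * Discrepancy *)

(** Conditions (ii) and (iii) dictate which frequencies of z^(-n) P(z) carry cosines: the even k up
    to m. All odd frequencies carry sines, and the target is built from these alone. Since every
    sine vanishes at z = 1 and z = -1, the real part must be large there by itself, which is why
    F(1) is estimated separately. The constants look circular. The sine coefficients fit into
    [-1, 1] only if the bad cells are few compared with n, so n / T must exceed some G depending on
    the number 2K of bad cells allowed in a window; yet points of different cells are separated by
    only about 1 / (G T). The circle is broken because K depends on neither the separation nor G: a
    smaller separation only lowers the threshold delta below which a value counts as tiny. So K is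
    chosen first, then G, then delta. The cost of the final rounding does not depend on the
    prescribed height, so the height S0 sqrt(n) is fixed in advance, large enough to survive it. *)

Section ExponentialSums.
Variable R : realType.
Implicit Types (x y : R).

(** A crude cosh bound obtained without power series: for |x| >= 1/2 use |x| <= 2 x^2, and for
    smaller x use e^x <= 1 / (1 - x), so that the sum is at most 2 / (1 - x^2). *)
Lemma cosh_le_expR x : expR x + expR (- x) <= 2 * expR (2 * x ^+ 2).
Proof.
wlog x0 : x / 0 <= x.
  move=> H; case: (lerP 0 x) => [/H //|x0].
  by have := H (- x); rewrite opprK sqrrN addrC oppr_ge0 (ltW x0); apply.
case: (lerP (1 / 2) x) => xh.
  have h1 : expR x <= expR (2 * x ^+ 2) by rewrite ler_expR; nra.
  have h2 : expR (- x) <= expR (2 * x ^+ 2) by rewrite ler_expR; nra.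
  by lra.
have h1 : expR x * (1 - x) <= 1.
  by rewrite -[leRHS](expRxMexpNx_1 x) ler_wpM2l ?expR_ge0// expR_ge1Dx.
have h2 : expR (- x) * (1 + x) <= 1.
  by rewrite -[leRHS](expRxMexpNx_1 x) mulrC ler_wpM2r ?expR_ge0// expR_ge1Dx.
have h3 : 1 <= expR (2 * x ^+ 2) * (1 - x ^+ 2).
  have y1 : x ^+ 2 <= 1 / 4 by nra.
  have := expR_ge1Dx (2 * x ^+ 2); have := sqr_ge0 x; move: y1.
  set y := x ^+ 2; set e := expR _ => y1 y0 ey.
  by apply: le_trans (_ : (1 + 2 * y) * (1 - y) <= _); [nra | rewrite ler_pM2r; lra].
have h4 : 0 < 1 - x ^+ 2 by nra.
rewrite -(ler_pM2r h4).
apply: le_trans (_ : 2 <= _); last by rewrite -mulrA; lra.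
have -> : (expR x + expR (- x)) * (1 - x ^+ 2) =
  expR x * (1 - x) * (1 + x) + expR (- x) * (1 + x) * (1 - x) by ring.
have : expR x * (1 - x) * (1 + x) <= 1 * (1 + x) by rewrite ler_pM2r; lra.
have : expR (- x) * (1 + x) * (1 - x) <= 1 * (1 - x) by rewrite ler_pM2r; lra.
lra.
Qed.

(** The graph of exp lies above its tangent at -c. *)
Lemma jensen_expR (T : finType) (f : T -> R) (c : R) :
  \sum_t f t <= #|T|%:R * c -> #|T|%:R * expR (- c) <= \sum_t expR (- f t).
Proof.
move=> H.
have: \sum_t (expR (- c) * (1 + (c - f t))) <= \sum_t expR (- f t).
  apply: ler_sum => t _.
  rewrite [in leRHS](_ : - f t = - c + (c - f t)); last by ring.
  by rewrite expRD ler_pM2l ?expR_gt0// expR_ge1Dx.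
apply: le_trans; rewrite -mulr_sumr mulrC ler_pM2l ?expR_gt0//.
by rewrite big_split/= sumrB !sumr_const -[X in X + _]mulr_natl -[X in _ + (X - _)]mulr_natl; lra.
Qed.

Definition sgb (b : bool) : R := (-1) ^+ b.

Lemma sgb_norm b : `|sgb b| = 1.
Proof. by rewrite /sgb normr_sign. Qed.

Lemma sum_ffun_prod (T : finType) (S : {set T}) (g : T -> bool -> R) :
  \sum_(f : {ffun T -> bool}) \prod_(t in S) g t (f t) =
  2 ^+ #|~: S| * \prod_(t in S) (g t true + g t false).
Proof.
transitivity (\sum_(f : {ffun T -> bool}) \prod_t (if t \in S then g t (f t) else 1)).
  by apply: eq_bigr => f _; rewrite big_mkcond.
rewrite -(bigA_distr_bigA (fun t b => if t \in S then g t b else 1)) /=.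
rewrite (bigID [in S]) /= mulrC; congr (_ * _).
  rewrite (eq_bigr (fun=> 2)) => [|t /negbTE ->]; last by rewrite big_bool/= ; ring.
  by rewrite prodr_const; congr (_ ^+ _); apply: eq_card => t; rewrite !inE.
by apply: eq_bigr => t ->; rewrite big_bool.
Qed.

Lemma hoeffding_mgf (T : finType) (S : {set T}) (a : T -> R) :
  (forall t, `|a t| <= 1) -> forall mu : R,
  \sum_(f : {ffun T -> bool})
     (expR (mu * \sum_(t in S) a t * sgb (f t)) +
      expR (- (mu * \sum_(t in S) a t * sgb (f t))))
  <= 2 ^+ #|T| * 2 * expR (2 * mu ^+ 2 * #|S|%:R).
Proof.
move=> a1 mu.
suff H nu : nu ^+ 2 = mu ^+ 2 -> \sum_(f : {ffun T -> bool})
     expR (nu * \sum_(t in S) a t * sgb (f t))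
     <= 2 ^+ #|T| * expR (2 * mu ^+ 2 * #|S|%:R).
  rewrite big_split/=; under [X in _ + X]eq_bigr do rewrite -mulNr.
  have := H mu erefl; have := H (- mu) (sqrrN _); lra.
move=> numu.
under eq_bigr do rewrite mulr_sumr expR_sum.
rewrite (sum_ffun_prod S (fun t b => expR (nu * (a t * sgb b)))).
rewrite -(cardsC S) addnC exprD -mulrA ler_pM2l ?exprn_gt0//.
rewrite (_ : 2 ^+ #|S| * _ = \prod_(t in S) (2 * expR (2 * mu ^+ 2))); last first.
  by rewrite prodr_const exprMn -expRM_natr.
apply: ler_prod => t _; rewrite addr_ge0 ?expR_ge0//= /sgb expr1 expr0 mulr1 mulrN1 mulrN.
rewrite addrC; apply: le_trans (cosh_le_expR _) _.
rewrite ler_pM2l// ler_expR ler_pM2l//.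
rewrite exprMn numu ler_piMr ?sqr_ge0//.
by rewrite -real_normK ?num_real// exprn_ile1.
Qed.

(** Generating function of the distance to [f0] on [S]. At y = e^(-1) it gives a Chernoff bound for
    the size of a Hamming ball. *)
Lemma hamming_ball (T : finType) (S : {set T}) (f0 : {ffun T -> bool}) (y : R) :
  \sum_(f : {ffun T -> bool}) y ^+ #|[set t in S | f t != f0 t]| =
  2 ^+ #|~: S| * (1 + y) ^+ #|S|.
Proof.
transitivity (\sum_(f : {ffun T -> bool}) \prod_(t in S) (if f t != f0 t then y else 1)).
  apply: eq_bigr => f _; rewrite -big_mkcondr/= prodr_const; congr (_ ^+ _).
  by apply: eq_card => t; rewrite !inE.
rewrite (sum_ffun_prod S (fun t b => if b != f0 t then y else 1)).
congr (_ * _); rewrite -prodr_const; apply: eq_bigr => t _.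
by case: (f0 t); rewrite /= ?[y + 1]addrC.
Qed.

Lemma sum_geom_le (e : R) c : 0 <= e -> e <= 1 / 2 -> \sum_(v < c) e ^+ v.+1 <= 2 * e.
Proof.
move=> e0 e1; suff : (\sum_(v < c) e ^+ v.+1) * (1 - e) <= e.
  have : 0 <= \sum_(v < c) e ^+ v.+1 by apply: sumr_ge0 => v _; rewrite exprn_ge0.
  nra.
suff -> : (\sum_(v < c) e ^+ v.+1) * (1 - e) = e - e ^+ c.+1.
  by rewrite gerBl exprn_ge0.
elim: c => [|c IH]; first by rewrite big_ord0 mul0r expr1 subrr.
by rewrite big_ord_recr/= mulrDl IH !exprS; ring.
Qed.

Lemma sum_two_sided_geom (L : R) c : expR (- L) <= 1 / 2 ->
  \sum_(v < c + c.+1) expR (- (L * `|v%:R - c%:R|)) <= 1 + 4 * expR (- L).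
Proof.
move=> Lh; rewrite big_split_ord/= big_ord_recl/= addn0 subrr normr0 mulr0 oppr0 expR0.
rewrite (_ : \sum_(i < c) _ = \sum_(v < c) expR (- L) ^+ v.+1); last first.
  rewrite (reindex_inj rev_ord_inj)/=; apply: eq_bigr => i _.
  rewrite -expRM_natl; congr expR; rewrite natrB// distrC ger0_norm; last by rewrite subr_ge0 lerBlDr lerDl.
  by ring.
rewrite (_ : \sum_(i < c) expR (- (L * `|(c + bump 0 i)%:R - c%:R|)) = \sum_(v < c) expR (- L) ^+ v.+1); last first.
  apply: eq_bigr => i _; rewrite -expRM_natl /bump/= add1n natrD addrAC subrr add0r normr_nat.
  by congr expR; ring.
by have := sum_geom_le c (expR_ge0 (- L)) Lh; lra.
Qed.

End ExponentialSums.

Section RoundedSums.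
Variable R : realType.
Implicit Types (x y : R).

(** Discrepancy bounds are stated with (m N)^(1/4) = sqrt(N) (m / N)^(1/4), weaker than Spencer's
    sqrt(N log(2 m / N)) but a pure power of N, so that iterating partial colourings gives a
    geometric series. *)
Definition rt4 x := Num.sqrt (Num.sqrt x).

Lemma rt4_ge0 x : 0 <= rt4 x. Proof. exact: sqrtr_ge0. Qed.

Lemma rt4K x : 0 <= x -> rt4 x ^+ 4 = x.
Proof. by move=> x0; rewrite -[4%N]/(2 * 2)%N exprM !sqr_sqrtr ?sqrtr_ge0. Qed.

Lemma ler_rt4 x y : x <= y -> rt4 x <= rt4 y.
Proof. by move=> xy; rewrite /rt4 !ler_wsqrtr. Qed.

Lemma rounding_eq_close (x y Lam c : R) : 0 < Lam ->
  0 <= x / (2 * Lam) + c -> 0 <= y / (2 * Lam) + c ->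
  Num.truncn (x / (2 * Lam) + c) = Num.truncn (y / (2 * Lam) + c) ->
  `|x - y| <= 2 * Lam.
Proof.
move=> L0 x0 y0 e.
have /andP[] := truncn_itv x0; have /andP[] := truncn_itv y0; rewrite e.
set v := Num.truncn _; rewrite -[v.+1%:R]natr1 => h1 h2 h3 h4.
have L2 : 0 < 2 * Lam by lra.
have : `|x / (2 * Lam) - y / (2 * Lam)| <= 1 by rewrite ler_norml; apply/andP; split; lra.
by rewrite -mulrBl normrM normfV (gtr0_norm L2) ler_pdivrMr// mul1r.
Qed.

(** Thanks to the 1/2, the cell of [c] is centred at x = 0, so the left side vanishes for |x| < Lam.
    Otherwise it is at most |x| / Lam <= 1 + nu (|x| - Lam) <= e^(nu (|x| - Lam)), which a moment
    generating function controls. *)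
Lemma rounding_deviation (x Lam nu : R) (c : nat) : 0 < Lam -> 1 <= nu * Lam ->
  0 <= x / (2 * Lam) + c%:R + 1 / 2 ->
  `|(Num.truncn (x / (2 * Lam) + c%:R + 1 / 2))%:R - c%:R| <=
    expR (- (nu * Lam)) * (expR (nu * x) + expR (- (nu * x))).
Proof.
move=> L0 nuL x0.
have L2 : 0 < 2 * Lam by lra.
have /andP[] := truncn_itv x0; set v := Num.truncn _; rewrite -[v.+1%:R]natr1 => h1 h2.
case: (ltrP `|x| Lam) => xL.
  suff -> : v = c by rewrite subrr normr0 mulr_ge0 ?expR_ge0// addr_ge0 ?expR_ge0.
  move: xL; rewrite ltr_norml => /andP[xl1 xl2].
  have xh : - (1 / 2) < x / (2 * Lam) < 1 / 2.
    by rewrite ltr_pdivlMr// ltr_pdivrMr//; apply/andP; split; lra.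
  have : (v%:R < c%:R + 1 :> R) by case/andP: xh; lra.
  have : (c%:R < v%:R + 1 :> R) by case/andP: xh; lra.
  by rewrite !natr1 !ltr_nat; lia.
have nu0 : 0 < nu by rewrite -(pmulr_lgt0 _ L0); lra.
have xe : expR (nu * `|x|) <= expR (nu * x) + expR (- (nu * x)).
  case: (lerP 0 x) => hx; first by rewrite ger0_norm// lerDl expR_ge0.
  by rewrite ltr0_norm// mulrN lerDr expR_ge0.
apply: le_trans (_ : expR (- (nu * Lam)) * expR (nu * `|x|) <= _); last first.
  by rewrite ler_pM2l ?expR_gt0.
rewrite -expRD; apply: le_trans (expR_ge1Dx _).
apply: le_trans (_ : `|x| / Lam <= _).
  have e : `|x| / Lam = `|x / (2 * Lam)| + `|x / (2 * Lam)|.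
    rewrite normrM normfV (gtr0_norm L2) invfM; field; lra.
  have : 1 <= `|x| / Lam by rewrite ler_pdivlMr// mul1r.
  have := ler_norm (x / (2 * Lam)); have := ler_norm (- (x / (2 * Lam))).
  by rewrite normrN ler_norml => *; apply/andP; split; lra.
have inv : 1 / Lam <= nu by rewrite ler_pdivrMr.
rewrite (_ : `|x| / Lam = 1 + (`|x| - Lam) * (1 / Lam)); last by field; lra.
by have : 0 <= `|x| - Lam; [rewrite subr_ge0|nra].
Qed.

End RoundedSums.

Section PartialColoring.
Variable R : realType.
Implicit Types (x y : R).

Lemma expR_sqr_ge x : 0 <= x -> x ^+ 2 / 4 <= expR x.
Proof.
move=> x0; have -> : expR x = expR (x / 2) ^+ 2 by rewrite -expRM_natl; congr expR; field.
have := expR_ge1Dx (x / 2); set e := expR _ => ?.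
by apply: le_trans (_ : (x / 2) ^+ 2 <= _); [rewrite expr_div_n; lra | rewrite ler_pXn2r ?nnegrE//; lra].
Qed.

(** Here 11/40 = 1/20 + 1/8 + 1/10 adds up the losses in [partial_coloring_pair]: Jensen's
    inequality, the Hamming radius and the total weight. *)
Lemma expRN1_lt : (1 + expR (- 1)) * expR (11 / 40) < 2 :> R.
Proof.
have h1 : 9 / 4 <= expR 1 :> R.
  have -> : expR 1 = expR (1 / 2) ^+ 2 :> R by rewrite -expRM_natl; congr expR; field.
  have := @expR_ge1Dx R (1 / 2); set e := expR _ => ?.
  by apply: le_trans (_ : (3 / 2) ^+ 2 <= _); [rewrite expr_div_n; lra | rewrite ler_pXn2r ?nnegrE//; lra].
have h2 : expR (- 1) <= 4 / 9 :> R.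
  by have := @expRxMexpNx_1 R 1; have := @expR_gt0 R (-1); nra.
have h3 : expR (11 / 40) <= 40 / 29 :> R.
  by have := @expRxMexpNx_1 R (11/40); have := @expR_ge1Dx R (- (11/40)); have := @expR_gt0 R (11/40); nra.
have := @expR_gt0 R (-1); have := @expR_gt0 R (11/40); nra.
Qed.

Section Partial.
Variables (T : finType) (S : {set T}) (m : nat) (a : 'I_m -> T -> R).
Hypotheses (a1 : forall i t, `|a i t| <= 1) (S0 : (0 < #|S|)%N) (Sm : (#|S| <= m)%N).

(** [nu] minimises 2 nu^2 N - nu Lam, with minimum -2 L. The factor 15 makes L^2 / 4 at least 40 m /
    N, hence m e^(-L) <= N / 40. *)
Let N : R := #|S|%:R.
Let Lam : R := 15 * rt4 (m%:R * N).
Let L : R := Lam ^+ 2 / (16 * N).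
Let nu : R := Lam / (4 * N).
Let X i (f : {ffun T -> bool}) : R := \sum_(t in S) a i t * sgb R (f t).
Let c := #|S|.+1.

Let N1 : 1 <= N. Proof. by rewrite /N ler1n. Qed.
Let Nm : N <= m%:R. Proof. by rewrite /N ler_nat. Qed.

Let Lam4 : Lam ^+ 4 = 15 ^+ 4 * (m%:R * N).
Proof. by rewrite /Lam exprMn rt4K ?mulr_ge0//; ring. Qed.

Let Lam_ge15 : 15 <= Lam.
Proof.
suff : 1 <= rt4 (m%:R * N) by rewrite /Lam; lra.
rewrite -(@ler_pXn2r _ 4) ?nnegrE ?rt4_ge0// rt4K ?mulr_ge0// expr1n.
by have := Nm; have := N1; nra.
Qed.

Let nuLam : nu * Lam = 4 * L.
Proof. by rewrite /nu /L; field; have := N1; lra. Qed.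

Let nuN : 2 * nu ^+ 2 * N = 2 * L.
Proof. by rewrite /nu /L; field; have := N1; lra. Qed.

Let L_sqr : L ^+ 2 = 15 ^+ 4 / 256 * (m%:R / N).
Proof.
have -> : L ^+ 2 = Lam ^+ 4 / (256 * N ^+ 2) by rewrite /L; field; have := N1; lra.
by rewrite Lam4; field; have := N1; lra.
Qed.

Let L_ge1 : 1 <= L.
Proof.
have L0 : 0 <= L by rewrite /L mulr_ge0 ?sqr_ge0// invr_ge0; have := N1; lra.
suff : 1 <= L ^+ 2 by nra.
suff : 1 <= m%:R / N by rewrite L_sqr; lra.
by have := Nm; rewrite ler_pdivlMr ?mul1r//; have := N1; lra.
Qed.

Let expNL : m%:R * expR (- L) <= N / 40.
Proof.
have h : 40 * (m%:R / N) <= expR L.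
  apply: le_trans (expR_sqr_ge _); last by have := L_ge1; lra.
  rewrite L_sqr; suff : 0 <= m%:R / N by lra.
  by rewrite divr_ge0 ?ler0n//.
rewrite expRN ler_pdivrMr ?expR_gt0//.
have : 40 * (m%:R / N) * N <= expR L * N by rewrite ler_pM2r//; have := N1; lra.
by rewrite -mulrA divfK ?gt_eqF//; have := N1; lra.
Qed.

Let X_bound i f : `|X i f| <= N.
Proof.
apply: le_trans (ler_norm_sum _ _ _) _; rewrite /N -sum1_card natr_sum.
by apply: ler_sum => t _; rewrite normrM sgb_norm mulr1.
Qed.

Let X_div_bound i f : `|X i f / (2 * Lam)| <= N / 2.
Proof.
have := X_bound i f; have := Lam_ge15 => ? ?.
have L2 : 0 < 2 * Lam by lra.
by rewrite normrM normfV (gtr0_norm L2) ler_pdivrMr//; have := N1; nra.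
Qed.

(** The shift by [c] makes the argument nonnegative, where [Num.truncn] is the floor; the value [c]
    then stands for a sum rounded to 0. *)
Let rarg i f := X i f / (2 * Lam) + c%:R + 1 / 2.

Let rarg_ge0 i f : 0 <= rarg i f.
Proof.
have := X_div_bound i f; rewrite ler_norml /rarg /c -[#|S|.+1%:R]natr1 -/N => /andP[? ?].
by have := N1; lra.
Qed.

Let rv i f := Num.truncn (rarg i f).

Let rv_lt i f : (rv i f < c + c.+1)%N.
Proof.
have /andP[h _] := truncn_itv (rarg_ge0 i f).
have := X_div_bound i f; rewrite ler_norml => /andP[_ h2].
rewrite -(ltr_nat R); apply: le_lt_trans h _; rewrite /rarg natrD /c -[#|S|.+2%:R]natr1 -[#|S|.+1%:R]natr1 -/N.
by have := N1; lra.
Qed.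

Let cls f : {ffun 'I_m -> 'I_(c + c.+1)} := [ffun i => Ordinal (rv_lt i f)].

Let cls_close f g : cls f = cls g -> forall i, `|X i f - X i g| <= 2 * Lam.
Proof.
move=> /ffunP e i; have := e i; rewrite !ffunE => /(congr1 val)/=; rewrite /rv /rarg -!addrA.
apply: rounding_eq_close; first by have := Lam_ge15; lra.
  by have := rarg_ge0 i f; rewrite /rarg addrA.
by have := rarg_ge0 i g; rewrite /rarg addrA.
Qed.

Let mean_dev i : \sum_f `|(rv i f)%:R - c%:R| <= 2 ^+ #|T| * 2 * expR (- (2 * L)).
Proof.
have Lam0 : 0 < Lam by have := Lam_ge15; lra.
apply: le_trans (_ : \sum_f expR (- (nu * Lam)) * (expR (nu * X i f) + expR (- (nu * X i f))) <= _).
  apply: ler_sum => f _; apply: rounding_deviation => //; last exact: rarg_ge0.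
  by rewrite nuLam; have := L_ge1; lra.
rewrite -mulr_sumr; apply: le_trans (_ : expR (- (nu * Lam)) * (2 ^+ #|T| * 2 * expR (2 * nu ^+ 2 * N)) <= _).
  by rewrite ler_pM2l ?expR_gt0// hoeffding_mgf.
by rewrite mulrCA -expRD nuLam nuN ler_wpM2l ?mulr_ge0 ?exprn_ge0// ler_expR; lra.
Qed.

(** A substitute for entropy in Spencer's argument: products of [weight] form a nearly normalised
    measure on the classes ([weight_sum]), while its sum over all colourings is almost 2^|T|
    ([weight_total]). So some class must be exponentially large. *)
Let weight (v : nat) : R := expR (- (L * `|v%:R - c%:R|)).

Let weight_total : 2 ^+ #|T| * expR (- (N / 20)) <= \sum_f \prod_i weight (cls f i).
Proof.
have -> : \sum_f \prod_i weight (cls f i) =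
    \sum_f expR (- \sum_i (L * `|(rv i f)%:R - c%:R|)).
  apply: eq_bigr => f _; rewrite -sumrN expR_sum; apply: eq_bigr => i _.
  by rewrite /weight ffunE.
have card_ffun : #|{: {ffun T -> bool}}|%:R = 2 ^+ #|T| :> R.
  by rewrite card_ffun card_bool natrX.
rewrite -card_ffun; apply: jensen_expR; rewrite card_ffun exchange_big/=.
apply: le_trans (_ : \sum_(i < m) L * (2 ^+ #|T| * 2 * expR (- (2 * L))) <= _).
  by apply: ler_sum => i _; rewrite -mulr_sumr ler_wpM2l//; have := L_ge1; lra.
rewrite sumr_const card_ord -[leLHS]mulr_natl.
have -> : expR (- (2 * L)) = expR (- L) * expR (- L) by rewrite -expRD; congr expR; ring.
have Le : L * expR (- L) <= 1.
  by rewrite expRN ler_pdivrMr ?expR_gt0// mul1r; have := expR_ge1Dx L; lra.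
have -> : m%:R * (L * (2 ^+ #|T| * 2 * (expR (- L) * expR (- L)))) =
  2 ^+ #|T| * (2 * (L * expR (- L)) * (m%:R * expR (- L))) by ring.
rewrite ler_pM2l ?exprn_gt0//.
have : 0 <= m%:R * expR (- L) by rewrite mulr_ge0// expR_ge0.
by have := expNL; have := L_ge1; have := expR_gt0 (- L); nra.
Qed.

Let weight_sum : \sum_(b : {ffun 'I_m -> 'I_(c + c.+1)}) \prod_i weight (b i) <= expR (N / 10).
Proof.
rewrite -(bigA_distr_bigA (fun _ (v : 'I_(c + c.+1)) => weight v))/= prodr_const card_ord.
have e0 := expR_gt0 (- L).
have eh : expR (- L) <= 1 / 2.
  by have := expNL; have := Nm; have := N1; nra.
apply: le_trans (_ : expR (4 * expR (- L)) ^+ m <= _).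
  rewrite lerXn2r ?nnegrE ?expR_ge0//; first by apply: sumr_ge0 => v _; exact: expR_ge0.
  by apply: le_trans (sum_two_sided_geom _ eh) _; rewrite expR_ge1Dx.
by rewrite -expRM_natl ler_expR; have := expNL; lra.
Qed.

Let diffs (f g : {ffun T -> bool}) : {set T} := [set t in S | f t != g t].

(* Were each class of cls contained in a Hamming ball of radius |S|/8, the classes would
   be too small to carry the weights, whose mean Jensen's inequality bounds from below. *)
Lemma partial_coloring_pair : exists f g : {ffun T -> bool},
  (#|S| < 8 * #|diffs f g|)%N /\ forall i, `|X i f - X i g| <= 2 * Lam.
Proof.
apply/not_existsP => H.
have near f g : cls f = cls g -> (8 * #|diffs f g| <= #|S|)%N.
  move=> /cls_close fg; rewrite leqNgt; apply/negP => fg'.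
  by apply: (H f); exists g.
(* [hamming_ball] at y = e^(-1): each member of a class is within N / 8 of a fixed member, so it
   contributes at least e^(-N / 8). *)
pose s : R := 2 ^+ #|~: S| * (1 + expR (- 1)) ^+ #|S| * expR (N / 8).
have s0 : 0 <= s by rewrite /s !mulr_ge0 ?exprn_ge0 ?expR_ge0// addr_ge0 ?expR_ge0.
have class_size b : #|[set f | cls f == b]|%:R <= s.
  have [-> | [g]] := set_0Vmem [set f | cls f == b]; first by rewrite cards0.
  rewrite inE => /eqP gb.
  rewrite /s -(hamming_ball S g) mulr_suml -sum1_card natr_sum big_mkcond/=.
  apply: ler_sum => f _; case: ifPn => [|_]; last by rewrite mulr_ge0 ?exprn_ge0 ?expR_ge0.
  rewrite inE => /eqP fb; rewrite -expRM_natl -expRD -[1%:R]expR0 ler_expR.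
  have := near f g; rewrite fb gb => /(_ erefl); rewrite -(ler_nat R) natrM -/N /diffs.
  by lra.
have : 2 ^+ #|T| * expR (- (N / 20)) <= s * expR (N / 10).
  apply: le_trans weight_total _.
  rewrite (partition_big cls xpredT)//=.
  apply: le_trans (_ : \sum_(b : {ffun 'I_m -> 'I_(c + c.+1)}) s * \prod_i weight (b i) <= _); last first.
    by rewrite -mulr_sumr ler_wpM2l.
  apply: ler_sum => b _.
  have const_class f : cls f == b -> \prod_i weight (cls f i) = \prod_i weight (b i) by move=> /eqP ->.
  rewrite (eq_bigr _ const_class).
  rewrite sumr_const -[leLHS]mulr_natl ler_wpM2r//; last first.
    by apply: le_trans (class_size b); rewrite ler_nat;
      apply: eq_leq; apply: eq_card => f; rewrite [RHS]inE unfold_in.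
  by apply: prodr_ge0 => i _; exact: expR_ge0.
apply/negP; rewrite -ltNge -(cardsC S) addnC exprD /s -!mulrA ltr_pM2l ?exprn_gt0//.
rewrite -expRD -ltr_pdivlMr ?expR_gt0// -mulrA -expRN -expRD.
have -> : expR (- (N / 20) - (N / 8 + N / 10)) = (expR (11 / 40) ^+ #|S|)^-1.
  by rewrite -expRM_natl -/N -expRN; congr expR; field.
rewrite ltr_pdivlMr ?exprn_gt0 ?expR_gt0//.
by rewrite -exprMn ltrXn2r ?expRN1_lt ?nnegrE ?mulr_ge0 ?addr_ge0 ?expR_ge0// -lt0n.
Qed.

(** Half the difference of the two colourings vanishes where they agree and equals the first one
    where they differ. *)
Lemma partial_coloring : exists (S1 : {set T}) (f : {ffun T -> bool}),
  [/\ S1 \subset S, (#|S| < 8 * #|S1|)%N &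
      forall i, `|\sum_(t in S1) a i t * sgb R (f t)| <= Lam].
Proof.
have [f [g [card_fg fg]]] := partial_coloring_pair.
exists (diffs f g), f; split => //; first by apply/fintype.subsetP => t; rewrite inE => /andP[].
move=> i; have := fg i.
suff -> : X i f - X i g = 2 * \sum_(t in diffs f g) a i t * sgb R (f t).
  by rewrite normrM ger0_norm// ler_pM2l.
rewrite /X -sumrB (bigID (fun t => f t != g t))/= [X in _ + X]big1 ?addr0; last first.
  by move=> t /andP[_ /negPn/eqP ->]; rewrite subrr.
rewrite mulr_sumr; apply: eq_big => [t|t /andP[_]]; first by rewrite inE.
by rewrite /sgb; case: (f t); case: (g t) => //= _; ring.
Qed.

End Partial.

End PartialColoring.

Section FullColoring.
Variables (R : realType) (T : finType) (m : nat) (a : 'I_m -> T -> R).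
Hypotheses (a1 : forall i t, `|a i t| <= 1).

(** Each round leaves at most 7/8 of the elements, and (7/8)^(1/4) <= 31/32, so the errors sum to at
    most 15 * 32 = 480 times the root. *)
Lemma full_coloring (S : {set T}) : (#|S| <= m)%N ->
  exists f : {ffun T -> bool}, forall i,
    `|\sum_(t in S) a i t * sgb R (f t)| <= 480 * rt4 (m%:R * #|S|%:R).
Proof.
move: {2}#|S| (leqnn #|S|) => n; elim: n S => [|n IH] S Sn Sm.
  exists [ffun=> false] => i; move: Sn; rewrite leqn0 cards_eq0 => /eqP ->.
  by rewrite big_set0 normr0 mulr_ge0 ?rt4_ge0.
have [-> | /finset.set0Pn S0] := eqVneq S finset.set0.
  by exists [ffun=> false] => i; rewrite big_set0 normr0 mulr_ge0 ?rt4_ge0.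
have S_gt0 : (0 < #|S|)%N by apply/card_gt0P.
have [S1 [f1 [S1S S1big f1P]]] := partial_coloring a1 S_gt0 Sm.
have := cardsID S1 S; rewrite (finset.setIidPr S1S) => cardD.
have [|| f2 f2P] := IH (S :\: S1); [lia | lia |].
exists [ffun t => if t \in S1 then f1 t else f2 t] => i.
rewrite (big_setID S1)/= (finset.setIidPr S1S).
rewrite (eq_bigr (fun t => a i t * sgb R (f1 t))); last by move=> t tS1; rewrite ffunE tS1.
rewrite [X in _ + X](eq_bigr (fun t => a i t * sgb R (f2 t))); last first.
  by move=> t; rewrite inE ffunE => /andP[/negbTE ->].
apply: le_trans (ler_normD _ _) _.
have : rt4 (m%:R * #|S :\: S1|%:R) <= 31 / 32 * rt4 (m%:R * #|S|%:R) :> R.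
  rewrite -(@ler_pXn2r _ 4) ?nnegrE ?mulr_ge0 ?rt4_ge0//; last by lra.
  rewrite exprMn !rt4K ?mulr_ge0// mulrCA ler_wpM2l//.
  have : 8 * #|S :\: S1|%:R <= 7 * #|S|%:R :> R by rewrite -!natrM ler_nat; lia.
  by have : 0 <= #|S|%:R :> R by []; lra.
by have := f1P i; have := f2P i; lra.
Qed.

(* The binary digits of x are rounded away one at a time, starting from the last. *)
Lemma dyadic_rounding d (k : T -> nat) : (forall t, k t <= 2 ^ d)%N -> (#|T| <= m)%N ->
  exists f : {ffun T -> bool}, forall i,
    `|\sum_t a i t * (1 - 2 * (k t)%:R / 2 ^+ d - sgb R (f t))|
      <= 960 * rt4 (m%:R * #|T|%:R) * (1 - 2 ^- d).
Proof.
move=> kd Tm; elim: d k kd => [|d IH] k kd.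
  exists [ffun t => k t != 0] => i.
  rewrite big1 ?normr0 ?expr0 ?invr1 ?subrr ?mulr0// => t _.
  rewrite ffunE /sgb; have := kd t; rewrite expn0.
  by case: (k t) => [|[|//]] _ /=; field.
pose S := [set t | odd (k t)].
have cardS : (#|S| <= #|T|)%N by exact: max_card.
have [g gP] := full_coloring (leq_trans cardS Tm).
(* An odd [k t] moves up when the sign is -1 and down when it is +1, which changes the value by
   [sgb R (g t)] / 2^d; even ones are unchanged. *)
have [|f fP] := IH (fun t => (k t)./2 + (odd (k t) && g t))%N.
  move=> t; have := kd t; rewrite expnS.
  by case: (boolP (odd _)); case: (g t) => /=; lia.
exists f => i.
have D0 : (2 ^+ d : R) != 0 by rewrite gt_eqF ?exprn_gt0.
have -> : \sum_t a i t * (1 - 2 * (k t)%:R / 2 ^+ d.+1 - sgb R (f t)) =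
  \sum_t a i t * (1 - 2 * ((k t)./2 + (odd (k t) && g t))%:R / 2 ^+ d - sgb R (f t))
  - 2 ^- d * \sum_(t in S) a i t * sgb R (g t).
  rewrite mulr_sumr [X in _ - X]big_mkcond/= -sumrB; apply: eq_bigr => t _.
  rewrite /S inE -[X in 2 * X%:R / 2 ^+ d.+1](odd_double_half (k t)) exprS.
  by rewrite -muln2 !natrD natrM /sgb; case: (odd _); case: (g t) => /=; field.
apply: le_trans (ler_normB _ _) _.
have d0 : 0 < 2 ^- d :> R by rewrite invr_gt0 exprn_gt0.
have := fP i; rewrite [X in _ -> _ + X <= _]normrM [`|2 ^- d|]gtr0_norm//.
have -> : 2 ^- d.+1 = 2 ^- d / 2 :> R by rewrite exprS invfM mulrC.
have rS : rt4 (m%:R * #|S|%:R) <= rt4 (m%:R * #|T|%:R) :> R.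
  by apply: ler_rt4; rewrite ler_wpM2l// ler_nat.
have : 2 ^- d * `|\sum_(t in S) a i t * sgb R (g t)|
    <= 2 ^- d * (480 * rt4 (m%:R * #|T|%:R)).
  by rewrite ler_pM2l//; apply: le_trans (gP i) _; lra.
by lra.
Qed.

(** Truncating to |T| binary digits costs |T| * 2 / 2^|T| <= 2 in total, the additive constant. *)
Lemma coloring_rounding (x : T -> R) : (forall t, `|x t| <= 1) -> (#|T| <= m)%N ->
  exists f : {ffun T -> bool}, forall i,
    `|\sum_t a i t * (x t - sgb R (f t))| <= 960 * rt4 (m%:R * #|T|%:R) + 2.
Proof.
move=> x1 Tm; set d := #|T|.
have d0 : 0 < 2 ^+ d :> R by rewrite exprn_gt0.
pose k t := Num.truncn ((1 - x t) / 2 * 2 ^+ d).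
have kP t : (k t)%:R <= (1 - x t) / 2 * 2 ^+ d < (k t).+1%:R.
  apply: truncn_itv; rewrite mulr_ge0 ?(ltW d0)//.
  by have := x1 t; rewrite ler_norml; lra.
have [t|//|f fP] := @dyadic_rounding d k.
  rewrite -(ler_nat R) natrX; have /andP[h _] := kP t; apply: le_trans h _.
  by rewrite ler_piMl ?(ltW d0)//; have := x1 t; rewrite ler_norml => /andP[? ?]; lra.
exists f => i.
have -> : \sum_t a i t * (x t - sgb R (f t)) =
  \sum_t a i t * (1 - 2 * (k t)%:R / 2 ^+ d - sgb R (f t)) +
  \sum_t a i t * (x t - (1 - 2 * (k t)%:R / 2 ^+ d)).
  by rewrite -big_split/=; apply: eq_bigr => t _; ring.
apply: le_trans (ler_normD _ _) _; apply: lerD.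
  apply: le_trans (fP i) _; rewrite ler_piMr ?mulr_ge0 ?rt4_ge0//.
  by rewrite gerBl invr_ge0 ltW.
apply: le_trans (ler_norm_sum _ _ _) _.
apply: le_trans (_ : \sum_(t : T) 2 / 2 ^+ d <= _).
  apply: ler_sum => t _; rewrite normrM; apply: le_trans (ler_piMl _ (a1 i t)) _ => //.
  have /andP[h1 h2] := kP t; move: h2; rewrite -[(k t).+1%:R]natr1 => h2.
  have -> : x t - (1 - 2 * (k t)%:R / 2 ^+ d) =
     (2 / 2 ^+ d) * ((k t)%:R - (1 - x t) / 2 * 2 ^+ d) by field; rewrite gt_eqF.
  rewrite normrM ger0_norm ?divr_ge0 ?(ltW d0)// ler_piMr ?divr_ge0 ?(ltW d0)//.
  by rewrite ler_norml; apply/andP; split; lra.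
rewrite sumr_const -/d -[leLHS]mulr_natl mulrCA ler_piMr// ler_pdivrMr// mul1r.
by rewrite -natrX ler_nat ltnW// ltn_expl.
Qed.

End FullColoring.

(** * Trigonometric polynomials on the circle *)

Section Circle.
Variable R : realType.
Implicit Types (x y : R) (z w : R[i]) (p q : {poly R[i]}).

Definition expi x : R[i] := cos x +i* sin x.

Lemma expi0 : expi 0 = 1.
Proof. by rewrite /expi cos0 sin0. Qed.

Lemma expiD x y : expi (x + y) = expi x * expi y.
Proof. by rewrite /expi cosD sinD; simpc; congr (_ +i* _); ring. Qed.

Lemma conj_expi x : (expi x)^* = expi (- x).
Proof. by rewrite /expi cosN sinN. Qed.

Lemma expiX x k : expi x ^+ k = expi (k%:R * x).
Proof.
elim: k => [|k IH]; first by rewrite mul0r expi0.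
by rewrite exprS IH -expiD -natr1; congr expi; ring.
Qed.

Lemma expi2pi : expi (2 * pi) = 1.
Proof. by rewrite /expi mulr_natl cos2pi sin2pi. Qed.

Lemma expi_neq1 x : 0 < x < 2 * pi -> expi x != 1.
Proof.
move=> x2; apply/eqP => -[c1 _].
have : 0 < sin (x / 2) by apply: sin_gt0_pi; lra.
suff : sin (x / 2) ^+ 2 = 0 by move=> /eqP; rewrite expf_eq0/= => /eqP ->; rewrite ltxx.
have := cos_mulr2n (x / 2); rewrite [x / 2 *+ 2]mulr2n -splitr c1 mulr2n.
by have := cos2Dsin2 (x / 2); lra.
Qed.

(** The modulus as an element of [R]; the norm of [R[i]] takes its values in [R[i]]. *)
Definition nrm z : R := Num.sqrt (Re z ^+ 2 + Im z ^+ 2).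

Lemma nrm_normr z : `|z| = (nrm z)%:C.
Proof. by rewrite normc_def. Qed.

Lemma nrm_ge0 z : 0 <= nrm z. Proof. exact: sqrtr_ge0. Qed.

Lemma nrm_sqr z : nrm z ^+ 2 = Re z ^+ 2 + Im z ^+ 2.
Proof. by rewrite sqr_sqrtr// addr_ge0 ?sqr_ge0. Qed.

Lemma nrmM z w : nrm (z * w) = nrm z * nrm w.
Proof. by apply: complexI; rewrite rmorphM/= -!nrm_normr normrM. Qed.

Lemma nrmX z k : nrm (z ^+ k) = nrm z ^+ k.
Proof. by apply: complexI; rewrite rmorphXn/= -!nrm_normr normrX. Qed.

Lemma nrmN z : nrm (- z) = nrm z.
Proof. by apply: complexI; rewrite -!nrm_normr normrN. Qed.

Lemma nrmJ z : nrm z^* = nrm z.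
Proof. by apply: complexI; rewrite -!nrm_normr normcJ. Qed.

Lemma nrmD z w : nrm (z + w) <= nrm z + nrm w.
Proof. by rewrite -lecR rmorphD/= -!nrm_normr ler_normD. Qed.

Lemma nrm_sum (I : Type) (r : seq I) (P : pred I) (F : I -> R[i]) :
  nrm (\sum_(i <- r | P i) F i) <= \sum_(i <- r | P i) nrm (F i).
Proof.
rewrite -lecR rmorph_sum/= -nrm_normr; under [leRHS]eq_bigr do rewrite -nrm_normr.
exact: ler_norm_sum.
Qed.

Lemma nrm_real x : nrm x%:C = `|x|.
Proof. by rewrite /nrm/= expr0n addr0 sqrtr_sqr. Qed.

Lemma nrm_ReIm z : nrm z <= `|Re z| + `|Im z|.
Proof.
rewrite -(@ler_pXn2r _ 2) ?nnegrE ?nrm_ge0 ?addr_ge0// nrm_sqr sqrrD.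
by rewrite !real_normK ?num_real// -addrA lerD2l addrC lerDl mulrn_wge0// mulr_ge0.
Qed.

Lemma normr_Re_le z : `|Re z| <= nrm z.
Proof. by rewrite -sqrtr_sqr ler_wsqrtr// lerDl sqr_ge0. Qed.

Lemma normr_Im_le z : `|Im z| <= nrm z.
Proof. by rewrite -sqrtr_sqr ler_wsqrtr// lerDr sqr_ge0. Qed.

Lemma mulr_conj z : z * z^* = (nrm z ^+ 2)%:C.
Proof. by rewrite nrm_sqr add_Re2_Im2 sqr_normc. Qed.

Lemma nrm_expi x : nrm (expi x) = 1.
Proof. by rewrite /nrm /= cos2Dsin2 sqrtr1. Qed.

Lemma mulr_conj1 z : nrm z = 1 -> z * z^* = 1.
Proof. by rewrite mulr_conj => ->; rewrite expr1n. Qed.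

(** Sums over rotated N-th roots of unity replace integrals over the circle; they are exact as long
    as degrees stay below N. *)
Definition root_pt w (N y : nat) : R[i] := w * expi (2 * pi / N%:R) ^+ y.

Lemma nrm_root_pt w (N y : nat) : nrm w = 1 -> nrm (root_pt w N y) = 1.
Proof. by move=> w1; rewrite nrmM nrmX nrm_expi expr1n w1 mulr1. Qed.

Lemma root_pt_orth w N k l : nrm w = 1 -> (k < N)%N -> (l < N)%N ->
  \sum_(y < N) root_pt w N y ^+ k * (root_pt w N y ^+ l)^* = (N * (k == l))%:R.
Proof.
move=> w1 kN lN.
have N0 : (0 : R) < N%:R by rewrite ltr0n (leq_trans _ kN).
have [<-|kl] := eqVneq k l.
  rewrite (eq_bigr (fun=> 1)); first by rewrite sumr_const card_ord muln1.
  by move=> y _; rewrite mulr_conj1// nrmX nrm_root_pt ?expr1n.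
rewrite muln0.
pose d := 2 * pi / N%:R : R; pose r := expi (k%:R * d - l%:R * d).
rewrite (eq_bigr (fun y : 'I_N => w ^+ k * (w ^+ l)^* * r ^+ y)); last first.
  move=> y _; rewrite /root_pt -/d !exprMn rmorphM/=.
  rewrite mulrACA; congr (_ * _).
  by rewrite !expiX conj_expi -!expiD; congr expi; ring.
rewrite -mulr_sumr.
have r1 : r != 1.
  wlog lk : k l kl kN lN @r / (l < k)%N.
    move=> H; case: (ltngtP k l) => [kl'|lk'|e]; last by rewrite e eqxx in kl.
      have := H l k; rewrite eq_sym => /(_ kl lN kN kl'); apply: contraNN => /eqP e.
      by have := congr1 (@conjc R) e; rewrite conj_expi opprB conjc1 => ->.
    exact: H.
  apply: expi_neq1; rewrite -mulrBl -natrB; last exact: ltnW.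
  rewrite /d; set D : R := (k - l)%:R.
  have D0 : 0 < D by rewrite ltr0n subn_gt0.
  have DN : D < N%:R by rewrite ltr_nat; lia.
  have p0 := pi_gt0 R.
  rewrite mulr_gt0 ?divr_gt0 ?mulr_gt0//= mulrA ltr_pdivrMr//.
  by rewrite mulrC ltr_pM2l// mulr_gt0.
have := subrX1 r N; rewrite (_ : r ^+ N = 1).
  rewrite subrr => /esym/eqP; rewrite mulf_eq0 subr_eq0 (negbTE r1)/= => /eqP ->.
  by rewrite mulr0.
rewrite expiX (_ : N%:R * _ = k%:R * (2 * pi) - l%:R * (2 * pi)); last first.
  by rewrite /d; field; rewrite gt_eqF.
by rewrite expiD -conj_expi -(expiX (2 * pi) k) -(expiX (2 * pi) l) expi2pi !expr1n conjc1 mulr1.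
Qed.

Lemma sum_roots_conj w N p q : nrm w = 1 -> (size p <= N)%N -> (size q <= N)%N ->
  \sum_(y < N) p.[root_pt w N y] * q.[root_pt w N y]^* =
  N%:R * \sum_(k < N) p`_k * (q`_k)^*.
Proof.
move=> w1 pN qN.
under eq_bigr do rewrite (horner_coef_wide _ pN) (horner_coef_wide _ qN) rmorph_sum/= mulr_suml.
rewrite exchange_big/= mulr_sumr; apply: eq_bigr => k _.
under eq_bigr do rewrite mulr_sumr.
rewrite exchange_big/= (bigD1 k)//= [X in _ + X]big1 ?addr0 => [|l lk].
  rewrite (eq_bigr (fun y : 'I_N => p`_k * (q`_k)^* *
      (root_pt w N y ^+ k * (root_pt w N y ^+ k)^*))); last first.
    by move=> y _; rewrite rmorphM/= mulrACA.
  by rewrite -mulr_sumr root_pt_orth// eqxx muln1 mulrC.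
rewrite (eq_bigr (fun y : 'I_N => p`_k * (q`_l)^* *
      (root_pt w N y ^+ k * (root_pt w N y ^+ l)^*))); last first.
  by move=> y _; rewrite rmorphM/= mulrACA.
by rewrite -mulr_sumr root_pt_orth// eq_sym (negbTE lk : (val l == val k) = false) muln0 mulr0.
Qed.

End Circle.

(** * Fejer kernels, Bernstein's inequality and bounds from a grid *)

Section Fejer.
Variable R : realType.
Implicit Types (x y : R) (z w : R[i]) (p q : {poly R[i]}).

(** For |w| = 1 this is the geometric sum of (z / w)^j, whose squared modulus is m times the Fejer
    kernel centred at w. *)
Definition dirichlet w m : {poly R[i]} := \poly_(j < m) (w^* ^+ j).

Lemma sumr_const_window (V : zmodType) (c : V) k m N : (m <= N)%N ->
  \sum_(l < N | (k <= l < m)%N) c = c *+ (m - k).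
Proof.
move=> mN; rewrite -sumr_const_nat -(big_mkord (fun l => (k <= l < m)%N) (fun=> c)).
rewrite (big_nat_widen _ _ _ _ _ mN) (big_nat_widenl _ _ _ _ _ (leq0n k)).
by apply: eq_bigl => l; rewrite /= andbC.
Qed.

(** The Fejer multipliers are the truncated differences [m - k], zero for k >= m. The condition n +
    m <= N prevents aliasing. *)
Lemma fejer_sum w w0 n m N p : nrm w = 1 -> nrm w0 = 1 ->
  (size p <= n)%N -> (n + m <= N)%N ->
  \sum_(y < N) p.[root_pt w0 N y] * (nrm (dirichlet w m).[root_pt w0 N y] ^+ 2)%:C =
  N%:R * \sum_(k < n) p`_k * w ^+ k *+ (m - k).
Proof.
move=> w1 w01 pn nmN; set E := dirichlet w m.
have sE : (size E <= m)%N by exact: size_poly.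
under eq_bigr do rewrite (horner_coef_wide _ pn) mulr_suml.
rewrite exchange_big/= mulr_sumr; apply: eq_bigr => k _.
rewrite (eq_bigr (fun y : 'I_N => p`_k *
    (('X^k * E).[root_pt w0 N y] * (E.[root_pt w0 N y])^*))); last first.
  by move=> y _; rewrite -mulr_conj hornerM hornerXn !mulrA.
rewrite -mulr_sumr sum_roots_conj//; last 2 first.
- by apply: leq_trans (size_polyMleq _ _) _; rewrite size_polyXn; move: (size _) sE (ltn_ord k) => s; lia.
- by lia.
rewrite mulrCA; congr (_ * _); rewrite -mulrnAr; congr (_ * _).
rewrite -(@sumr_const_window _ _ k m N) ?[in RHS]big_mkcond; last by lia.
apply: eq_bigr => l _; rewrite coefXnM !coef_poly.
case: (ltnP l k) => lk; first by rewrite mul0r.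
rewrite andTb; case: (ltnP l m) => lm; last by rewrite conjc0 mulr0.
rewrite (leq_ltn_trans (leq_subr _ _) lm) rmorphXn/= conjcK -{2}(subnK lk) exprD mulrA -exprMn.
by rewrite [_^* * _]mulrC mulr_conj1// expr1n mul1r.
Qed.

Lemma fejer_mass w w0 m N : nrm w = 1 -> nrm w0 = 1 -> (m < N)%N ->
  \sum_(y < N) nrm (dirichlet w m).[root_pt w0 N y] ^+ 2 = N%:R * m%:R.
Proof.
move=> w1 w01 mN; apply: complexI; rewrite rmorph_sum rmorphM /= !rmorph_nat.
have := @fejer_sum w w0 1 m N 1 w1 w01; rewrite size_poly1 => /(_ isT mN).
rewrite big_ord1 coef1 eqxx expr0 mulr1 subn0 => <-.
by apply: eq_bigr => y _; rewrite hornerC mul1r.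
Qed.

Definition zderiv p := 'X * p^`().

Lemma size_zderiv p n : (size p <= n)%N -> (size (zderiv p) <= n)%N.
Proof.
move=> pn; have [->|p0] := eqVneq p 0; first by rewrite /zderiv linear0 mulr0 size_poly0.
rewrite (leq_trans _ pn)// /zderiv mulrC; have := lt_size_deriv p0.
by have [->|d0] := eqVneq p^`() 0; rewrite ?mul0r ?size_poly0// size_mulX.
Qed.

Lemma coef_zderiv p k : (zderiv p)`_k = p`_k *+ k.
Proof. by rewrite /zderiv coefXM coef_deriv; case: k => [|k]; rewrite ?mulr0n. Qed.

(* n p - z p' is n times the convolution of p with the Fejer kernel of order n. *)
Lemma bernstein p n (S : R) : (size p <= n)%N ->
  (forall z, nrm z = 1 -> nrm p.[z] <= S) ->
  forall z, nrm z = 1 -> nrm (zderiv p).[z] <= 2 * n%:R * S.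
Proof.
move=> pn pS z z1.
have S0 : 0 <= S by apply: le_trans (nrm_ge0 _) (pS _ z1).
case: (posnP n) => [n0|n0].
  move: pn; rewrite n0 leqn0 size_poly_eq0 => /eqP ->.
  by rewrite /zderiv linear0 mulr0 horner0 nrm_real normr0 mulr0 mul0r.
have e : (n.*2.+1)%:R * (n%:R * p.[z] - (zderiv p).[z]) =
   \sum_(y < n.*2.+1) p.[root_pt 1 n.*2.+1 y] *
      (nrm (dirichlet z n).[root_pt 1 n.*2.+1 y] ^+ 2)%:C.
  rewrite (fejer_sum (n := n))//; [|by rewrite nrm_real normr1|by lia].
  congr (_ * _); rewrite (horner_coef_wide _ pn) (horner_coef_wide _ (size_zderiv pn)).
  rewrite mulr_sumr -sumrB; apply: eq_bigr => k _.
  by rewrite coef_zderiv mulr_natl mulrnAl mulrnBr// ltnW.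
have : nrm ((n.*2.+1)%:R * (n%:R * p.[z] - (zderiv p).[z])) <= (n.*2.+1)%:R * (n%:R * S).
  rewrite e; apply: le_trans (nrm_sum _ _ _) _.
  rewrite mulrA -(@fejer_mass z 1 n n.*2.+1)//; [|by rewrite nrm_real normr1|by lia].
  rewrite mulr_suml; apply: ler_sum => y _.
  rewrite nrmM nrm_real ger0_norm ?sqr_ge0// mulrC ler_wpM2l ?sqr_ge0//.
  by rewrite pS// nrm_root_pt// nrm_real normr1.
rewrite nrmM -(rmorph_nat (real_complex R)) nrm_real normr_nat ler_pM2l ?ltr0n// => h.
rewrite -[(zderiv p).[z]](subKr (n%:R * p.[z])).
apply: le_trans (nrmD _ _) _; rewrite nrmN nrmM -(rmorph_nat (real_complex R)) nrm_real normr_nat.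
have : n%:R * nrm p.[z] <= n%:R * S by rewrite ler_wpM2l// pS.
move: h; rewrite -(rmorph_nat (real_complex R)); lra.
Qed.

(* De la Vallee-Poussin: twice the Fejer kernel of order 2n minus that of order n
   reproduces polynomials of degree less than n. *)
Lemma Im_grid_bound p n N (S : R) : (size p <= n)%N -> (3 * n <= N)%N -> (0 < n)%N ->
  (forall y : nat, (y < N)%N -> `|Im p.[root_pt 1 N y]| <= S) ->
  forall z, nrm z = 1 -> `|Im p.[z]| <= 3 * S.
Proof.
move=> pn nN n0 pS z z1.
have one1 : nrm (1 : R[i]) = 1 by rewrite nrm_real normr1.
pose K m (y : nat) := nrm (dirichlet z m).[root_pt 1 N y] ^+ 2.
have e : (N%:R * n%:R)%:C * p.[z] =
    \sum_(y < N) p.[root_pt 1 N y] * (K n.*2 y - K n y)%:C.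
  under eq_bigr do rewrite rmorphB/= mulrBr.
  rewrite sumrB !(fejer_sum (n := n))//; [|by lia|by lia].
  rewrite rmorphM/= !rmorph_nat -mulrA -mulrBr; congr (_ * _).
  rewrite (horner_coef_wide _ pn) -sumrB mulr_sumr; apply: eq_bigr => k _.
  rewrite -mulrnBr; last by lia.
  by rewrite mulr_natl; congr (_ *+ _); have := ltn_ord k; lia.
have Im_scale (a : R) w : Im (a%:C * w) = a * Im w by case: w => u v /=; simpc.
have Im_sum (F : nat -> R[i]) : Im (\sum_(y < N) F y) = \sum_(y < N) Im (F y).
  by elim/big_rec2: _ => //= i u [u1 u2] _ <-; case: (F i).
have := congr1 (@complex.Im R) e; rewrite Im_scale (Im_sum (fun y : nat => p.[root_pt 1 N y] * (K n.*2 y - K n y)%:C)) => {}e.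
have Nn0 : 0 < N%:R * n%:R :> R by rewrite mulr_gt0 ?ltr0n//; lia.
rewrite -(ler_pM2l Nn0) -[X in X * _](gtr0_norm Nn0) -normrM e.
apply: le_trans (ler_norm_sum _ _ _) _.
apply: le_trans (_ : \sum_(y < N) (S * K n.*2 y + S * K n y) <= _).
  apply: ler_sum => y _; rewrite mulrC Im_scale normrM mulrC -mulrDr.
  apply: ler_pM => //; first exact: pS.
  by apply: le_trans (ler_normB _ _) _; rewrite !ger0_norm ?sqr_ge0.
(* The two kernels have masses 2n and n, to be compared with n: hence the factor 3. *)
rewrite big_split/= -!mulr_sumr /K !fejer_mass//; [|by lia|by lia].
rewrite -muln2 natrM; lra.
Qed.

End Fejer.

(** * Rudin-Shapiro polynomials *)

Section RudinShapiro.
Variable R : realType.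
Implicit Types (z w : R[i]) (p q : {poly R[i]}).

Fixpoint rs t : {poly R[i]} * {poly R[i]} :=
  if t is t'.+1 then
    ((rs t').1 + 'X^(2 ^ t') * (rs t').2, (rs t').1 - 'X^(2 ^ t') * (rs t').2)
  else (1, 1).

Lemma size_XnM_leq p n m : (size p <= m)%N -> (size ('X^n * p)%R <= n + m)%N.
Proof.
move=> pm; apply: leq_trans (size_polyMleq _ _) _; rewrite size_polyXn.
by move: (size p) pm => s; lia.
Qed.

Lemma size_add_leq p q m : (size p <= m)%N -> (size q <= m)%N -> (size (p + q)%R <= m)%N.
Proof. by move=> pm qm; rewrite (leq_trans (size_polyD _ _))// geq_max pm. Qed.

Lemma size_mul_leq p q m n : (size p <= m)%N -> (size q <= n.+1)%N -> (size (p * q)%R <= m + n)%N.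
Proof.
move=> pm qn; apply: leq_trans (size_polyMleq _ _) _.
by move: (size p) (size q) pm qn => s s'; lia.
Qed.

Lemma size_rs t : (size (rs t).1 <= 2 ^ t)%N /\ (size (rs t).2 <= 2 ^ t)%N.
Proof.
elim: t => [|t [IH1 IH2]]; first by rewrite /= size_poly1.
have h : (2 ^ t + 2 ^ t = 2 ^ t.+1)%N by rewrite expnS; lia.
by split; rewrite /= -h size_add_leq ?size_polyN ?size_XnM_leq// (leq_trans IH1)// leq_addl.
Qed.

Lemma coef_rs t k : (k < 2 ^ t)%N ->
  (exists b : bool, (rs t).1`_k = (-1) ^+ b) /\ (exists b : bool, (rs t).2`_k = (-1) ^+ b).
Proof.
elim: t k => [|t IH] k kt.
  by move: kt; rewrite expn0; case: k => // _; split; exists false; rewrite coef1.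
have [s1 s2] := size_rs t.
rewrite /= coefD coefB coefXnM; case: ltnP => h.
  by have [[b ->] _] := IH k h; rewrite addr0 subr0; split; exists b.
have [|_ [b ->]] := IH (k - 2 ^ t)%N; first by rewrite expnS in kt; lia.
rewrite (nth_default 0 (leq_trans s1 h)) add0r.
by split; [exists b | exists (~~ b); rewrite signrN sub0r].
Qed.

Lemma nrm_rs t z : nrm z = 1 -> nrm (rs t).1.[z] ^+ 2 + nrm (rs t).2.[z] ^+ 2 = 2 ^+ t.+1.
Proof.
move=> z1; elim: t => [|t IH].
  by rewrite /= hornerC nrm_real normr1; ring.
rewrite /= !(hornerD, hornerN, hornerM, hornerXn).
have par (u v : R[i]) : nrm (u + v) ^+ 2 + nrm (u - v) ^+ 2 = 2 * (nrm u ^+ 2 + nrm v ^+ 2).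
  by case: u v => [a b] [c d]; rewrite !nrm_sqr /=; ring.
by rewrite par nrmM nrmX z1 expr1n mul1r IH -exprS.
Qed.

Lemma nrm_rs_le t z : nrm z = 1 ->
  nrm (rs t).1.[z] ^+ 2 <= 2 ^+ t.+1 /\ nrm (rs t).2.[z] ^+ 2 <= 2 ^+ t.+1.
Proof.
move=> /(nrm_rs t); have := sqr_ge0 (nrm (rs t).1.[z]); have := sqr_ge0 (nrm (rs t).2.[z]).
by move: (_ ^+ 2) (_ ^+ 2) (2 ^+ _) => a b c; lra.
Qed.

Lemma nrm_rs_le_sqrt t z : nrm z = 1 -> nrm (rs t.+1).1.[z] <= 2 * Num.sqrt (2 ^+ t).
Proof.
move=> /(nrm_rs_le t.+1)[h _].
rewrite -(@ler_pXn2r _ 2) ?nnegrE ?nrm_ge0 ?mulr_ge0 ?sqrtr_ge0//.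
have -> : (2 * Num.sqrt (2 ^+ t)) ^+ 2 = 2 ^+ t.+2 :> R.
  by rewrite exprMn sqr_sqrtr ?exprn_ge0// !exprS; ring.
exact: h.
Qed.

(** At z = 1 two steps of the recursion double the first polynomial, hence the induction by two. *)
Lemma rs_at1 t : exists2 r : R, (rs t).1.[1] = r%:C & 2 ^+ t <= r ^+ 2.
Proof.
elim/ltn_ind: t => -[|[|t]] IH.
- by exists 1; rewrite /= ?hornerC// expr1n expr0.
- exists 2; last by rewrite expr1; lra.
  by rewrite rmorph_nat /= !(hornerD, hornerM, hornerXn, hornerC) expr1n mulr1.
have [//|r e h] := IH t.
exists (2 * r); last by rewrite exprMn !exprS; nra.
rewrite rmorphM/= rmorph_nat -e /= !(hornerD, hornerN, hornerM, hornerXn) !expr1n; ring.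
Qed.

(** Both polynomials of step t+1 begin with the first polynomial of step t, so initial blocks of
    length 2^s are again flat. Dually, in [rs_suffix], both end with the second one up to sign. A
    kernel of order 2^s lets only such end blocks interact. *)
Lemma rs_prefix s t : (s <= t)%N ->
  (exists A U, [/\ (rs t).1 = A + 'X^(2 ^ s) * U, (size A <= 2 ^ s)%N &
     forall z, nrm z = 1 -> nrm A.[z] ^+ 2 <= 2 ^+ s.+1]) /\
  (exists A U, [/\ (rs t).2 = A + 'X^(2 ^ s) * U, (size A <= 2 ^ s)%N &
     forall z, nrm z = 1 -> nrm A.[z] ^+ 2 <= 2 ^+ s.+1]).
Proof.
elim: t => [|t IH].
  rewrite leqn0 => /eqP ->.
  by split; exists 1, 0; rewrite mulr0 addr0 size_poly1; split=> // z _;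
    rewrite hornerC nrm_real normr1 expr1n; lra.
rewrite leq_eqVlt => /predU1P[->|st].
  have [s1 s2] := size_rs t.+1.
  by split; [exists (rs t.+1).1 | exists (rs t.+1).2]; exists 0;
    rewrite mulr0 addr0; split=> // z /(nrm_rs_le t.+1)[].
have [[A [U [e sA hA]]] _] := IH st.
have h : (2 ^ t = 2 ^ s + (2 ^ t - 2 ^ s))%N by rewrite subnKC// leq_exp2l.
split; [exists A, (U + 'X^(2 ^ t - 2 ^ s) * (rs t).2) |
        exists A, (U - 'X^(2 ^ t - 2 ^ s) * (rs t).2)]; split=> //=;
  by rewrite e [in LHS]h exprD; ring.
Qed.

Lemma rs_suffix s t : (s <= t)%N ->
  (exists L A, [/\ (rs t).1 = L + 'X^(2 ^ t - 2 ^ s) * A, (size L <= 2 ^ t - 2 ^ s)%N,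
     (size A <= 2 ^ s)%N & forall z, nrm z = 1 -> nrm A.[z] ^+ 2 <= 2 ^+ s.+1]) /\
  (exists L A, [/\ (rs t).2 = L + 'X^(2 ^ t - 2 ^ s) * A, (size L <= 2 ^ t - 2 ^ s)%N,
     (size A <= 2 ^ s)%N & forall z, nrm z = 1 -> nrm A.[z] ^+ 2 <= 2 ^+ s.+1]).
Proof.
elim: t => [|t IH].
  rewrite leqn0 => /eqP ->.
  have one1 z : nrm z = 1 -> nrm (1 : {poly R[i]}).[z] ^+ 2 <= 2 ^+ 1.
    by move=> _; rewrite hornerC nrm_real normr1 expr1n expr1; lra.
  have e : 1 = 0 + 'X^(2 ^ 0 - 2 ^ 0) * 1 :> {poly R[i]} by rewrite subnn mul1r add0r.
  split; exists 0, 1; split;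
    [exact: e | by rewrite size_poly0 | by rewrite size_poly1 | exact: one1 |
     exact: e | by rewrite size_poly0 | by rewrite size_poly1 | exact: one1].
rewrite leq_eqVlt => /predU1P[->|st].
  have [s1 s2] := size_rs t.+1.
  by split; exists 0; [exists (rs t.+1).1 | exists (rs t.+1).2];
    rewrite subnn expr0 mul1r add0r size_poly0; split=> // z /(nrm_rs_le t.+1)[].
have [_ [L [A [e sL sA hA]]]] := IH st; have [s1 s2] := size_rs t.
have le : (2 ^ s <= 2 ^ t)%N by rewrite leq_exp2l.
have h : (2 ^ t.+1 - 2 ^ s = 2 ^ t + (2 ^ t - 2 ^ s))%N by rewrite expnS; lia.
split.
  exists ((rs t).1 + 'X^(2 ^ t) * L), A; split=> //=.
    by rewrite h exprD {1}e; ring.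
  by rewrite h size_add_leq ?size_XnM_leq// (leq_trans s1)// leq_addr.
exists ((rs t).1 - 'X^(2 ^ t) * L), (- A); split=> [/=|/=||z /hA].
- by rewrite h exprD {1}e; ring.
- by rewrite h size_add_leq ?size_polyN ?size_XnM_leq// (leq_trans s1)// leq_addr.
- by rewrite size_polyN.
- by rewrite hornerN nrmN.
Qed.

End RudinShapiro.

(** * Local mean of the squared real part of a Rudin-Shapiro polynomial *)

Section LocalEnergy.
Variable R : realType.
Implicit Types (x : R) (z w : R[i]) (p q A : {poly R[i]}).

Lemma sum_roots_orth w N s p q : nrm w = 1 -> (size p <= s)%N -> (size p <= N)%N ->
  (size ('X^s * q)%R <= N)%N ->
  \sum_(y < N) p.[root_pt w N y] * (('X^s * q).[root_pt w N y])^* = 0.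
Proof.
move=> w1 ps pN qN; rewrite sum_roots_conj// big1 ?mulr0// => k _.
rewrite coefXnM; case: ltnP => h; first by rewrite conjc0 mulr0.
by rewrite nth_default ?mul0r// (leq_trans ps).
Qed.

Lemma sum_roots_orth_conj w N s p q : nrm w = 1 -> (size p <= s)%N -> (size p <= N)%N ->
  (size ('X^s * q)%R <= N)%N ->
  \sum_(y < N) ('X^s * q).[root_pt w N y] * (p.[root_pt w N y])^* = 0.
Proof.
move=> w1 ps pN qN; rewrite sum_roots_conj// big1 ?mulr0// => k _.
rewrite coefXnM; case: ltnP => h; first by rewrite mul0r.
by rewrite [p`_k]nth_default ?conjc0 ?mulr0// (leq_trans ps).
Qed.

Lemma Re_sum N (F : nat -> R[i]) : Re (\sum_(y < N) F y) = \sum_(y < N) Re (F y).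
Proof. by elim/big_rec2: _ => //= i u [u1 u2] _ <-; case: (F i). Qed.

Section Window.
Variables (s : nat) (w : R[i]).
Hypothesis w1 : nrm w = 1.
Let t := (s + 4)%N.
Let T := (2 ^ t)%N.
Let r := (2 ^ s)%N.
Let N := (8 * T)%N.
Let E := dirichlet w r.
Let F := (rs R t.+1).1.
Let z y := root_pt w N y.
Let W y := nrm E.[z y] ^+ 2.

Let z1 y : nrm (z y) = 1. Proof. exact: nrm_root_pt. Qed.
Let Tr : T = (16 * r)%N. Proof. by rewrite /T /t expnD mulnC. Qed.
Let r0 : (0 < r)%N. Proof. by rewrite expn_gt0. Qed.
Let sE : (size E <= r)%N. Proof. exact: size_poly. Qed.

Let mass : \sum_(y < N) W y = N%:R * r%:R.
Proof. by rewrite /W fejer_mass// /N Tr; move: r0; lia. Qed.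

Let sub_mass (f : nat -> R) c : 0 <= c -> (forall y, f y <= c) ->
  \sum_(y < N) f y * W y <= c * (N%:R * r%:R).
Proof.
by move=> c0 fc; rewrite -mass mulr_sumr ler_sum// => y _; rewrite ler_wpM2r ?sqr_ge0.
Qed.

(** Multiplying by [E] spreads coefficients by less than r, so by orthogonality only the last r
    coefficients of the first polynomial meet the first r of the second, shifted by T. Both blocks
    have squared modulus at most 2r. *)
Let cross : Re (\sum_(y < N)
   ((rs R t).1 * E).[z y] * (('X^T * (rs R t).2 * E).[z y])^*) >= - (2 * r%:R * (N%:R * r%:R)).
Proof.
have st : (s <= t)%N by exact: leq_addr.
have [[L [A [eP sL sA hA]]] _] := rs_suffix R st.
have [_ [A' [U [eQ sA' hA']]]] := rs_prefix R st.
have [sP sQ] := size_rs R t.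
rewrite -/T -/r in eP sL sA eQ sA' sP sQ.
have sLE : (size (L * E)%R <= T)%N.
  have sE' : (size E <= r.-1.+1)%N by rewrite prednK.
  by apply: leq_trans (size_mul_leq sL sE') _; rewrite Tr; move: r0; lia.
have sAE : (size (A * E)%R <= r + r)%N by apply: size_mul_leq => //; rewrite (leq_trans sE).
have sA'E : (size (A' * E)%R <= r + r)%N by apply: size_mul_leq => //; rewrite (leq_trans sE).
have sQE : (size ((rs R t).2 * E)%R <= T + r)%N by apply: size_mul_leq => //; rewrite (leq_trans sE).
have sUE : (size ('X^(T + r) * (U * E))%R <= N)%N.
  have -> : 'X^(T + r) * (U * E) = 'X^T * ((rs R t).2 * E) - 'X^T * (A' * E).
    by rewrite eQ exprD; ring.
  by rewrite size_add_leq ?size_polyN// (leq_trans (size_XnM_leq _ sQE), leq_trans (size_XnM_leq _ sA'E))// /N Tr; move: r0; lia.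
have sA2 : (size ('X^(T - r) * (A * E))%R <= T + r)%N.
  by apply: leq_trans (size_XnM_leq _ sAE) _; rewrite Tr; move: r0; lia.
have -> : \sum_(y < N) ((rs R t).1 * E).[z y] * (('X^T * (rs R t).2 * E).[z y])^* =
  \sum_(y < N) ('X^(T - r) * (A * E)).[z y] * (('X^T * (A' * E)).[z y])^*.
  transitivity (\sum_(y < N) (L * E).[z y] * (('X^T * ((rs R t).2 * E)).[z y])^* +
    (\sum_(y < N) ('X^(T - r) * (A * E)).[z y] * (('X^(T + r) * (U * E)).[z y])^* +
        \sum_(y < N) ('X^(T - r) * (A * E)).[z y] * (('X^T * (A' * E)).[z y])^*)); last first.
    rewrite [X in X + _]sum_roots_orth ?[X in 0 + (X + _)]sum_roots_orth ?add0r//.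
    - by rewrite (leq_trans sA2)// /N Tr; move: r0; lia.
    - by rewrite (leq_trans sLE)// /N; lia.
    - by rewrite (leq_trans (size_XnM_leq _ sQE))// /N Tr; move: r0; lia.
  rewrite -!big_split/=; apply: eq_bigr => y _.
  rewrite -mulrDr -rmorphD/= -hornerD -mulrA.
  have -> : 'X^(T + r) * (U * E) + 'X^T * (A' * E) = 'X^T * ((rs R t).2 * E).
    by rewrite eQ exprD; ring.
  by rewrite -mulrDl -hornerD; congr (_.[_] * _); rewrite eP mulrDl mulrA.
set G := \sum_(y < N) _.
suff : nrm G <= 2 * r%:R * (N%:R * r%:R).
  by have := normr_Re_le G; rewrite ler_norml => /andP[]; lra.
apply: le_trans (nrm_sum _ _ _) _.
rewrite (eq_bigr (fun y : 'I_N => nrm A.[z y] * nrm A'.[z y] * W y)); last first.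
  move=> y _; rewrite nrmM nrmJ !hornerM !nrmM !hornerXn !nrmX !z1 !expr1n /W; ring.
have rR : 2 ^+ s.+1 = 2 * r%:R :> R by rewrite exprS natrX.
apply: (sub_mass (f := fun y => nrm A.[z y] * nrm A'.[z y])) => [|y].
  by rewrite mulr_ge0.
have := hA _ (z1 y); have := hA' _ (z1 y); rewrite rR.
by have := sqr_ge0 (nrm A.[z y] - nrm A'.[z y]); nra.
Qed.

(** F^2 carries no conjugate, so the kernel sees only its coefficients below r, and these are the
    same for F^2 and the square of the initial block of F. *)
Let square_sum : Re (\sum_(y < N) F.[z y] ^+ 2 * (W y)%:C) >= - (2 * r%:R * (N%:R * r%:R)).
Proof.
have st : (s <= t.+1)%N by rewrite /t; lia.
have [[A [U [eF sA hA]]] _] := rs_prefix R st.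
have [sF _] := size_rs R t.+1.
rewrite -/F -/r in eF sA sF.
have eT : (2 ^ t.+1 = 2 * T)%N by rewrite expnS.
pose V := 2 * A * U + 'X^r * U ^+ 2.
have eF2 : F ^+ 2 = A ^+ 2 + 'X^r * V by rewrite eF /V; ring.
have sq p m : (size p <= m)%N -> (size (p ^+ 2 * E)%R <= 2 * m + r)%N.
  move=> pm; apply: size_mul_leq; last by rewrite (leq_trans sE).
  rewrite expr2 mul2n -addnn; apply: size_mul_leq => //; exact: leq_trans pm _.
have sVE : (size ('X^r * (V * E))%R <= N)%N.
  have -> : 'X^r * (V * E) = F ^+ 2 * E - A ^+ 2 * E by rewrite eF2; ring.
  rewrite size_add_leq ?size_polyN//; first by rewrite (leq_trans (sq _ _ sF))// eT /N Tr; move: r0; lia.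
  by rewrite (leq_trans (sq _ _ sA))// /N Tr; move: r0; lia.
have -> : \sum_(y < N) F.[z y] ^+ 2 * (W y)%:C = \sum_(y < N) A.[z y] ^+ 2 * (W y)%:C.
  transitivity (\sum_(y < N) A.[z y] ^+ 2 * (W y)%:C +
     \sum_(y < N) ('X^r * (V * E)).[z y] * (E.[z y])^*); last first.
    by rewrite sum_roots_orth_conj ?addr0// (leq_trans sE)// /N Tr; move: r0; lia.
  rewrite -big_split/=; apply: eq_bigr => y _.
  rewrite -[F.[_] ^+ 2]horner_exp eF2 hornerD mulrDl horner_exp; congr (_ + _).
  by rewrite /W -mulr_conj !hornerM !mulrA.
set G := \sum_(y < N) _.
suff : nrm G <= 2 * r%:R * (N%:R * r%:R).
  by have := normr_Re_le G; rewrite ler_norml => /andP[]; lra.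
apply: le_trans (nrm_sum _ _ _) _.
rewrite (eq_bigr (fun y : 'I_N => nrm A.[z y] ^+ 2 * W y)); last first.
  by move=> y _; rewrite nrmM nrmX nrm_real ger0_norm ?sqr_ge0.
have rR : 2 ^+ s.+1 = 2 * r%:R :> R by rewrite exprS natrX.
apply: (sub_mass (f := fun y => nrm A.[z y] ^+ 2)) => [|y]; first by rewrite mulr_ge0.
by rewrite -rR hA.
Qed.

(** With F = P + z^T Q and |P|^2 + |Q|^2 = 2T, the square of Re F is T plus the real part of P times
    the conjugate of z^T Q, plus Re(F^2) / 2. The two oscillating terms cost 2r and r. *)
Lemma local_energy :
  (T%:R - 3 * r%:R) * (N%:R * r%:R) <= \sum_(y < N) Re F.[z y] ^+ 2 * W y.
Proof.
pose P := (rs R t).1; pose Q := (rs R t).2.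
pose G y := (P * E).[z y] * (('X^T * Q * E).[z y])^*.
have e y : Re F.[z y] ^+ 2 * W y =
   (T%:R * W y + Re (G y)) + Re (F.[z y] ^+ 2 * (W y)%:C) / 2.
  have := nrm_rs t (z1 y); rewrite -natrX expnS natrM -/T -/P -/Q => PQ.
  have Fe : F.[z y] = P.[z y] + z y ^+ T * Q.[z y].
    by rewrite /F /= hornerD hornerM hornerXn.
  have zT : nrm (z y ^+ T) = 1 by rewrite nrmX z1 expr1n.
  have -> : T%:R * W y = (nrm P.[z y] ^+ 2 + nrm (z y ^+ T * Q.[z y]) ^+ 2) / 2 * W y.
    by rewrite nrmM zT mul1r PQ; field.
  have -> : G y = P.[z y] * (z y ^+ T * Q.[z y])^* * (W y)%:C.
    rewrite /G /W -mulr_conj !hornerM hornerXn !rmorphM/=; ring.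
  rewrite Fe; move: (_ * _) (P.[_]) (W _) => [c d] [a b] v.
  by rewrite !nrm_sqr /=; simpc => /=; field.
under eq_bigr do rewrite e.
rewrite !big_split/= -mulr_suml -mulr_sumr mass.
have := cross; rewrite (Re_sum _ G).
have := square_sum; rewrite (Re_sum _ (fun y => F.[z y] ^+ 2 * (W y)%:C)).
rewrite -/G.
by lra.
Qed.

End Window.
End LocalEnergy.

Section TrigBounds.
Variable R : realType.
Implicit Types (x a b : R).

Lemma mvt_le (f df : R -> R) a b : (forall x, is_derive x 1 f (df x)) -> a <= b ->
  exists2 c, a <= c <= b & f b - f a = df c * (b - a).
Proof.
move=> fdf ab.
have fc : {within `[a, b], continuous f}%classic.
  by apply: derivable_within_continuous => x _; case: (fdf x).
have [c] := MVT_segment ab (fun x _ => fdf x) fc.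
by rewrite in_itv/= => cab e; exists c.
Qed.

Lemma sin_le x : 0 <= x -> sin x <= x.
Proof.
move=> x0; have [c _] := mvt_le (@is_derive_sin R) x0.
by rewrite sin0 !subr0 => ->; rewrite ler_piMl// cos_le1.
Qed.

Lemma cos_ge x : 1 - x ^+ 2 / 2 <= cos x.
Proof.
wlog x0 : x / 0 <= x.
  by move=> H; case: (lerP 0 x) => [/H//|xn]; rewrite -cosN -sqrrN H// oppr_ge0 ltW.
have [c /andP[c0 cx]] := mvt_le (@is_derive_cos R) (divr_ge0 x0 (ler0n R 2)).
have := cos_mulr2n (x / 2); rewrite [x / 2 *+ 2]mulr2n -splitr mulr2n => -> _.
have := cos2Dsin2 (x / 2); have := sin_le (divr_ge0 x0 (ler0n R 2)).
have : - (x / 2) <= sin (x / 2).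
  have [d _] := mvt_le (@is_derive_sin R) (divr_ge0 x0 (ler0n R 2)).
  by rewrite sin0 !subr0 => ->; have := cos_geN1 d; nra.
by move: (sin _) (cos _) => s k; nra.
Qed.

Lemma sin_ge_quarter x : 0 <= x <= pi / 2 -> x / 4 <= sin x.
Proof.
move=> /andP[x0 xpi]; have p2 := @pihalf_lt2 R; have p1 := @pihalf_ge1 R.
have H (y : R) : 0 <= y <= 1 -> y / 2 <= sin y.
  move=> /andP[y0 y1]; have [c /andP[c0 cy]] := mvt_le (@is_derive_sin R) y0.
  by rewrite sin0 !subr0 => ->; have := cos_ge c; nra.
case: (lerP x 1) => x1; first by have := H x; rewrite x0 x1 => /(_ isT); lra.
have : sin 1 < sin x by rewrite ltr_sin// in_itv/=; apply/andP; split; lra.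
by have := H 1; rewrite ler01 lexx => /(_ isT); lra.
Qed.

Lemma sum_inv_sqr (Y n : nat) : (0 < Y)%N -> \sum_(y < n | (Y < y)%N) (y%:R ^- 2) <= Y%:R^-1 :> R.
Proof.
move=> Y0.
(* Telescoping form; [maxn] covers the n for which the sum is empty. *)
suff: \sum_(y < n | (Y < y)%N) (y%:R ^- 2) <= Y%:R^-1 - (maxn Y n.-1)%:R^-1 :> R.
  by move=> h; apply: le_trans h _; rewrite gerBl invr_ge0.
elim: n => [|n IH]; first by rewrite big_ord0 maxn0 subrr.
rewrite big_mkcond big_ord_recr/= -big_mkcond/=.
case: (ltnP Y n) => Yn; last first.
  by rewrite addr0; apply: le_trans IH _; have -> : maxn Y n.-1 = Y by lia.
apply: le_trans (lerD IH (lexx _)) _.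
have -> : maxn Y n.-1 = n.-1 by lia.
have n1 : 1 <= n.-1%:R :> R by rewrite ler1n; lia.
have -> : n%:R = n.-1%:R + 1 :> R by rewrite natr1 prednK//; lia.
move: (n.-1%:R) n1 => u u1; rewrite -addrA lerD2l -subr_ge0.
have -> : - (u + 1)^-1 - (- u^-1 + (u + 1) ^- 2) = (u * (u + 1) ^+ 2)^-1 by field; lra.
by rewrite invr_ge0 mulr_ge0 ?sqr_ge0//; lra.
Qed.

End TrigBounds.

Section Window.
Variable R : realType.
Implicit Types (x : R) (z w : R[i]).

Lemma nrm_expi_sub1 x : nrm (expi x - 1) ^+ 2 = 4 * sin (x / 2) ^+ 2.
Proof.
rewrite nrm_sqr /= {1}(splitr x) [in X in _ + X](splitr x) cosD sinD subr0.
by have := cos2Dsin2 (x / 2); move: (cos _) (sin _) => c s h; nra.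
Qed.

Lemma dirichlet_root_pt w N (y : nat) m : nrm w = 1 ->
  (dirichlet w m).[root_pt w N y] = \sum_(j < m) (expi (2 * pi / N%:R) ^+ y) ^+ j.
Proof.
move=> w1; rewrite horner_poly; apply: eq_bigr => j _.
by rewrite -exprMn /root_pt mulrA [_^* * _]mulrC mulr_conj1// mul1r.
Qed.

(** The geometric sum has modulus at most 2 / |u - 1|, and |u - 1| is governed by the distance from
    y to 0 or to N, whichever is nearer around the circle. *)
Lemma dirichlet_decay w N (y : nat) m : nrm w = 1 -> (0 < y < N)%N ->
  nrm (dirichlet w m).[root_pt w N y] ^+ 2 <= 4 * N%:R ^+ 2 * (y%:R ^- 2 + (N - y)%:R ^- 2).
Proof.
move=> w1 /andP[y0 yN]; rewrite dirichlet_root_pt//; set u := expi _ ^+ y; set D := \sum_(j < m) _.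
have N0 : 0 < N%:R :> R by rewrite ltr0n; lia.
have yR : 0 < y%:R :> R by rewrite ltr0n.
have zR : 0 < (N - y)%:R :> R by rewrite ltr0n; lia.
have pi0 := pi_gt0 R; have pi1 := @pihalf_ge1 R.
have Du : nrm D ^+ 2 * nrm (u - 1) ^+ 2 <= 4.
  rewrite -exprMn -nrmM mulrC -subrX1 -[4]/((2 * 2)%:R) natrM -expr2.
  rewrite ler_pXn2r ?nnegrE ?nrm_ge0//; apply: le_trans (nrmD _ _) _.
  by rewrite nrmN nrmX [nrm u]nrmX nrm_expi !expr1n nrm_real normr1.
move: Du; rewrite /u expiX nrm_expi_sub1; set v := _ / 2.
have ve : v = pi * (y%:R / N%:R) by rewrite /v; field; rewrite gt_eqF.
have vN : pi - v = pi * ((N - y)%:R / N%:R).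
  by rewrite ve natrB ?(ltnW yN)//; field; rewrite gt_eqF.
have lower (k : nat) (kpi : pi * (k%:R / N%:R) <= pi / 2 :> R) :
   k%:R / (2 * N%:R) <= sin (pi * (k%:R / N%:R)) :> R.
  have k0R : 0 <= k%:R / N%:R :> R by rewrite divr_ge0.
  apply: le_trans (_ : pi * (k%:R / N%:R) / 4 <= _); last first.
    by apply: sin_ge_quarter; rewrite kpi mulr_ge0// ltW.
  have -> : k%:R / (2 * N%:R) = k%:R / N%:R / 2 :> R by field; rewrite gt_eqF.
  nra.
have main (k : nat) : (0 < k)%N -> nrm D ^+ 2 * (4 * sin v ^+ 2) <= 4 ->
    k%:R / (2 * N%:R) <= sin v -> nrm D ^+ 2 <= 4 * N%:R ^+ 2 * k%:R ^- 2.
  move=> k0 h1 h2; have kR : 0 < k%:R :> R by rewrite ltr0n.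
  rewrite ler_pdivlMr ?exprn_gt0//.
  have e : k%:R ^+ 2 = 4 * N%:R ^+ 2 * (k%:R / (2 * N%:R)) ^+ 2 :> R.
    by field; rewrite gt_eqF.
  rewrite e mulrCA ler_piMr ?mulr_ge0 ?sqr_ge0//.
  have q0 : 0 <= k%:R / (2 * N%:R) :> R by rewrite divr_ge0// mulr_ge0.
  have : (k%:R / (2 * N%:R)) ^+ 2 <= sin v ^+ 2 by rewrite ler_pXn2r ?nnegrE//; lra.
  by have := sqr_ge0 (nrm D); move: (nrm D ^+ 2) (sin v ^+ 2) h1 => a b; nra.
move=> h; have sq0 (k : nat) : 0 <= 4 * N%:R ^+ 2 * k%:R ^- 2 :> R by rewrite !mulr_ge0 ?invr_ge0 ?sqr_ge0.
rewrite mulrDr.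
case: (lerP v (pi / 2)) => vh.
  apply: le_trans (main y y0 h _) _; last by rewrite lerDl sq0.
  by rewrite ve lower// -ve.
apply: le_trans (main (N - y)%N _ h _) _; [lia| |by rewrite lerDr sq0].
have -> : sin v = sin (pi - v) by rewrite sinB sinpi cospi; ring.
by rewrite vN lower// -vN; lra.
Qed.

(* Otherwise the mean of (Re F)^2 against the Fejer kernel of order T/16 centred at x0
   would be too small: the tails of the kernel carry little mass. *)
Lemma rs_large_in_window t (x0 : R) : (4 <= t)%N ->
  exists x, `|x - x0| <= 2 ^+ 14 / 2 ^+ t /\
    2 ^+ t <= 4 * Re (rs R t.+1).1.[expi x] ^+ 2.
Proof.
move=> t4; apply/not_existsP => H.
have near x : `|x - x0| <= 2 ^+ 14 / 2 ^+ t -> Re (rs R t.+1).1.[expi x] ^+ 2 <= 2 ^+ t / 4.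
  by move=> hx; apply/ltW; rewrite ltNge; apply/negP => hh; apply: (H x); split=> //; lra.
pose s := (t - 4)%N; have ts : t = (s + 4)%N by rewrite subnK.
have w1 := nrm_expi x0; have := local_energy s w1; rewrite -ts.
set r := (2 ^ s)%N; set T := (2 ^ t)%N.
have Tr : T = (16 * r)%N by rewrite /T ts expnD mulnC.
have r0 : (0 < r)%N by rewrite expn_gt0.
set N := (8 * T)%N; set F := (rs R t.+1).1 in near *; set w := expi x0 in w1 *.
set W := fun y => nrm (dirichlet w r).[root_pt w N y] ^+ 2.
(* As N = 128 r and 2^14 = 128^2, the kernel mass farther than Y steps is at most 8 N^2 / Y = 8 r^2,
   against a total of 128 r^2. *)
pose Y := (2 ^ 14)%N; have Y0 : (0 < Y)%N by rewrite expn_gt0.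
pose far (y : nat) := (Y < y)%N && (Y < N - y)%N.
have TR : T%:R = 2 ^+ t :> R by rewrite natrX.
have T0 : 0 < T%:R :> R by rewrite TR exprn_gt0.
have N0 : 0 < N%:R :> R by rewrite /N natrM mulr_gt0.
have pi0 := pi_gt0 R; have pi2 := @pihalf_lt2 R.
have small y : (y < N)%N -> Re F.[root_pt w N y] ^+ 2 <= T%:R / 4 + (if far y then 4 * T%:R else 0).
  move=> yN; case: ifPn => [_|nf].
    apply: le_trans (_ : 4 * T%:R <= _); last by lra.
    have [h _] := nrm_rs_le t.+1 (nrm_root_pt N y w1).
    have -> : 4 * T%:R = 2 ^+ t.+2 :> R by rewrite TR !exprS; ring.
    by apply: le_trans h; rewrite -real_normK ?num_real// ler_pXn2r ?nnegrE ?nrm_ge0// normr_Re_le.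
  rewrite addr0 TR.
  have close k : (k <= Y)%N -> k%:R * (2 * pi / N%:R) <= 2 ^+ 14 / 2 ^+ t :> R.
    move=> kY; rewrite -TR /N natrM.
    have -> : k%:R * (2 * pi / (8 * T%:R)) = (k%:R * (pi / 4)) / T%:R :> R by field; rewrite gt_eqF.
    rewrite ler_pM2r ?invr_gt0//; apply: le_trans (_ : k%:R <= _).
      by rewrite ler_piMr//; lra.
    by rewrite -natrX ler_nat.
  rewrite /root_pt expiX -expiD.
  have [yY|yY] := leqP y Y.
    by apply: near; rewrite addrAC subrr add0r ger0_norm ?close// mulr_ge0// divr_ge0// ltW// mulr_gt0.
  have NyY : (N - y <= Y)%N by move: nf; rewrite /far yY /= -leqNgt.
  have -> : x0 + y%:R * (2 * pi / N%:R) = (x0 - (N - y)%:R * (2 * pi / N%:R)) + 2 * pi.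
    by rewrite natrB ?(ltnW yN)//; field; rewrite gt_eqF.
  rewrite expiD expi2pi mulr1; apply: near.
  by rewrite addrAC subrr add0r normrN ger0_norm ?close// mulr_ge0// divr_ge0// ltW// mulr_gt0.
have far_mass : \sum_(y < N | far y) W y <= 4 * N%:R ^+ 2 * (2 / Y%:R).
  apply: le_trans (_ : \sum_(y < N | far y) 4 * N%:R ^+ 2 * (y%:R ^- 2 + (N - y)%:R ^- 2) <= _).
    by apply: ler_sum => y /andP[y1 y2]; apply: dirichlet_decay; rewrite // ltn_ord andbT; lia.
  rewrite -mulr_sumr ler_wpM2l ?mulr_ge0 ?sqr_ge0// big_split/=.
  have -> : 2 / Y%:R = Y%:R^-1 + Y%:R^-1 :> R by ring.
  apply: lerD.
    apply: le_trans (sum_inv_sqr R N Y0); rewrite big_mkcondr/=; apply: ler_sum => y _.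
    by case: ifP => // _; rewrite invr_ge0 sqr_ge0.
  apply: le_trans (sum_inv_sqr R N.+1 Y0).
  rewrite [leRHS]big_mkcond big_ord_recl /= add0r -big_mkcond/=.
  rewrite [leRHS](reindex_inj rev_ord_inj)/=.
  rewrite [leLHS]big_mkcond [leRHS]big_mkcond; apply: ler_sum => y _ /=.
  rewrite /bump /= add1n subnSK// /far.
  by case: (Y < N - y)%N; rewrite ?andbF// andbT; case: ifP => // _; rewrite invr_ge0 sqr_ge0.
have mass : \sum_(y < N) W y = N%:R * r%:R by rewrite /W fejer_mass// /N Tr; move: r0; lia.
apply/negP; rewrite -ltNge.
apply: le_lt_trans (_ : T%:R / 4 * (N%:R * r%:R) + 4 * T%:R * (4 * N%:R ^+ 2 * (2 / Y%:R)) < _).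
  apply: le_trans (_ : \sum_(y < N) (T%:R / 4 * W y + (if far y then 4 * T%:R * W y else 0)) <= _).
    apply: ler_sum => y _; have := small y (ltn_ord y); have := sqr_ge0 (nrm (dirichlet w r).[root_pt w N y]).
    rewrite -/(W y); case: ifP => _; nra.
  rewrite big_split/= -mulr_sumr mass -big_mkcond/= -mulr_sumr lerD2l ler_wpM2l//.
  by rewrite mulr_ge0// ltW.
rewrite /N Tr /Y natrX !natrM.
have rR : 0 < r%:R :> R by rewrite ltr0n.
move: (r%:R) rR => u u0; rewrite -subr_gt0.
(* In units of r^3: energy 13 * 128, minus 4 * 128 from the near part and 64 * 8 from the tails. *)
set e := (X in 0 < X); have -> : e = 640 * u ^+ 3 by rewrite /e; field.
by rewrite mulr_gt0 ?exprn_gt0.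
Qed.

End Window.

(** * Few small values in a window *)

Section DividedDifference.
Variable R : realType.
Implicit Types (x : R).

Lemma rolle_path (g dg : R -> R) : (forall x, is_derive x 1 g (dg x)) ->
  forall (s : seq R) x, path <%R x s -> (forall y, y \in x :: s -> g y = 0) ->
  exists s', [/\ size s' = size s, path <%R x s' & forall y, y \in s' -> dg y = 0].
Proof.
move=> gdg; elim=> [|y s IH] x /=; first by exists [::].
move=> /andP[xy ys] z.
have [|s' [ss' ys' zs']] := IH y ys.
  by move=> v vs; apply: z; rewrite inE vs orbT.
have gc : {within `[x, y], continuous g}%classic.
  by apply: derivable_within_continuous => v _; case: (gdg v).
have gd v : v \in `]x, y[ -> derivable g v 1 by case: (gdg v).
have gxy : g x = g y by rewrite !z// !inE eqxx ?orbT.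
have [c] := Rolle xy gd gc gxy; rewrite in_itv/= => /andP[xc cy] dc.
exists (c :: s'); split=> /=; first by rewrite ss'.
  by rewrite xc; case: s' ys' {ss' zs'} => //= a l /andP[ya ->]; rewrite (lt_trans cy ya).
move=> v; rewrite inE => /predU1P[->|/zs'//].
by case: (gdg c) dc => _ <- [_ <-].
Qed.

Lemma rolle_tower (f : nat -> R -> R) : (forall (j : nat) x, is_derive x 1 (f j) (f j.+1 x)) ->
  forall (s : seq R) x j, path <%R x s -> (forall y, y \in x :: s -> f j y = 0) ->
  exists c, f (j + size s)%N c = 0.
Proof.
move=> fd s; move: {2}(size s) (erefl (size s)) => n; elim: n s => [|n IH] s sn x j xs z.
  by exists x; rewrite sn addn0 z// inE eqxx.
have [[|y s'] [ss' xs' zs']] := rolle_path (fd j) xs z; first by rewrite sn in ss'.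
have [||c fc] := IH s' _ y j.+1 _ zs'; first by rewrite sn in ss'; case: ss'.
  by move: xs' => /= /andP[].
by exists c; rewrite -ss' /= addnS -addSn.
Qed.

(** Mean value theorem for divided differences. Subtracting the Lagrange interpolant [q] leaves k+1
    zeros, and iterated Rolle leaves a zero of the k-th derivative, where [q] contributes k! times
    its top coefficient. *)
Lemma divided_difference (f : nat -> R -> R) k (x : 'I_k.+1 -> R) :
  (forall (j : nat) (y : R), is_derive y 1 (f j) (f j.+1 y)) -> injective x ->
  exists c, f k c = (k`!)%:R * \sum_i f 0%N (x i) / \prod_(j | j != i) (x i - x j).
Proof.
move=> fd xinj.
pose M i : {poly R} := \prod_(j | j != i) ('X - (x j)%:P).
pose d i := \prod_(j | j != i) (x i - x j).
have d0 i : d i != 0.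
  by apply/prodf_neq0 => j ji; rewrite subr_eq0 (inj_eq xinj) eq_sym.
pose q := \sum_i (f 0%N (x i) / d i) *: M i.
have sM i : size (M i) = k.+1.
  rewrite /M -big_filter size_prod_XsubC; congr (_.+1).
  by rewrite size_filter -sum1_count sum1_card cardC1 card_ord.
have mM i : M i \is monic by exact: monic_prod_XsubC.
have Mi i : (M i).[x i] = d i.
  by rewrite /M /d horner_prod; apply: eq_bigr => j _; rewrite hornerXsubC.
have Mj i j : j != i -> (M i).[x j] = 0.
  by move=> ji; rewrite /M horner_prod (bigD1 j)//= hornerXsubC subrr mul0r.
have qx i : q.[x i] = f 0%N (x i).
  rewrite /q horner_sum (bigD1 i)//= big1 ?addr0 => [|j ji].
    by rewrite hornerZ Mi divfK.
  by rewrite hornerZ Mj ?mulr0// eq_sym.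
have qk : q`_k = \sum_i f 0%N (x i) / d i.
  rewrite /q coef_sum; apply: eq_bigr => i _.
  by rewrite coefZ; have /monicP := mM i; rewrite /lead_coef sM /= => ->; rewrite mulr1.
have sq : (size q <= k.+1)%N.
  apply: leq_trans (size_sum _ _ _) _; apply/bigmax_leqP => i _.
  by rewrite (leq_trans (size_scale_leq _ _))// sM.
pose g j y := f j y - (q^`(j)).[y].
have gd (j : nat) (y : R) : is_derive y 1 (g j) (g j.+1 y).
  by apply: is_deriveB; rewrite derivnS; exact: is_derive_poly.
pose s := sort <=%R [seq x i | i : 'I_k.+1].
have szs : size s = k.+1 by rewrite size_sort size_map size_enum_ord.
have us : sorted <%R s.
  by rewrite lt_sorted_uniq_le sort_uniq sort_le_sorted andbT map_inj_uniq ?enum_uniq.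
have zs y : y \in s -> g 0%N y = 0.
  by rewrite mem_sort => /mapP[i _ ->]; rewrite /g derivn0 qx subrr.
case: s szs us zs => // y s [ss] ys zs.
have [c] := rolle_tower gd ys zs; rewrite add0n ss /g => /eqP; rewrite subr_eq0 => /eqP fc.
exists c; rewrite fc.
have -> : q^`(k) = ((k`!)%:R * q`_k)%:P.
  apply/polyP => i; rewrite coef_derivn coefC; case: i => [|i] /=.
    by rewrite addn0 ffactnn mulr_natl.
  by rewrite nth_default ?mul0rn// (leq_trans sq)// addnS ltnS leq_addr.
by rewrite hornerC qk.
Qed.

End DividedDifference.

Section AngularDerivative.
Variable R : realType.
Implicit Types (x : R) (p : {poly R[i]}).

(** The derivative of p(e^(ix)) in x, again a polynomial in e^(ix) of no larger degree, so that
    [bernstein] can be iterated. *)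
Definition angle_deriv p := 'i *: zderiv p.

Lemma Re_horner_expi n p x : (size p <= n)%N ->
  Re p.[expi x] = \sum_(k < n) (Re p`_k * cos (k%:R * x) - Im p`_k * sin (k%:R * x)).
Proof.
move=> pn; rewrite (horner_coef_wide _ pn) (Re_sum _ (fun k => p`_k * expi x ^+ k)).
by apply: eq_bigr => k _; rewrite expiX; case: (p`_k).
Qed.

Lemma complex_mulrn (z : R[i]) k : z *+ k = (Re z *+ k) +i* (Im z *+ k).
Proof.
elim: k => [|k IH]; first by rewrite !mulr0n.
by rewrite !mulrSr IH; case: z {IH} => a b; simpc.
Qed.

Lemma is_derive_Re_expi p x :
  is_derive x 1 (fun y => Re p.[expi y]) (Re (angle_deriv p).[expi x]).
Proof.
have sd : (size (angle_deriv p) <= size p)%N.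
  by rewrite (leq_trans (size_scale_leq _ _))// size_zderiv.
rewrite (Re_horner_expi _ sd).
have -> : (fun y => Re p.[expi y]) =
    \sum_(k < size p) ((fun y => Re p`_k * cos (k%:R * y) - Im p`_k * sin (k%:R * y)) : R -> R).
  by apply/funext => y; rewrite (Re_horner_expi _ (leqnn _)) fct_sumE.
apply: is_derive_sum => k.
set a := Re p`_k; set b := Im p`_k.
have lin : is_derive x 1 (fun y : R => k%:R * y) (k%:R : R).
  by apply: is_derive_eq; rewrite scaler1 ?mulr1.
have dc := is_derive1_comp (is_derive_cos (k%:R * x)) lin.
have ds := is_derive1_comp (is_derive_sin (k%:R * x)) lin.
have := is_deriveB (is_deriveZ a dc) (is_deriveZ b ds).
congr is_derive.
rewrite coefZ coef_zderiv /a /b.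
rewrite complex_mulrn; case: (p`_k) => u v /=; simpc => /=.
rewrite -[v *+ k]mulr_natl -[u *+ k]mulr_natl.
by rewrite /GRing.scale/=; ring.
Qed.

Lemma iter_angle_deriv n (S : R) p j : (size p <= n)%N ->
  (forall z, nrm z = 1 -> nrm p.[z] <= S) ->
  (size (iter j angle_deriv p) <= n)%N /\
  forall z, nrm z = 1 -> nrm (iter j angle_deriv p).[z] <= (2 * n%:R) ^+ j * S.
Proof.
move=> pn pS; elim: j => [|j [IH1 IH2]]; first by split=> // z /pS; rewrite mul1r.
split=> [|z z1]; first by rewrite /= (leq_trans (size_scale_leq _ _))// size_zderiv.
rewrite /= hornerZ nrmM {1}/nrm /= expr0n expr1n add0r sqrtr1 mul1r exprS -mulrA.
exact: bernstein.
Qed.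

Lemma factorial_dominates (a : nat) : exists2 k, (0 < k)%N & (16 * a ^ k <= k`!)%N.
Proof.
have h m j : (m ^ j <= (m + j)`!)%N.
  elim: j => [|j IH]; first by rewrite expn0 fact_gt0.
  by rewrite addnS factS expnS leq_mul// -addnS leq_addr.
(* With k = 2m: (2m)! >= m^m = 16^m (a+1)^(2m). *)
pose m := (16 * a.+1 ^ 2)%N; have m0 : (0 < m)%N by rewrite muln_gt0 expn_gt0.
exists (m + m)%N; first by rewrite addn_gt0 m0.
apply: leq_trans (h m m); rewrite {4}/m expnMn -expnM mul2n -addnn leq_mul//.
  by rewrite -{1}(expn1 16) leq_pexp2l.
by rewrite leq_exp2r ?addn_gt0 ?m0.
Qed.

End AngularDerivative.

Section SeparatedSmallValues.
Variable R : realType.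
Implicit Types (x : R) (p : {poly R[i]}).

(** The divided difference at x0 and the x_i, solved for u(x0). The list [y] puts x0 in position 0
    and shifts the x_i by one. *)
Lemma lagrange_bound (u : R -> R) K (x : 'I_K -> R) (x0 L : R)
    (y := fun i => oapp x x0 (unlift ord0 i)) :
  (forall i, x i != x0) -> injective x ->
  `|\sum_(i < K.+1) u (y i) / \prod_(j | j != i) (y i - y j)| <= L ->
  `|u x0| <= L * \prod_i `|x0 - x i| +
     \sum_i `|u (x i)| * \prod_(j | j != i) (`|x0 - x j| / `|x i - x j|).
Proof.
move=> xx0 xinj; move: (erefl (\sum_(i < K.+1) u (y i) / \prod_(j | j != i) (y i - y j))).
move: {1 3}(\sum_(i < K.+1) _) => c ec cL.
have y0 : y ord0 = x0 by rewrite /y unlift_none.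
have yl i : y (lift ord0 i) = x i by rewrite /y liftK.
set D := \prod_j (x0 - x j).
have D0 : \prod_(j | j != ord0) (y ord0 - y j) = D.
  rewrite big_mkcond big_ord_recl eqxx /= mul1r; apply: eq_bigr => j _.
  by rewrite y0 yl.
have Di i : \prod_(j | j != lift ord0 i) (y (lift ord0 i) - y j) =
    (x i - x0) * \prod_(j | j != i) (x i - x j).
  rewrite big_mkcond big_ord_recl neq_lift y0 yl; congr (_ * _).
  rewrite [RHS]big_mkcond; apply: eq_bigr => j _.
  by rewrite (inj_eq (@lift_inj _ _)) yl.
have Dn0 : D != 0 by apply/prodf_neq0 => j _; rewrite subr_eq0 eq_sym.
have -> : u x0 = D * c - \sum_i D * (u (x i) / ((x i - x0) * \prod_(j | j != i) (x i - x j))).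
  rewrite -mulr_sumr -mulrBr ec big_ord_recl D0 y0.
  by under eq_bigr do rewrite Di yl; rewrite addrK mulrC divfK.
apply: le_trans (ler_normB _ _) _; apply: lerD.
  by rewrite normrM mulrC normr_prod ler_wpM2r// prodr_ge0.
apply: le_trans (ler_norm_sum _ _ _) _; apply: ler_sum => i _.
rewrite /D (bigD1 i)//= !(normrM, normfV, normr_prod) [`|x i - x0|]distrC prodf_div.
have h : `|x0 - x i| != 0 by rewrite normr_eq0 subr_eq0 eq_sym.
have h' : \prod_(j | j != i) `|x i - x j| != 0.
  by apply/prodf_neq0 => j ji; rewrite normr_eq0 subr_eq0 (inj_eq xinj) eq_sym.
by rewrite le_eqVlt; apply/orP; left; apply/eqP; field; rewrite h h'.
Qed.

(** Some nearby x0 has |Re F| >= sqrt(T) / 2. If all x_i had tiny values, [lagrange_bound] would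
    contradict this: the derivative term scales as (4T)^K (b / T)^K / K!, free of T and beaten by
    the factorial, and the interpolation term is made small by delta. *)
Lemma separated_small_points : exists2 K : nat, (0 < K)%N & forall sigma : R, 0 < sigma ->
  exists2 delta : R, 0 < delta & forall t (x : 'I_K -> R), (4 <= t)%N ->
    (forall i j, `|x i - x j| <= 1 / 2 ^+ t) ->
    (forall i j, i != j -> sigma / 2 ^+ t <= `|x i - x j|) ->
    exists i, delta * Num.sqrt (2 ^+ t) <= `|Re (rs R t.+1).1.[expi (x i)]|.
Proof.
(* The radius 2^14 / T of the window with a large value, plus the spread 1 / T of the points. *)
pose b := (2 ^ 14).+1.
have [K K0 Kfact] := factorial_dominates (4 * b).
exists K => // sigma sigma0.
pose C : R := b%:R / sigma; have C0 : 0 < C by rewrite divr_gt0.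
(* K Lagrange weights of size at most C^(K-1); the 2 gives delta <= 1/16, so that no x_i can
   coincide with x0. *)
have [m mE] : exists m, m = K%:R * C ^+ K.-1 + 2 by eexists.
have m2 : 2 <= m by rewrite mE lerDr mulr_ge0// exprn_ge0// ltW.
exists (1 / (8 * m)) => [|t x t4 xclose xsep]; first by rewrite divr_gt0//; lra.
set T : R := 2 ^+ t in xclose xsep *; have T0 : 0 < T by rewrite exprn_gt0.
set S := Num.sqrt T; have S0 : 0 < S by rewrite sqrtr_gt0.
have S2 : S ^+ 2 = T by rewrite sqr_sqrtr// ltW.
set F := (rs R t.+1).1; pose u y := Re F.[expi y].
apply/not_existsP => H.
have small i : `|u (x i)| <= 1 / (8 * m) * S.
  by rewrite leNgt; apply/negP => /ltW h; apply: (H i).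
have dm : 1 / (8 * m) <= 1 / 16 by rewrite ler_pdivrMr; lra.
have [x0 [x0close x0big]] := rs_large_in_window (x (Ordinal K0)) t4.
rewrite -/T -/F -/(u x0) in x0close x0big.
have ux0 : S / 2 <= `|u x0|.
  rewrite -(@ler_pXn2r _ 2) ?nnegrE//; last by rewrite divr_ge0// ltW.
  by rewrite real_normK ?num_real// expr_div_n S2; lra.
have x0i i : x i != x0.
  by apply/eqP => e; have := small i; rewrite e; nra.
have xinj : injective x.
  move=> i j e; apply/eqP; apply: contraT => /xsep; rewrite e subrr normr0 leNgt.
  by rewrite divr_gt0.
have dist i : `|x0 - x i| <= b%:R / T.
  rewrite -[x0](subrK (x (Ordinal K0))) -addrA; apply: le_trans (ler_normD _ _) _.
  apply: le_trans (lerD x0close (xclose _ _)) _.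
  by rewrite /b -[X in _ <= X / _]natr1 natrX mulrDl.
have [sF _] := size_rs R t.+1.
have TN : (2 ^ t.+1)%:R = 2 * T by rewrite natrX exprS.
have F2S z : nrm z = 1 -> nrm F.[z] <= 2 * S by exact: nrm_rs_le_sqrt.
pose f j y := Re (iter j (@angle_deriv R) F).[expi y].
have fd (j : nat) (y : R) : is_derive y 1 (f j) (f j.+1 y) by exact: is_derive_Re_expi.
pose y i := oapp x x0 (unlift ord0 i) : R.
have yinj : injective y.
  move=> i j; rewrite /y; case: (unliftP ord0 i) => [i'|] ->; case: (unliftP ord0 j) => [j'|] -> //=.
  - by move=> /xinj ->.
  - by move=> /eqP; rewrite (negbTE (x0i _)).
  - by move=> /eqP; rewrite eq_sym (negbTE (x0i _)).
have [c fc] := divided_difference fd yinj.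
have fKc : `|f K c| <= (4 * T) ^+ K * (2 * S).
  apply: le_trans (normr_Re_le _) _.
  have [_ h] := iter_angle_deriv K sF F2S; apply: le_trans (h _ (nrm_expi c)) _.
  by rewrite TN mulrA -natrM.
have fact0 : (K`!)%:R != 0 :> R by rewrite pnatr_eq0 -lt0n fact_gt0.
have factp : 0 < (K`!)%:R :> R by rewrite ltr0n fact_gt0.
have ddK : `|\sum_(i < K.+1) u (y i) / \prod_(j | j != i) (y i - y j)|
    <= (4 * T) ^+ K * (2 * S) / (K`!)%:R.
  rewrite -[X in `|X|](mulKf fact0) -fc mulrC normrM normfV (gtr0_norm factp).
  by rewrite ler_pM2r// invr_gt0.
have := lagrange_bound x0i xinj ddK.
apply/negP; rewrite -ltNge; apply: lt_le_trans ux0.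
apply: le_lt_trans (_ : S / 8 + S / 8 < _); last by lra.
apply: lerD.
  apply: le_trans (_ : (4 * T) ^+ K * (2 * S) / (K`!)%:R * (b%:R / T) ^+ K <= _).
    rewrite ler_wpM2l//.
      by rewrite divr_ge0 ?ler0n// mulr_ge0 ?exprn_ge0 ?mulr_ge0// ltW.
    rewrite -[X in _ <= _ ^+ X](card_ord K) -prodr_const; apply: ler_prod => i _.
    by rewrite normr_ge0 dist.
  rewrite mulrAC ler_pdivrMr//.
  have -> : (4 * T) ^+ K * (2 * S) * (b%:R / T) ^+ K = (4 * b%:R) ^+ K * (2 * S).
    by rewrite mulrAC -exprMn; congr (_ ^+ _ * _); field; rewrite gt_eqF.
  have : 16 * (4 * b%:R) ^+ K <= (K`!)%:R :> R by rewrite -natrM -natrX -natrM ler_nat.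
  by nra.
apply: le_trans (_ : \sum_(i < K) 1 / (8 * m) * S * C ^+ K.-1 <= _).
  apply: ler_sum => i _; apply: ler_pM => //; first by apply: prodr_ge0 => j _; rewrite divr_ge0.
  have -> : K.-1 = #|predC1 i| by rewrite cardC1 card_ord.
  rewrite -prodr_const; apply: ler_prod => j ji; rewrite divr_ge0//= ler_pdivrMr; last first.
    by rewrite normr_gt0 subr_eq0 (inj_eq xinj) eq_sym.
  apply: le_trans (dist j) _; have := xsep i j; rewrite eq_sym => /(_ ji) h.
  apply: le_trans (_ : C * (sigma / T) <= _); last by rewrite ler_pM2l.
  by rewrite /C mulrA divfK// gt_eqF.
rewrite sumr_const card_ord -[leLHS]mulr_natl.
have -> : K%:R * (1 / (8 * m) * S * C ^+ K.-1) = S / 8 * ((K%:R * C ^+ K.-1) / m).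
  by field; rewrite gt_eqF//; lra.
rewrite ler_piMr//; first by rewrite divr_ge0// ltW.
by rewrite ler_pdivrMr ?mE; lra.
Qed.

End SeparatedSmallValues.

(** * Bad cells *)

Section Clusters.
Local Open Scope nat_scope.
Variables (bad : pred nat) (r A w : nat).
Hypotheses (few : forall i, count bad (iota i w) < r) (A0 : 0 < A) (rAw : r * A <= w).

Definition gap_start i := ~~ has bad (iota i A).

(* Two bad cells get the same label when no A consecutive good cells separate them. *)
Definition cluster j := count gap_start (iota 0 j).

Lemma clusterD j k : cluster (j + k) = cluster j + count gap_start (iota j k).
Proof. by rewrite /cluster iotaD count_cat. Qed.

Lemma cluster_le j : cluster j <= j.
Proof. by rewrite /cluster -{2}(size_iota 0 j) count_size. Qed.

(** Some run of A good cells starts between them; it starts after j and ends before j + k because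
    both of these are bad. *)
Lemma cluster_far j k : bad j -> bad (j + k) -> cluster j != cluster (j + k) -> A < k.
Proof.
clear few rAw; move=> bj bk; rewrite clusterD -{1}[cluster j]addn0 eqn_add2l eq_sym -lt0n -has_count.
move=> /hasP[i0]; rewrite mem_iota => /andP[ji ik] /hasPn gi.
rewrite ltnNge; apply/negP => kA.
have [e|ji'] := eqVneq i0 j.
  by have /negP[] : ~~ bad j by apply: gi; rewrite mem_iota e leqnn -[X in X < _]addn0 ltn_add2l.
by have /negP[] : ~~ bad (j + k) by apply: gi; rewrite mem_iota; lia.
Qed.

Lemma dense_blocks i c : (forall b, b < c -> has bad (iota (i + b * A) A)) ->
  c <= count bad (iota i (c * A)).
Proof.
elim: c => // c IH H; rewrite mulSnr iotaD count_cat -addn1 leq_add//.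
  by apply: IH => b bc; apply: H; rewrite ltnS ltnW.
by rewrite -has_count H.
Qed.

(** Pigeonhole: r disjoint blocks of length A, each with a bad cell, would give r bad cells in one
    window. *)
Lemma gap_in_window j : exists2 i, j <= i < j + w & gap_start i.
Proof.
have [/existsP[b gb] | ] := boolP [exists b : 'I_r, gap_start (j + b * A)].
  exists (j + b * A) => //; rewrite leq_addr ltn_add2l.
  by rewrite (leq_trans _ rAw)// ltn_mul2r A0 ltn_ord.
rewrite negb_exists => /forallP H; have := few j; rewrite ltnNge => /negP[].
apply: leq_trans (dense_blocks (i := j) _) _ => [b br|].
  by have /negPn := H (Ordinal br).
by rewrite -(subnK rAw) addnC iotaD count_cat leq_addr.
Qed.

Lemma cluster_bounded j k : cluster j = cluster (j + k) -> k < w.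
Proof.
rewrite clusterD => e; rewrite ltnNge; apply/negP => wk.
have [i /andP[ji iw] gi] := gap_in_window j.
suff : 0 < count gap_start (iota j k) by lia.
by rewrite -has_count; apply/hasP; exists i; rewrite // mem_iota; lia.
Qed.

Lemma count_windows c : count bad (iota 0 (c * w)) <= c * r.
Proof.
elim: c => [|c IH]; first by rewrite mul0n.
by rewrite !mulSnr iotaD count_cat leq_add// ltnW.
Qed.

End Clusters.

(** * The sine target *)

Section OddKernel.
Variable R : realType.
Implicit Types (x a : R) (q : nat).

(** [odd_kernel] is cos x (sin(qx) / (q sin x))^2, a Fejer kernel moved to odd frequencies: it
    equals 1 at 0, is nonnegative on [-pi/2, pi/2] and changes sign under x -> pi - x. *)
Definition odd_coef q p : R := (2 * q%:R - (2 * p + 1)%:R) / q%:R ^+ 2.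

Definition odd_kernel q x : R := \sum_(p < q) odd_coef q p * cos ((2 * p + 1)%:R * x).

Lemma sum_cos_odd q x :
  2 * (\sum_(p < q) cos ((2 * p + 1)%:R * x)) * sin x = sin ((2 * q)%:R * x).
Proof.
elim: q => [|q IH]; first by rewrite big_ord0 muln0 mul0r sin0 mulr0 mul0r.
rewrite big_ord_recr/= mulrDr mulrDl IH.
have -> : (2 * q.+1)%:R * x = (2 * q + 1)%:R * x + x.
  by rewrite !natrM -natr1 natrD natrM; ring.
have -> : (2 * q)%:R * x = (2 * q + 1)%:R * x - x by rewrite natrD; ring.
by rewrite sinB sinD; ring.
Qed.

Lemma sum_odd_weights q x :
  (\sum_(p < q) (2 * q%:R - (2 * p + 1)%:R) * cos ((2 * p + 1)%:R * x)) * sin x ^+ 2 =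
  cos x * sin (q%:R * x) ^+ 2.
Proof.
elim: q => [|q IH]; first by rewrite big_ord0 mul0r mul0r sin0; ring.
have -> : \sum_(p < q.+1) (2 * q.+1%:R - (2 * p + 1)%:R) * cos ((2 * p + 1)%:R * x) =
  \sum_(p < q) (2 * q%:R - (2 * p + 1)%:R) * cos ((2 * p + 1)%:R * x) +
  2 * (\sum_(p < q) cos ((2 * p + 1)%:R * x)) + cos ((2 * q + 1)%:R * x).
  rewrite big_ord_recr/= mulr_sumr -big_split/=; congr (_ + _).
    by apply: eq_bigr => p _; rewrite -[q.+1%:R]natr1; ring.
  by rewrite -[q.+1%:R]natr1 natrD natrM; ring.
rewrite [LHS]mulrDl [X in X + _ = _]mulrDl IH [sin x ^+ 2]expr2 [X in _ + X + _]mulrA sum_cos_odd.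
have -> : (2 * q)%:R * x = q%:R * x + q%:R * x by rewrite natrM; ring.
have -> : (2 * q + 1)%:R * x = q%:R * x + q%:R * x + x by rewrite natrD natrM; ring.
have -> : q.+1%:R * x = q%:R * x + x by rewrite -natr1; ring.
rewrite !(sinD, cosD); have := cos2Dsin2 x.
move: (sin (q%:R * x)) (cos (q%:R * x)) (sin x) (cos x) => sa ca sx cx h.
apply/eqP; rewrite -subr_eq0; apply/eqP.
transitivity ((cx * sa ^+ 2 + 2 * sx * sa * ca) * (1 - (cx ^+ 2 + sx ^+ 2))).
  by ring.
by rewrite h subrr mulr0.
Qed.

Lemma odd_kernel_closed q x : (0 < q)%N ->
  odd_kernel q x * (q%:R * sin x) ^+ 2 = cos x * sin (q%:R * x) ^+ 2.
Proof.
move=> q0; rewrite -sum_odd_weights /odd_kernel exprMn mulrA mulr_suml; congr (_ * _).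
apply: eq_bigr => p _; rewrite /odd_coef mulrAC divfK//.
by rewrite expf_neq0// pnatr_eq0 -lt0n.
Qed.

Lemma odd_coef_ge0 q p : (p < q)%N -> 0 <= odd_coef q p.
Proof.
by move=> pq; rewrite divr_ge0 ?sqr_ge0// -natrM subr_ge0 ler_nat; lia.
Qed.

Lemma odd_coef_sum q : (0 < q)%N -> \sum_(p < q) odd_coef q p = 1.
Proof.
move=> q0; rewrite -mulr_suml; have -> : \sum_(p < q) (2 * q%:R - (2 * p + 1)%:R) = q%:R ^+ 2 :> R.
  rewrite sumrB sumr_const card_ord.
  suff -> : \sum_(p < q) (2 * p + 1)%:R = q%:R ^+ 2 :> R by rewrite -[_ *+ q]mulr_natl; ring.
  elim: q {q0} => [|q IH]; first by rewrite big_ord0 expr0n.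
  by rewrite big_ord_recr/= IH -[q.+1%:R]natr1 natrD natrM; ring.
by rewrite divff// expf_neq0// pnatr_eq0 -lt0n.
Qed.

Lemma odd_coef_le q p : (0 < q)%N -> odd_coef q p <= 2 / q%:R.
Proof.
move=> q0; have qR : 0 < q%:R :> R by rewrite ltr0n.
have -> : 2 / q%:R = (2 * q%:R) / q%:R ^+ 2 :> R by field; rewrite gt_eqF.
by rewrite ler_pM2r ?invr_gt0 ?exprn_gt0// gerBl.
Qed.

Lemma odd_kernel_le1 q x : (0 < q)%N -> `|odd_kernel q x| <= 1.
Proof.
move=> q0; rewrite -(odd_coef_sum q0); apply: le_trans (ler_norm_sum _ _ _) _.
apply: ler_sum => p _; rewrite normrM ger0_norm ?odd_coef_ge0//.
by rewrite ler_piMr ?odd_coef_ge0// cos_max.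
Qed.

Lemma odd_kernelN q x : odd_kernel q (- x) = odd_kernel q x.
Proof. by apply: eq_bigr => p _; rewrite mulrN cosN. Qed.

Lemma odd_kernel_peak q x : (0 < q)%N -> q%:R * `|x| <= 1 / 2 -> 1 / 2 <= odd_kernel q x.
Proof.
move=> q0 qx; apply: le_trans (_ : \sum_(p < q) odd_coef q p * (1 / 2) <= _).
  by rewrite -mulr_suml odd_coef_sum//; lra.
apply: ler_sum => p _; rewrite ler_wpM2l ?odd_coef_ge0//.
apply: le_trans (cos_ge _); set y := _ * x.
have : `|y| <= 1.
  rewrite normrM normr_nat; apply: le_trans (_ : (2 * q%:R) * `|x| <= _); last by lra.
  by rewrite ler_wpM2r// -natrM ler_nat; have := ltn_ord p; lia.
by rewrite ler_norml => /andP[? ?]; nra.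
Qed.

Lemma odd_kernel_decay q x s : (0 < q)%N -> 0 < s -> s <= sin x ->
  `|odd_kernel q x| <= (q%:R * s) ^- 2.
Proof.
move=> q0 s0 sx; have qR : 0 < q%:R :> R by rewrite ltr0n.
have qs : 0 < (q%:R * s) ^+ 2 by rewrite exprn_gt0// mulr_gt0.
rewrite -[leRHS]mul1r ler_pdivlMr//.
apply: le_trans (_ : `|odd_kernel q x| * (q%:R * sin x) ^+ 2 <= _).
  rewrite ler_wpM2l// ler_pXn2r ?nnegrE ?mulr_ge0 ?ler_pM2l//; lra.
have h : 0 <= (q%:R * sin x) ^+ 2 by exact: sqr_ge0.
rewrite -[X in _ * X](ger0_norm h) -normrM odd_kernel_closed// normrM.
by rewrite -[leRHS]mulr1 ler_pM// ?cos_max// normrX exprn_ile1// sin_max.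
Qed.

Lemma odd_kernel_ge0 q x : (0 < q)%N -> - (pi / 2) <= x <= pi / 2 -> 0 <= odd_kernel q x.
Proof.
move=> q0; wlog x0 : x / 0 <= x.
  move=> H /andP[x1 x2]; case: (lerP 0 x) => x0; first by apply: H; rewrite // x1 x2.
  by rewrite -odd_kernelN; apply: H; [rewrite oppr_ge0 ltW | rewrite lerN2 x2 lerNl x1].
move=> /andP[x1 x2]; have qR : 0 < q%:R :> R by rewrite ltr0n.
have [->|xn0] := eqVneq x 0.
  apply: le_trans (odd_kernel_peak q0 _); first by rewrite divr_ge0.
  by rewrite normr0 mulr0 divr_ge0.
have sx : 0 < sin x.
  by apply: sin_gt0_pi; rewrite lt0r xn0 x0/=; have := pi_gt0 R; lra.
have qs : 0 < (q%:R * sin x) ^+ 2 by rewrite exprn_gt0// mulr_gt0.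
rewrite -(pmulr_lge0 _ qs) odd_kernel_closed// mulr_ge0 ?sqr_ge0//.
by apply: cos_ge0_pihalf; rewrite x1 x2.
Qed.

Lemma cos_nat_pi_sub n x : odd n -> cos (n%:R * (pi - x)) = - cos (n%:R * x).
Proof.
move=> on; rewrite mulrBr -cosN opprB.
suff H (k : nat) (y : R) : cos (y - (2 * k + 1)%:R * pi) = - cos y.
  by rewrite -(odd_double_half n) on add1n -addn1 -mul2n H.
elim: k y => [|k IH] y; first by rewrite mul1r -cosN opprB cosB cospi sinpi; ring.
have -> : y - (2 * k.+1 + 1)%:R * pi = (y - pi - pi) - (2 * k + 1)%:R * pi.
  by rewrite !natrD !natrM -natr1; ring.
by rewrite IH !cosB !sinB cospi sinpi; ring.
Qed.

Lemma odd_kernel_pi_sub q x : odd_kernel q (pi - x) = - odd_kernel q x.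
Proof.
rewrite /odd_kernel -sumrN; apply: eq_bigr => p _.
by rewrite cos_nat_pi_sub ?mulrN// addn1 /= oddM.
Qed.

(** Pairing the peaks at a and -a with opposite signs leaves a pure sine series. *)
Lemma odd_kernel_diff q x a : odd_kernel q (x - a) - odd_kernel q (x + a) =
  \sum_(p < q) 2 * odd_coef q p * sin ((2 * p + 1)%:R * a) * sin ((2 * p + 1)%:R * x).
Proof.
rewrite /odd_kernel -sumrB; apply: eq_bigr => p _.
by rewrite mulrBr mulrDr cosB cosD; ring.
Qed.

End OddKernel.

(** * Sums of signed kernels over the bad cells *)

Section Target.
Variable R : realType.
Implicit Types (x a b : R).

(** With truncated subtraction the argument of [g] is |j - j0|, and each distance occurs at most
    twice. *)
Lemma sum_dist_le (g : nat -> R) m (j0 : nat) : (forall d, 0 <= g d) -> (j0 < m)%N ->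
  \sum_(j < m) g ((j - j0) + (j0 - j))%N <= 2 * \sum_(d < m) g d.
Proof.
move=> g0 jm.
have part k : (k <= m)%N -> \sum_(0 <= d < k) g d <= \sum_(d < m) g d.
  move=> km; rewrite -(big_mkord xpredT g) (bigop.big_cat_nat (leq0n k) km)/= lerDl.
  by apply: sumr_ge0 => d _.
rewrite -(big_mkord xpredT (fun j => g ((j - j0) + (j0 - j))%N)).
rewrite (bigop.big_cat_nat (leq0n j0) (ltnW jm))/= mulr_natl mulr2n.
apply: lerD.
  apply: le_trans (part j0.+1 jm).
  apply: le_trans (_ : \sum_(0 <= j < j0) g (j0 - j)%N <= _).
    by rewrite !big_mkord; apply: ler_sum => j _; have -> : (j - j0 + (j0 - j) = j0 - j)%N by have := ltn_ord j; lia.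
  rewrite big_nat_recl// -[leLHS]add0r lerD// big_nat_rev/= add0n !big_mkord.
  by apply: ler_sum => j _; have -> : (j0 - (j0 - j.+1) = j.+1)%N by have := ltn_ord j; lia.
apply: le_trans (part (m - j0)%N (leq_subr _ _)).
rewrite -{1}[j0]add0n big_addn !big_mkord; apply: ler_sum => d _.
by have -> : (d + j0 - j0 + (j0 - (d + j0)) = d)%N by lia.
Qed.

Lemma sin_dist_le a b : 0 <= a <= pi / 2 -> 0 <= b <= pi / 2 ->
  `|a - b| / 4 <= sin `|a - b| /\ `|a - b| / 4 <= sin (a + b).
Proof.
move=> /andP[a0 a1] /andP[b0 b1]; have pi0 := pi_gt0 R.
have d2 : `|a - b| <= pi / 2 by rewrite ler_norml; apply/andP; split; lra.
split; first by apply: sin_ge_quarter; rewrite normr_ge0.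
case: (lerP (a + b) (pi / 2)) => ab.
  apply: le_trans (_ : (a + b) / 4 <= _); last by apply: sin_ge_quarter; rewrite ab addr_ge0.
  by rewrite ler_pM2r ?invr_gt0// ler_norml; apply/andP; split; lra.
have -> : sin (a + b) = sin (pi - (a + b)) by rewrite [RHS]sinB sinpi cospi; ring.
apply: le_trans (_ : (pi - (a + b)) / 4 <= _).
  by rewrite ler_pM2r ?invr_gt0// ler_norml; apply/andP; split; lra.
by apply: sin_ge_quarter; apply/andP; split; lra.
Qed.

Section Fixed.
Variables (n q : nat).
Hypotheses (q0 : (0 < q)%N) (nq : (n <= 3 * q)%N) (qn : (2 * q <= n)%N).
Let h : R := pi / (2 * n%:R).

Definition grid (j : nat) : R := j%:R * (pi / (2 * n%:R)).

Let n0 : 0 < n%:R :> R. Proof. by rewrite ltr0n; lia. Qed.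
Let qR : 0 < q%:R :> R. Proof. by rewrite ltr0n. Qed.
Let h0 : 0 < h. Proof. by rewrite divr_gt0 ?pi_gt0// mulr_gt0. Qed.

Let qh : 1 / 3 <= q%:R * h.
Proof.
rewrite /h mulrA ler_pdivlMr ?mulr_gt0//.
have : n%:R <= 3 * q%:R :> R by rewrite -natrM ler_nat.
have : q%:R * 2 <= q%:R * pi :> R by rewrite ler_pM2l// pi_ge2.
by lra.
Qed.

Let grid_range (j : nat) : (j <= n)%N -> 0 <= grid j <= pi / 2.
Proof.
move=> jn; have pi0 := pi_gt0 R; rewrite /grid mulr_ge0 ?(ltW h0)//=.
have -> : pi / 2 = n%:R * h by rewrite /h; field; rewrite gt_eqF.
by rewrite ler_pM2r// ler_nat.
Qed.

(** q s >= d q h / 8 >= d / 24, whence the constant 24. *)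
Let decay x s (d : nat) : (0 < d)%N -> d%:R * h <= 8 * s -> s <= sin x ->
  `|odd_kernel q x| <= 24 ^+ 2 * d%:R ^- 2.
Proof.
move=> d0 ds sx; have dR : 0 < d%:R :> R by rewrite ltr0n.
have dh0 : 0 < d%:R * h by rewrite mulr_gt0.
have s0 : 0 < s by lra.
apply: le_trans (odd_kernel_decay q0 s0 sx) _.
have -> : 24 ^+ 2 * d%:R ^- 2 = (d%:R / 24) ^- 2 :> R by field; rewrite gt_eqF.
have qs0 : 0 < q%:R * s by rewrite mulr_gt0.
rewrite lef_pV2 ?posrE ?exprn_gt0 ?divr_gt0//.
rewrite ler_pXn2r ?nnegrE ?divr_ge0// ?(ltW qs0)//.
have : q%:R * (d%:R * h) <= q%:R * (8 * s) by rewrite ler_pM2l.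
have : d%:R * (1 / 3) <= d%:R * (q%:R * h) by rewrite ler_pM2l.
by lra.
Qed.

Variables (theta : R) (j0 : nat).
Hypotheses (theta_range : 0 <= theta <= pi / 2) (j0n : (j0 <= n)%N)
  (theta_j0 : `|theta - grid j0| <= h / 2).

Let dist_ge (j : nat) : (j != j0)%N ->
  ((j - j0) + (j0 - j))%:R * h <= 2 * `|theta - grid j|.
Proof.
move=> jj; set d := (_ + _)%N; have d1 : 1 <= d%:R :> R by rewrite ler1n /d; lia.
have e : d%:R * h = `|grid j - grid j0|.
  rewrite /grid -mulrBl normrM [`|pi / _|]gtr0_norm//; congr (_ * _).
  rewrite /d; case: (leqP j j0) => jj0.
    by rewrite (eqP jj0) add0n distrC -natrB// normr_nat.
  by rewrite (eqP (ltnW jj0)) addn0 -natrB 1?ltnW// normr_nat.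
have : `|grid j - grid j0| <= `|theta - grid j| + `|theta - grid j0|.
  by rewrite [`|theta - grid j|]distrC; have := ler_normD (grid j - theta) (theta - grid j0); rewrite subrKA.
by rewrite -e; have := h0; move: theta_j0; nra.
Qed.

Let pair_decay (j : nat) : (j <= n)%N -> j != j0 ->
  `|odd_kernel q (theta - grid j)| <= 24 ^+ 2 * ((j - j0) + (j0 - j))%:R ^- 2 /\
  `|odd_kernel q (theta + grid j)| <= 24 ^+ 2 * ((j - j0) + (j0 - j))%:R ^- 2.
Proof.
move=> jn jj; have d0 : (0 < (j - j0) + (j0 - j))%N by lia.
have [s1 s2] := sin_dist_le theta_range (grid_range jn).
have dd : ((j - j0) + (j0 - j))%:R * h <= 8 * (`|theta - grid j| / 4).
  by have := dist_ge jj; lra.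
split; last exact: decay dd s2.
have -> : odd_kernel q (theta - grid j) = odd_kernel q `|theta - grid j|.
  have /orP[x0|x0] := le_total 0 (theta - grid j); first by rewrite ger0_norm.
  by rewrite ler0_norm// odd_kernelN.
exact: decay dd s1.
Qed.

Variables (B : {set 'I_n.+1}) (alpha : 'I_n.+1 -> R).
Hypothesis alpha1 : forall j, `|alpha j| = 1.

Definition target x := \sum_(j in B) alpha j * (odd_kernel q (x - grid j) - odd_kernel q (x + grid j)).

Lemma target_upper : `|target theta| <= 4 * (9 * 24 ^+ 2).
Proof.
(* One majorant for all distances: (d + 2)^2 <= 9 d^2 for d >= 1, and at d = 0 the value exceeds 1.
   The shift by 2 makes the sum of inverse squares at most 1. *)
pose g (d : nat) : R := 9 * 24 ^+ 2 * d.+2%:R ^- 2.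
have g0 d : 0 <= g d by rewrite !mulr_ge0 ?invr_ge0 ?sqr_ge0.
apply: le_trans (_ : \sum_(j < n.+1) 2 * g ((j - j0) + (j0 - j))%N <= _).
  apply: le_trans (ler_norm_sum _ _ _) _; rewrite big_mkcond; apply: ler_sum => j _.
  case: ifP => _; last by rewrite mulr_ge0.
  rewrite normrM alpha1 mul1r; apply: le_trans (ler_normB _ _) _.
  have [jj|jj] := eqVneq (j : nat) j0.
    have : 2 <= 2 * g ((j - j0) + (j0 - j))%N by rewrite jj subnn /g addn0; lra.
    have := odd_kernel_le1 (theta - grid j) q0; have := odd_kernel_le1 (theta + grid j) q0.
    by lra.
  have [h1 h2] := pair_decay (ltn_ord j) jj.
  suff : 24 ^+ 2 * ((j - j0) + (j0 - j))%:R ^- 2 <= g ((j - j0) + (j0 - j))%N by lra.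
  have : (0 < (j - j0) + (j0 - j))%N by lia.
  rewrite /g; move: (_ + _)%N => d d0.
  have d1 : 1 <= d%:R :> R by rewrite ler1n.
  have -> : d.+2%:R = d%:R + 2 :> R by rewrite -addn2 natrD.
  have p1 : 0 < d%:R ^+ 2 :> R by rewrite exprn_gt0//; lra.
  have p2 : 0 < (d%:R + 2) ^+ 2 :> R by rewrite exprn_gt0//; lra.
  by rewrite ler_pdivrMr// mulrAC ler_pdivlMr//; nra.
rewrite -mulr_sumr.
have := sum_dist_le g0 (j0n : (j0 < n.+1)%N).
suff : \sum_(d < n.+1) g d <= 9 * 24 ^+ 2 by lra.
suff s1 : \sum_(d < n.+1) d.+2%:R ^- 2 <= 1 :> R by rewrite /g -mulr_sumr ler_piMr// mulr_ge0 ?sqr_ge0.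
have := sum_inv_sqr R n.+3 (ltn0Sn 0); rewrite big_mkcond 2!big_ord_recl /= !add0r invr1.
by apply: le_trans; apply: ler_sum => d _; rewrite /bump /= !add1n.
Qed.

Variable A : nat.
Hypotheses (A0 : (0 < A)%N) (j0B : forall j : 'I_n.+1, j = j0 :> nat -> j \in B)
  (B_gt : forall j : 'I_n.+1, j \in B -> (A < j)%N)
  (alpha_far : forall i j : 'I_n.+1, i = j0 :> nat -> j \in B -> alpha j != alpha i ->
     (A < (j - j0) + (j0 - j))%N).

(** Multiply by the sign at j0. Kernels of equal sign help, up to their mirror images, which are
    small because j > A or nonpositive beyond pi/2. Kernels of opposite sign sit farther than A. The
    mirror images cost 24^2 / A, the far kernels four times as much. *)
Lemma target_lower : 1 / 2 - 5 * 24 ^+ 2 / A%:R <= `|target theta|.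
Proof.
have pi0 := pi_gt0 R.
pose i0 : 'I_n.+1 := Ordinal (j0n : (j0 < n.+1)%N).
pose g (d : nat) : R := if (A < d)%N then 24 ^+ 2 * d%:R ^- 2 else 0.
have g0 d : 0 <= g d by rewrite /g; case: ifP => // _; rewrite !mulr_ge0 ?invr_ge0 ?sqr_ge0.
have -> : `|target theta| = `|alpha i0 * target theta| by rewrite normrM alpha1 mul1r.
apply: le_trans (ler_norm _); rewrite /target mulr_sumr big_mkcond.
apply: le_trans (_ : \sum_(j < n.+1) ((if j == i0 then 1 / 2 else 0) - g j
     - 2 * g ((j - j0) + (j0 - j))%N) <= _).
  rewrite !sumrB -mulr_sumr -big_mkcond big_pred1_eq.
  have := sum_dist_le g0 (j0n : (j0 < n.+1)%N).
  suff : \sum_(d < n.+1) g d <= 24 ^+ 2 / A%:R by lra.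
  rewrite /g -big_mkcond -mulr_sumr ler_wpM2l ?sqr_ge0//.
  exact: sum_inv_sqr.
have alpha_sq j : alpha j * alpha j = 1.
  by rewrite -expr2 -real_normK ?num_real// alpha1 expr1n.
apply: ler_sum => j _; have [jB|jB] := boolP (j \in B); last first.
  case: ifPn => [/eqP ji|_]; first by rewrite ji j0B in jB.
  by have := g0 j; have := g0 ((j - j0) + (j0 - j))%N; lra.
have [/andP[r1 r2] /andP[r3 r4]] := (theta_range, grid_range (ltn_ord j)).
have [aj|aj] := eqVneq (alpha j) (alpha i0).
  rewrite aj mulrA alpha_sq mul1r.
  have gj : odd_kernel q (theta + grid j) <= g j.
    case: (lerP (theta + grid j) (pi / 2)) => tj; last first.
      have -> : theta + grid j = pi - (pi - (theta + grid j)) by ring.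
      rewrite odd_kernel_pi_sub; apply: le_trans (g0 j); rewrite oppr_le0.
      by apply: odd_kernel_ge0 => //; apply/andP; split; lra.
    have Aj := B_gt jB; rewrite /g Aj.
    have j_gt0 : (0 < j)%N by exact: leq_trans Aj.
    have jd : j%:R * h <= 8 * ((theta + grid j) / 4) by rewrite -/(grid j); lra.
    have js : (theta + grid j) / 4 <= sin (theta + grid j).
      by apply: sin_ge_quarter; apply/andP; split; lra.
    exact: le_trans (ler_norm _) (decay j_gt0 jd js).
  have := g0 ((j - j0) + (j0 - j))%N.
  case: ifPn => [/eqP ji0|_]; last first.
    have : 0 <= odd_kernel q (theta - grid j).
      by apply: odd_kernel_ge0 => //; apply/andP; split; lra.
    by lra.
  have : 1 / 2 <= odd_kernel q (theta - grid j).
    apply: odd_kernel_peak => //; rewrite ji0 /=.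
    apply: le_trans (_ : q%:R * (h / 2) <= _); first by rewrite ler_pM2l.
    have qn2 : 2 * q%:R <= n%:R :> R by rewrite -natrM ler_nat.
    have e : n%:R * h = pi / 2 by rewrite /h; field; rewrite gt_eqF.
    have := @pihalf_lt2 R; have : 2 * q%:R * h <= n%:R * h by rewrite ler_pM2r.
    lra.
  by lra.
have far := alpha_far (erefl : i0 = j0 :> nat) jB aj.
have jj : (j : nat) != j0 by apply/eqP => e; move: far; rewrite e subnn.
case: ifPn => [/eqP ji|_]; first by rewrite ji eqxx in jj.
have [h1 h2] := pair_decay (ltn_ord j) jj.
have := g0 j; move: h1 h2; rewrite -/(g _) [g ((_ - _) + _)%N]/g far.
set u := odd_kernel q _; set v := odd_kernel q _; set w := 24 ^+ 2 * _ => h1 h2.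
have : `|alpha i0 * (alpha j * (u - v))| <= 2 * w.
  rewrite !normrM !alpha1 !mul1r; apply: le_trans (ler_normB _ _) _; lra.
by rewrite ler_norml => /andP[]; lra.
Qed.

End Fixed.
End Target.

(** * Skew-reciprocal structure and assembly *)

Section SkewStructure.
Variable R : realType.
Implicit Types (x : R) (z : R[i]).

Lemma sum_even_ord (V : zmodType) (g : nat -> V) n M : (M.*2 <= n)%N ->
  \sum_(k < n.+1 | ~~ odd k && (k <= M.*2)%N) g k = \sum_(l < M.+1) g l.*2.
Proof.
move=> Mn; rewrite -(big_mkord (fun k => ~~ odd k && (k <= M.*2)%N)).
rewrite -(big_nat_widen 0 M.*2.+1 n.+1 (fun k => ~~ odd k))// big_mkord.
elim: M {Mn} => [|M IH]; first by rewrite big_mkcond !big_ord1.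
rewrite big_mkcond 2!big_ord_recr -big_mkcond /= IH [RHS]big_ord_recr/=.
by rewrite odd_double /= addr0.
Qed.

Lemma sum_odd_ord (V : zmodType) (g : nat -> V) n q : (q.*2 <= n)%N ->
  \sum_(k < n.+1 | odd k && (k < q.*2)%N) g k = \sum_(p < q) g p.*2.+1.
Proof.
move=> qn; rewrite -(big_mkord (fun k => odd k && (k < q.*2)%N)).
rewrite -(big_nat_widen 0 q.*2 n.+1 (fun k => odd k))//; last by rewrite ltnW.
rewrite big_mkord; elim: q {qn} => [|q IH]; first by rewrite !big_ord0.
rewrite big_mkcond 2!big_ord_recr -big_mkcond /= IH [RHS]big_ord_recr/=.
by rewrite odd_double /= addr0.
Qed.

(* The coefficient of z^(n+k) is b k; that of z^(n-k) is b k if k is even and k <= m,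
   so that k carries a cosine, and - b k otherwise, so that k carries a sine. *)
Definition is_cos m k := ~~ odd k && (k <= m)%N.

Definition skew_coef (n m : nat) (b : nat -> int) (j : nat) : int :=
  if (n <= j)%N then b (j - n)%N else if is_cos m (n - j) then b (n - j)%N else - b (n - j)%N.

(** The correction by [b 0]: the middle coefficient occurs once, but the doubled sum counts it
    twice. *)
Definition cos_part n m (b : nat -> int) x : R :=
  2 * (\sum_(k < n.+1 | is_cos m k) (b k)%:~R * cos (k%:R * x)) - (b 0%N)%:~R.

Definition sin_part n m (b : nat -> int) x : R :=
  2 * \sum_(k < n.+1 | ~~ is_cos m k) (b k)%:~R * sin (k%:R * x).

Lemma skew_coef_eval n m b x :
  (poly_of_coefs R (skew_coef n m b) (2 * n)).[expi x] =
  expi (n%:R * x) * (cos_part n m b x +i* sin_part n m b x).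
Proof.
rewrite /poly_of_coefs horner_sum.
under eq_bigr do rewrite hornerZ hornerXn expiX.
pose G k : R[i] := (if is_cos m k then 2 * (b k)%:~R * cos (k%:R * x) else 0) +i*
  (if is_cos m k then 0 else 2 * (b k)%:~R * sin (k%:R * x)).
have pair k : (if is_cos m k then b k else - b k)%:~R * expi (- (k%:R * x)) +
    (b k)%:~R * expi (k%:R * x) = G k :> R[i].
  rewrite -!(rmorph_int (real_complex R)) /G /expi cosN sinN.
  by case: ifP => _; rewrite ?rmorphN/=; simpc; congr (_ +i* _); ring.
have -> : \sum_(j < (2 * n).+1) (skew_coef n m b j)%:~R * expi (j%:R * x) =
   expi (n%:R * x) * ((b 0%N)%:~R + \sum_(k < n) G k.+1).
  have e : (2 * n).+1 = (n + n.+1)%N by lia.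
  rewrite e big_split_ord/= big_ord_recl/= addn0.
  rewrite (reindex_inj rev_ord_inj)/= mulrDr mulr_sumr addrCA -big_split/=.
  congr (_ + _); first by rewrite /skew_coef leqnn subnn mulrC.
  apply: eq_bigr => k _; rewrite /skew_coef leq_addr addKn /bump /= add1n.
  have kn := ltn_ord k; have -> : (n <= n - k.+1)%N = false by lia.
  rewrite subKn// -pair mulrDr mulrCA -expiD [in RHS]mulrCA -expiD.
  by congr (_ * expi _ + _ * expi _); rewrite ?natrB ?natrD//; ring.
congr (_ * _).
have sumG (F H : nat -> R) N : \sum_(k < N) (F k.+1 +i* H k.+1) =
    (\sum_(k < N) F k.+1) +i* (\sum_(k < N) H k.+1).
  elim: N => [|N IH]; first by rewrite !big_ord0.
  by rewrite !big_ord_recr/= IH; simpc.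
rewrite /G (sumG (fun k => if is_cos m k then 2 * (b k)%:~R * cos (k%:R * x) else 0)
  (fun k => if is_cos m k then 0 else 2 * (b k)%:~R * sin (k%:R * x))).
rewrite -(rmorph_int (real_complex R)); simpc; congr (_ +i* _).
  rewrite /cos_part [in RHS]big_mkcond [in RHS]big_ord_recl /= mul0r cos0 mulr1 mulrDr mulr_sumr.
  set u := (b 0%N)%:~R; have -> (v : R) : 2 * u + v - u = u + v by ring.
  congr (_ + _); apply: eq_bigr => k _; rewrite /bump /= add1n.
  by case: ifP; rewrite ?mulr0// mulrA.
rewrite /sin_part [in RHS]big_mkcond [in RHS]big_ord_recl /= add0r mulr_sumr.
by apply: eq_bigr => k _; rewrite /bump /= add1n; case: ifP; rewrite /= ?mulr0// mulrA.
Qed.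

(** The reflections y -> -y and y -> pi - y keep even cosines and change odd sines by a common sign.
    Even sines have no such rule, but they enter only through the rounding error, which is bounded
    on the whole circle. *)
Lemma unit_circle_quarter z : nrm z = 1 ->
  exists (x y s : R), [/\ 0 <= x <= pi / 2, z = expi y, `|s| = 1,
    forall k, odd k -> sin (k%:R * y) = s * sin (k%:R * x) &
    forall k, ~~ odd k -> cos (k%:R * y) = cos (k%:R * x)].
Proof.
case: z => a b /(congr1 (fun u => u ^+ 2)); rewrite nrm_sqr expr1n /= => ab.
have a1 : - 1 <= `|a| <= 1.
  have := normr_ge0 a; have := sqr_ge0 b; have := real_normK (num_real a); nra.
pose x := acos `|a|.
have cx : cos x = `|a| by rewrite acosK.
have sx : sin x = `|b|.
  rewrite sin_acos// real_normK ?num_real//; have -> : 1 - a ^+ 2 = b ^+ 2 by lra.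
  by rewrite sqrtr_sqr.
have xr : 0 <= x <= pi / 2.
  rewrite acos_ge0//= leNgt; apply/negP => h.
  have := acos_lepi a1; rewrite -/x => h'.
  have : cos x < cos (pi / 2).
    have pi0 := pi_gt0 R.
    by rewrite ltr_cos// in_itv/=; apply/andP; split; lra.
  by rewrite cos_pihalf cx ltNge normr_ge0.
have refl k : expi (k%:R * (pi - x)) = (-1) ^+ k * expi (- (k%:R * x)) :> R[i].
  rewrite -mulrN -!expiX -exprMn; congr (_ ^+ _).
  by rewrite /expi cosB sinB cospi sinpi cosN sinN; simpc; congr (_ +i* _); ring.
have even_cos k : ~~ odd k -> cos (k%:R * (pi - x)) = cos (k%:R * x).
  move=> ek; have := refl k; rewrite -signr_odd (negbTE ek) mul1r => -[-> _].
  exact: cosN.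
have odd_sin k : odd k -> sin (k%:R * (pi - x)) = sin (k%:R * x).
  move=> ok; have := refl k; rewrite -signr_odd ok expr1 mulN1r => -[_ ->].
  by rewrite sinN opprK.
have [[a0 ea]|[a0 ea]] : (0 <= a /\ `|a| = a) \/ (a <= 0 /\ `|a| = - a).
  have /orP[h|h] := le_total 0 a; first by left; rewrite ger0_norm.
  by right; rewrite ler0_norm.
all: have [[b0 eb]|[b0 eb]] : (0 <= b /\ `|b| = b) \/ (b <= 0 /\ `|b| = - b)
  by (have /orP[h|h] := le_total 0 b; [left; rewrite ger0_norm | right; rewrite ler0_norm]).
- exists x, x, 1; split=> //; first by rewrite /expi cx sx ea eb.
    by rewrite normr1.
  by move=> k _; rewrite mul1r.
- exists x, (- x), (- 1); split=> //; first by rewrite /expi cosN sinN cx sx ea eb opprK.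
  + by rewrite normrN1.
  + by move=> k _; rewrite mulrN sinN mulN1r.
  + by move=> k _; rewrite mulrN cosN.
- exists x, (pi - x), 1; split=> //.
  + rewrite /expi cosB sinB cospi sinpi cx sx ea eb; congr (_ +i* _); ring.
  + by rewrite normr1.
  + by move=> k /odd_sin ->; rewrite mul1r.
- exists x, (- (pi - x)), (- 1); split=> //.
  + rewrite /expi cosN sinN cosB sinB cospi sinpi cx sx ea eb; congr (_ +i* _); ring.
  + by rewrite normrN1.
  + by move=> k /odd_sin h; rewrite mulrN sinN h mulN1r.
  + by move=> k /even_cos h; rewrite mulrN cosN h.
Qed.

End SkewStructure.

Section BadCells.
Variable R : realType.
Implicit Types (x : R).

(** By Bernstein, Re F moves by at most half of sqrt(T) from its value at 1. It keeps the bad cells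
    away from 0, where the sines vanish. *)
Lemma rs_large_near_1 t x : `|x| <= 1 / (16 * 2 ^+ t) ->
  Num.sqrt (2 ^+ t) / 2 <= `|Re (rs R t.+1).1.[expi x]|.
Proof.
set T : R := 2 ^+ t => xT; have T0 : 0 < T by rewrite exprn_gt0.
set S := Num.sqrt T; have S0 : 0 < S by rewrite sqrtr_gt0.
have S2 : S ^+ 2 = T by rewrite sqr_sqrtr// ltW.
set F := (rs R t.+1).1; pose u y := Re F.[expi y].
have [sF _] := size_rs R t.+1.
have F2S z : nrm z = 1 -> nrm F.[z] <= 2 * S by exact: nrm_rs_le_sqrt.
have ud (y : R) : is_derive y 1 u (Re (angle_deriv F).[expi y]) by exact: is_derive_Re_expi.
have u' y : `|Re (angle_deriv F).[expi y]| <= 8 * T * S.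
  apply: le_trans (normr_Re_le _) _.
  have [_ h] := iter_angle_deriv 1 sF F2S; apply: le_trans (h _ (nrm_expi y)) _.
  by rewrite expr1 natrX exprS -/T; lra.
have diff : `|u x - u 0| <= 8 * T * S * `|x|.
  have [x0|x0] := lerP 0 x.
    have [c _ ->] := mvt_le ud x0.
    by rewrite normrM subr0 (ger0_norm x0) ler_wpM2r.
  have [c _] := mvt_le ud (ltW x0); rewrite distrC => ->.
  by rewrite normrM sub0r normrN (ltr0_norm x0) ler_wpM2r// oppr_ge0 ltW.
have u0 : S <= `|u 0|.
  have [r er r2] := rs_at1 R t.+1.
  rewrite /u expi0 er /= -(@ler_pXn2r _ 2) ?nnegrE// ?(ltW S0)// S2 real_normK ?num_real//.
  by apply: le_trans r2; rewrite exprS -/T; lra.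
have : 8 * T * S * `|x| <= S / 2.
  have -> : S / 2 = 8 * T * S * (1 / (16 * T)) by field; rewrite gt_eqF.
  by rewrite ler_wpM2l// !mulr_ge0// ltW.
have := ler_normB (u x) (u x - u 0); rewrite opprB addrCA subrr addr0 -/(u x).
by move: diff u0; lra.
Qed.

Definition bad_cell n t (delta : R) (j : nat) : bool :=
  `[< exists2 x : R, `|x - grid R n j| <= pi / (2 * n%:R) / 2 &
      `|Re (rs R t.+1).1.[expi (2 * x)]| < delta * Num.sqrt (2 ^+ t) >].

Lemma bad_cell_far n t delta A j : delta <= 1 / 2 -> (0 < n)%N ->
  (128 * A.+1 * 2 ^ t <= n)%N -> bad_cell n t delta j -> (A < j)%N.
Proof.
move=> d2 n0 An /asboolP[x xj ux]; rewrite ltnNge; apply/negP => jA.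
have nR : 0 < n%:R :> R by rewrite ltr0n.
have T0 : 0 < 2 ^+ t :> R by rewrite exprn_gt0.
suff hx : `|2 * x| <= 1 / (16 * 2 ^+ t).
  have := rs_large_near_1 hx; rewrite leNgt => /negP; apply.
  by apply: lt_le_trans ux _; rewrite mulrC ler_wpM2l ?sqrtr_ge0//; lra.
rewrite normrM ger0_norm//.
set h : R := pi / (2 * n%:R) in xj.
have h0 : 0 < h by rewrite divr_gt0 ?pi_gt0// mulr_gt0.
have hn : h * n%:R <= 2.
  have -> : h * n%:R = pi / 2 by rewrite /h; field; rewrite gt_eqF.
  by have := @pihalf_lt2 R; lra.
have xA : `|x| <= A.+1%:R * h.
  rewrite -[x](subrK (grid R n j)); apply: le_trans (ler_normD _ _) _.
  have : `|grid R n j| <= A%:R * h.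
    have jh : 0 <= j%:R * h by apply: mulr_ge0 => //; exact: ltW.
    by rewrite /grid -/h ger0_norm// ler_pM2r// ler_nat.
  by rewrite -[A.+1%:R]natr1; lra.
rewrite ler_pdivlMr ?mulr_gt0//.
have : 128 * A.+1%:R * 2 ^+ t <= n%:R :> R by rewrite -natrX -!natrM ler_nat.
move=> An'.
have : h * (128 * A.+1%:R * 2 ^+ t) <= h * n%:R by rewrite ler_pM2l.
have : `|x| * (2 ^+ t) <= A.+1%:R * h * 2 ^+ t by rewrite ler_pM2r.
by lra.
Qed.

Lemma sorted_ltn_nth_double (s : seq nat) a b : sorted ltn s -> (2 * b < size s)%N ->
  (a < b)%N -> (nth 0%N s (2 * a) + 2 <= nth 0%N s (2 * b))%N.
Proof.
move=> so bs ab; have mono := sorted_ltn_nth ltn_trans 0%N so.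
have i1 : (2 * a < size s)%N by lia.
have i2 : ((2 * a).+1 < size s)%N by lia.
have h1 := mono _ _ i1 i2 (ltnSn _).
have h2 : (nth 0%N s (2 * a).+1 < nth 0%N s (2 * b))%N by apply: mono => //; lia.
by rewrite addn2 (leq_trans _ h2).
Qed.

(** From 2K bad cells take every second one: witnesses in the K chosen cells are at least one cell
    apart. Doubling their angles, since F is evaluated at z^2, gives points within 1 / T and
    separated by 1 / (Gam T). *)
Lemma few_bad_cells n t K (Gam delta : R) :
  (forall x : 'I_K -> R, (forall i j, `|x i - x j| <= 1 / 2 ^+ t) ->
    (forall i j, i != j -> 1 / Gam / 2 ^+ t <= `|x i - x j|) ->
    exists i, delta * Num.sqrt (2 ^+ t) <= `|Re (rs R t.+1).1.[expi (x i)]|) ->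
  (0 < n)%N -> 0 < Gam -> n%:R <= 2 * Gam * 2 ^+ t ->
  (0 < n %/ (4 * 2 ^ t))%N -> (0 < K)%N ->
  forall i, (count (bad_cell n t delta) (iota i (n %/ (4 * 2 ^ t))) < 2 * K)%N.
Proof.
move=> sep n0 G0 nG w0 K0 i; set w := (n %/ _)%N in w0 *; rewrite ltnNge; apply/negP => cK.
have nR : 0 < n%:R :> R by rewrite ltr0n.
have T0 : 0 < 2 ^+ t :> R by rewrite exprn_gt0.
have pi0 := pi_gt0 R; have pi2 := pi_ge2 R; have pi4 := @pihalf_lt2 R.
pose s := [seq j <- iota i w | bad_cell n t delta j].
have ss : (2 * K <= size s)%N by rewrite size_filter.
have so : sorted ltn s by rewrite sorted_filter ?iota_ltn_sorted//; exact: ltn_trans.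
have sK (a : 'I_K) : (2 * a < size s)%N by apply: leq_trans ss; rewrite ltn_pmul2l.
pose J (a : 'I_K) := nth 0%N s (2 * a).
have Jin a : J a \in s by rewrite mem_nth.
have Jbad a : bad_cell n t delta (J a) by have := Jin a; rewrite mem_filter => /andP[].
have Jrange a : (i <= J a < i + w)%N by have := Jin a; rewrite mem_filter mem_iota => /andP[].
have J2 (a b : 'I_K) : (a < b)%N -> (J a + 2 <= J b)%N.
  exact: sorted_ltn_nth_double.
have wit a : exists x : R, `|x - grid R n (J a)| <= pi / (2 * n%:R) / 2 /\
      `|Re (rs R t.+1).1.[expi (2 * x)]| < delta * Num.sqrt (2 ^+ t).
  by have /asboolP[x h1 h2] := Jbad a; exists x.
have [y yP] := choice wit.
set h : R := pi / (2 * n%:R) in yP.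
have h0 : 0 < h by rewrite divr_gt0// mulr_gt0.
have hn : h * n%:R = pi / 2 by rewrite /h; field; rewrite gt_eqF.
have gridB (a b : 'I_K) : grid R n (J a) - grid R n (J b) = ((J a)%:R - (J b)%:R) * h.
  by rewrite /grid mulrBl.
have [||a ha] := sep (fun a => 2 * y a).
- move=> a b; rewrite -mulrBr normrM ger0_norm//.
  have [/ler_normlP[ya1 ya2] _] := yP a; have [/ler_normlP[yb1 yb2] _] := yP b.
  have /andP[ja1 ja2] := Jrange a; have /andP[jb1 jb2] := Jrange b.
  have wn : w%:R * (4 * 2 ^+ t) <= n%:R :> R.
    by rewrite -natrX -!natrM ler_nat leq_divM.
  have hw : w%:R * h * (2 * 2 ^+ t) <= 1.
    have : h * (w%:R * (4 * 2 ^+ t)) <= h * n%:R by rewrite ler_pM2l.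
    by lra.
  have jab : `|((J a)%:R - (J b)%:R) * h| <= (w%:R - 1) * h.
    rewrite normrM (gtr0_norm h0) ler_pM2r// ler_norml.
    have : (J a)%:R + 1 <= (J b)%:R + w%:R :> R.
      by rewrite natr1 -natrD ler_nat (leq_trans ja2)// leq_add2r.
    have : (J b)%:R + 1 <= (J a)%:R + w%:R :> R.
      by rewrite natr1 -natrD ler_nat (leq_trans jb2)// leq_add2r.
    by move=> *; apply/andP; split; lra.
  have : `|y a - y b| <= w%:R * h.
    move: jab; rewrite -gridB => /ler_normlP[g1 g2].
    by rewrite ler_norml; apply/andP; split; lra.
  move=> hab; rewrite ler_pdivlMr//.
  have : `|y a - y b| * (2 * 2 ^+ t) <= w%:R * h * (2 * 2 ^+ t).
    by rewrite ler_pM2r// mulr_gt0.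
  by lra.
- move=> a b; wlog ab : a b / (a < b)%N.
    move=> H ab; have [ab'|ba'|e] := ltngtP a b; first exact: H.
      by rewrite distrC; apply: H; rewrite // eq_sym.
    by move: ab; rewrite (val_inj e) eqxx.
  move=> _; rewrite -mulrBr normrM ger0_norm//.
  have [/ler_normlP[ya1 ya2] _] := yP a; have [/ler_normlP[yb1 yb2] _] := yP b.
  have jab : 2 * h <= ((J b)%:R - (J a)%:R) * h.
    rewrite ler_pM2r//; have : (J a)%:R + 2 <= (J b)%:R :> R by rewrite -natrD ler_nat J2.
    by lra.
  have : h <= y b - y a by move: jab; rewrite -gridB; lra.
  move=> hab; apply: le_trans (_ : 2 * h <= _); last first.
    by rewrite ler_pM2l// ler_normr; apply/orP; right; lra.
  rewrite ler_pdivrMr// ler_pdivrMr//.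
  have : h * n%:R <= h * (2 * Gam * 2 ^+ t) by rewrite ler_pM2l.
  by rewrite hn; lra.
by have [_] := yP a; rewrite ltNge ha.
Qed.

End BadCells.

(** * Rounding the sine coefficients and choosing the signs of the clusters *)

Section Signs.
Variable R : realType.
Implicit Types (x : R).

Lemma Im_poly_expi (c : nat -> R) n x :
  Im (\poly_(k < n) (c k)%:C).[expi x] = \sum_(k < n) c k * sin (k%:R * x).
Proof.
rewrite horner_poly; elim: n => [|n IH]; first by rewrite !big_ord0.
rewrite !big_ord_recr/= -IH expiX /expi; move: (\sum_(i < n) _) => [u v].
by simpc.
Qed.

(** Discrepancy controls the error at 3(n+1) roots of unity, and [Im_grid_bound] extends this to the
    circle. As (3 (n+1)^2)^(1/4) <= 2 sqrt(n), the bound 960 * 2 sqrt(n) + 2 is at most 1922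
    sqrt(n). *)
Lemma sine_rounding n (P : pred nat) (c : nat -> R) : (0 < n)%N -> (forall k, `|c k| <= 1) ->
  exists f : nat -> bool, forall x,
    `|\sum_(k < n.+1 | P k) (c k - sgb R (f k)) * sin (k%:R * x)| <= 3 * (1922 * Num.sqrt n%:R).
Proof.
move=> n0 c1; pose N := (3 * n.+1)%N.
pose a (i : 'I_N) (k : 'I_n.+1) : R := if P k then sin (k%:R * (i%:R * (2 * pi / N%:R))) else 0.
have a1 i k : `|a i k| <= 1 by rewrite /a; case: ifP; rewrite ?normr0 ?ler01// sin_max.
have [||f fP] := coloring_rounding a1 (x := fun k : 'I_n.+1 => c k).
- by move=> k.
- by rewrite card_ord /N; lia.
exists (fun k => f (inord k)) => x.
pose d k := if P k then c k - sgb R (f (inord k)) else 0.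
have -> : \sum_(k < n.+1 | P k) (c k - sgb R (f (inord k))) * sin (k%:R * x) =
    Im (\poly_(k < n.+1) (d k)%:C).[expi x].
  rewrite Im_poly_expi big_mkcond; apply: eq_bigr => k _; rewrite /d.
  by case: ifP; rewrite ?mul0r.
apply: (Im_grid_bound (n := n.+1) (N := N)) => //; last exact: nrm_expi.
move=> i iN; rewrite /root_pt mul1r expiX Im_poly_expi.
have := fP (Ordinal iN).
have -> : \sum_k a (Ordinal iN) k * (c k - sgb R (f k)) =
    \sum_(k < n.+1) d k * sin (k%:R * (i%:R * (2 * pi / N%:R))).
  apply: eq_bigr => k _; rewrite /a /d inord_val /=.
  by case: ifP => _; rewrite ?mul0r// mulrC.
move/le_trans; apply; rewrite card_ord.
have s1 : 1 <= Num.sqrt n%:R :> R by rewrite -[leLHS]sqrtr1 ler_wsqrtr// ler1n.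
suff : rt4 (N%:R * n.+1%:R) <= 2 * Num.sqrt n%:R :> R by lra.
rewrite -(@ler_pXn2r _ 4) ?nnegrE ?rt4_ge0 ?mulr_ge0 ?sqrtr_ge0// rt4K ?mulr_ge0//.
rewrite exprMn -[X in _ * _ ^+ X]/(2 * 2)%N exprM sqr_sqrtr// /N -natrX -natrX -!natrM ler_nat.
by rewrite -mulnn (_ : 2 ^ 4 = 16)%N//; nia.
Qed.

Section ClusterSigns.
Variables (n : nat) (bad : pred nat) (r A w : nat).
Hypotheses (few : forall i, (count bad (iota i w) < r)%N) (A0 : (0 < A)%N) (rAw : (r * A <= w)%N).
Let B := [set j : 'I_n.+1 | bad j].
Let label (j : 'I_n.+1) : 'I_n.+1 := inord (cluster bad A j).

Let labelE j : label j = cluster bad A j :> nat.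
Proof. by rewrite inordK// ltnS (leq_trans (cluster_le _ _ _))// -ltnS. Qed.

Lemma card_le_count (S : {set 'I_n.+1}) i c : {in S, forall j : 'I_n.+1, bad j && (i <= j < i + c)%N} ->
  (#|S| <= count bad (iota i c))%N.
Proof.
move=> H; rewrite cardE -(size_map val) -size_filter.
apply: uniq_leq_size; first by rewrite map_inj_uniq ?enum_uniq//; exact: val_inj.
by move=> j /mapP[k]; rewrite mem_enum => /H kP ->; rewrite mem_filter mem_iota.
Qed.

Lemma card_bad c : (n.+1 <= c * w)%N -> (#|B| <= c * r)%N.
Proof.
move=> nc; apply: leq_trans (count_windows few c).
by apply: card_le_count => j; rewrite inE => -> /=; rewrite add0n (leq_trans _ nc).
Qed.

Let card_cluster l : (#|[set j in B | label j == l]| <= r)%N.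
Proof.
set S := [set j in B | _]; have [->|[k0 k0S]] := set_0Vmem S; first by rewrite cards0.
have [k kS kmin] := arg_minnP (fun j : 'I_n.+1 => j : nat) k0S.
apply: leq_trans (ltnW (few k)); apply: card_le_count => j jS.
have {}kS : k \in S by exact: kS.
have := jS; have := kS; rewrite /S !inE => /andP[_ /eqP lk] /andP[-> /eqP lj] /=.
rewrite kmin//=; have kj := kmin _ jS.
have := @cluster_bounded bad r A w few A0 rAw k (j - k).
by rewrite subnKC// -!labelE lk lj => /(_ erefl); lia.
Qed.

(** The clusters are coloured, with one constraint per frequency; dividing by r normalises the
    entries, since a cluster has at most r bad cells. The gain over sqrt(n) comes from |B| being
    much smaller than n. *)
Lemma cluster_signs : exists alpha : 'I_n.+1 -> R,
  [/\ forall j, `|alpha j| = 1,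
      forall i j : 'I_n.+1, bad i -> bad j -> alpha j != alpha i -> (A < (j - i) + (i - j))%N &
      forall k : nat, (k <= n)%N -> `|\sum_(j in B) alpha j * sin (k%:R * grid R n j)|
         <= r%:R * (480 * rt4 (n.+1%:R * #|B|%:R))].
Proof.
have r0 : (0 < r)%N by apply: leq_trans (few 0).
have rR : 0 < r%:R :> R by rewrite ltr0n.
pose a (k : 'I_n.+1) l : R := (\sum_(j in B | label j == l) sin (k%:R * grid R n j)) / r%:R.
have a1 k l : `|a k l| <= 1.
  rewrite normrM normfV (gtr0_norm rR) ler_pdivrMr// mul1r.
  apply: le_trans (ler_norm_sum _ _ _) _.
  apply: le_trans (_ : \sum_(j in B | label j == l) 1 <= _).
    by apply: ler_sum => j _; exact: sin_max.
  rewrite sumr_const ler_nat; apply: leq_trans (card_cluster l).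
  by apply: eq_leq; apply: eq_card => j; rewrite [RHS]inE unfold_in.
have Sn : (#|label @: B| <= n.+1)%N by rewrite -[X in (_ <= X)%N]card_ord max_card.
have [f fP] := full_coloring a1 Sn.
exists (fun j => sgb R (f (label j))); split=> [j|i j bi bj|k kn]; first exact: sgb_norm.
  move=> fij; have cij : cluster bad A i != cluster bad A j.
    by apply: contraNneq fij => e; rewrite (_ : label j = label i)//; apply: val_inj; rewrite /= !labelE e.
  have far (x y : nat) : bad x -> bad (x + y)%N ->
    cluster bad A x != cluster bad A (x + y) -> (A < y)%N by exact: cluster_far.
  case: (leqP i j) => ij.
    by have := far i (j - i)%N bi; rewrite subnKC// => /(_ bj cij); lia.
  have e : (j + (i - j) = i)%N by lia.
  by have := far j (i - j)%N bj; rewrite e eq_sym => /(_ bi cij); lia.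
have -> : \sum_(j in B) sgb R (f (label j)) * sin (k%:R * grid R n j) =
   r%:R * \sum_(l in label @: B) a (inord k) l * sgb R (f l).
  rewrite mulr_sumr (partition_big_imset label)/=; apply: eq_bigr => l _.
  rewrite /a inordK// mulrA mulrCA divff ?gt_eqF// mulr1 mulr_suml.
  by apply: eq_bigr => j /andP[_ /eqP ->]; rewrite mulrC.
rewrite normrM (gtr0_norm rR) ler_pM2l//; apply: le_trans (fP _) _.
rewrite ler_pM2l//; apply: ler_rt4; rewrite ler_wpM2l// ler_nat.
exact: leq_imset_card.
Qed.

End ClusterSigns.
End Signs.

(** * The polynomial for large n *)

Section Assembly.
Variable R : realType.
Implicit Types (x y s : R) (z : R[i]).

Definition rs_sign t l : int := if (rs R t).1`_l == 1 then 1 else -1.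

Lemma rs_signE t l : (l < 2 ^ t)%N ->
  Re (rs R t).1`_l = (rs_sign t l)%:~R /\ Im (rs R t).1`_l = 0.
Proof.
move=> lt; have [[b e] _] := coef_rs R lt; rewrite /rs_sign e.
case: b e => _; last by rewrite expr0 eqxx.
rewrite expr1 -subr_eq0 -opprD oppr_eq0 -[1 + 1]/(2%:R) pnatr_eq0 /=.
by rewrite oppr0 rmorphN.
Qed.

Lemma nearest_grid n x : (0 < n)%N -> 0 <= x <= pi / 2 ->
  exists2 j, (j <= n)%N & `|x - grid R n j| <= pi / (2 * n%:R) / 2.
Proof.
move=> n0 /andP[x0 x1]; rewrite /grid; set h : R := pi / (2 * n%:R).
have nR : 0 < n%:R :> R by rewrite ltr0n.
have h0 : 0 < h by rewrite divr_gt0 ?pi_gt0// mulr_gt0.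
have hn : n%:R * h = pi / 2 by rewrite /h; field; rewrite gt_eqF.
have xh : 0 <= x / h by rewrite divr_ge0// ltW.
have xh2 : 0 <= x / h + 1 / 2 by lra.
have /andP[] := truncn_itv xh2; set j := Num.truncn _ => j1 j2.
have e : x = x / h * h by rewrite divfK// gt_eqF.
exists j.
  have : j%:R < n%:R + 1 :> R; last by rewrite natr1 ltr_nat ltnS.
  apply: le_lt_trans j1 _.
  have : x / h <= n%:R by rewrite ler_pdivrMr// hn.
  by lra.
have {}j2 : x / h + 1 / 2 < j%:R + 1 by rewrite natr1.
have -> : x - j%:R * h = (x / h - j%:R) * h by rewrite mulrBl -e.
rewrite normrM (gtr0_norm h0) mulrC ler_pM2l// ler_norml.
by apply/andP; split; lra.
Qed.

Section Large.
Variables (n t K Gn : nat) (delta S0 : R).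
(* A window of w cells contains fewer than r bad ones, and at least A good cells lie
   between two clusters. *)
Let T := (2 ^ t)%N.
Let r := (2 * K)%N.
Let A := (2 ^ 14)%N.
Let w := (n %/ (4 * T))%N.
Let q := (n./2)%N.
Let m := ((2 ^ t.+1).-1.*2)%N.
Hypotheses (K0 : (0 < K)%N) (d2 : delta <= 1 / 2).
Hypothesis sep : forall x : 'I_K -> R, (forall i j, `|x i - x j| <= 1 / 2 ^+ t) ->
    (forall i j, i != j -> 1 / Gn%:R / 2 ^+ t <= `|x i - x j|) ->
    exists i, delta * Num.sqrt (2 ^+ t) <= `|Re (rs R t.+1).1.[expi (x i)]|.
(** [G1] keeps bad cells beyond index A, [G2] gives r A <= w, and [G3] is the gain in [disc_bound].
    A quarter of S0 sqrt(n) exceeds the rounding error 6 * 1922 sqrt(n) by sqrt(n). [dT] lets 2 Re F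
    absorb the middle coefficient. *)
Hypotheses (G1 : (128 * A.+1 <= Gn)%N) (G2 : (4 * (r * A) <= Gn)%N)
  (G3 : 16 * r%:R * (2880 * S0 * r%:R) ^+ 4 <= Gn%:R)
  (S0E : S0 = 4 * (6 * 1922 + 1))
  (nG : (Gn * T <= n)%N) (nG' : (n <= 2 * (Gn * T))%N)
  (dT : 1 <= delta * Num.sqrt (2 ^+ t)).

Let bad := bad_cell n t delta.
Let B := [set j : 'I_n.+1 | bad j].

Let T0 : (0 < T)%N. Proof. by rewrite expn_gt0. Qed.
Let A0 : (0 < A)%N. Proof. by rewrite expn_gt0. Qed.
Let r0 : (0 < r)%N. Proof. by rewrite muln_gt0. Qed.
Let Gn0 : (128 <= Gn)%N. Proof. by apply: leq_trans G1; rewrite leq_pmulr. Qed.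
Let nT : (128 * T <= n)%N. Proof. by apply: leq_trans nG; rewrite leq_mul2r Gn0 orbT. Qed.
Let n128 : (128 <= n)%N. Proof. by apply: leq_trans nT; rewrite leq_pmulr. Qed.
Let nR : 0 < n%:R :> R. Proof. by rewrite ltr0n (leq_trans _ n128). Qed.
Let GR : 0 < Gn%:R :> R. Proof. by rewrite ltr0n (leq_trans _ Gn0). Qed.
Let rR : 0 < r%:R :> R. Proof. by rewrite ltr0n. Qed.
Let S0_gt0 : 0 < S0. Proof. by rewrite S0E; lra. Qed.
Let sqn : 0 < Num.sqrt n%:R :> R. Proof. by rewrite sqrtr_gt0. Qed.

Let S0n : 0 <= S0 * Num.sqrt n%:R. Proof. by apply: mulr_ge0; apply: ltW. Qed.

Let rAw : (r * A <= w)%N.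
Proof.
rewrite leq_divRL ?muln_gt0//; apply: leq_trans nG.
by rewrite mulnA leq_mul2r mulnC G2 orbT.
Qed.

Let w0 : (0 < w)%N.
Proof. by apply: leq_trans rAw; rewrite muln_gt0 r0. Qed.

Let few i : (count bad (iota i w) < r)%N.
Proof.
apply: (few_bad_cells (Gam := Gn%:R)) => //; first by apply: leq_trans n128.
by rewrite -natrX -!natrM ler_nat -mulnA.
Qed.

Let card_B : (#|B| <= 8 * T * r)%N.
Proof.
apply: (card_bad few); have := ltn_ceil n (_ : 0 < 4 * T)%N; rewrite muln_gt0 T0 => /(_ isT).
rewrite -/w => h; apply: leq_trans h _.
have -> : (8 * T * w = 2 * w * (4 * T))%N by ring.
by rewrite leq_mul2r mul2n -addnn -[w.+1]addn1 leq_add2l w0 orbT.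
Qed.

(** (n + 1) |B| <= 2n * 8 T r <= 16 r n^2 / Gn, and 2880 = 6 * 480. The 6 makes the sine
    coefficients at most n / (3q) <= 1. *)
Let disc_bound : r%:R * (480 * rt4 (n.+1%:R * #|B|%:R)) <= Num.sqrt n%:R / (6 * S0).
Proof.
have P0 : 0 < 2880 * S0 * r%:R by rewrite !mulr_gt0.
have key : rt4 (n.+1%:R * #|B|%:R) <= Num.sqrt n%:R / (2880 * S0 * r%:R).
  rewrite -(@ler_pXn2r _ 4) ?nnegrE ?rt4_ge0 ?divr_ge0 ?sqrtr_ge0 ?(ltW P0)// rt4K ?mulr_ge0//.
  rewrite expr_div_n -[X in Num.sqrt _ ^+ X]/(2 * 2)%N exprM sqr_sqrtr// ler_pdivlMr ?exprn_gt0//.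
  have h1 : n.+1%:R * #|B|%:R * Gn%:R <= 16 * r%:R * n%:R ^+ 2 :> R.
    rewrite -natrX -!natrM ler_nat.
    apply: leq_trans (_ : (2 * n) * (8 * T * r) * Gn <= _)%N.
      rewrite leq_mul2r; apply/orP; right; apply: leq_mul; last exact: card_B.
      by rewrite mul2n -addnn -[n.+1]addn1 leq_add2l (leq_trans _ n128).
    have -> : (2 * n * (8 * T * r) * Gn = 16 * r * (n * (Gn * T)))%N by ring.
    by rewrite leq_mul2l -mulnn leq_mul2l nG !orbT.
  rewrite -(ler_pM2r GR).
  have -> : n.+1%:R * #|B|%:R * (2880 * S0 * r%:R) ^+ 4 * Gn%:R =
     n.+1%:R * #|B|%:R * Gn%:R * (2880 * S0 * r%:R) ^+ 4 by ring.
  apply: le_trans (_ : 16 * r%:R * n%:R ^+ 2 * (2880 * S0 * r%:R) ^+ 4 <= _).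
    by rewrite ler_wpM2r// exprn_ge0// ltW.
  by rewrite mulrAC mulrC ler_wpM2l ?sqr_ge0.
apply: le_trans (_ : r%:R * (480 * (Num.sqrt n%:R / (2880 * S0 * r%:R))) <= _).
  by rewrite ler_pM2l// ler_pM2l.
by rewrite le_eqVlt; apply/orP; left; apply/eqP; field; rewrite !gt_eqF.
Qed.

Let q0 : (0 < q)%N. Proof. by rewrite /q half_gt0; apply: leq_trans n128. Qed.

Let q2n : (q.*2 <= n)%N.
Proof. by rewrite -[X in (_ <= X)%N](odd_double_half n) leq_addl. Qed.

Let n3q : (n <= 3 * q)%N.
Proof.
rewrite -[X in (X <= _)%N](odd_double_half n) -/q -mul2n [(3 * q)%N]mulSnr addnC leq_add2l.
exact: leq_trans (leq_b1 _) q0.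
Qed.

Let mn : (m <= n)%N.
Proof.
apply: (@leq_trans (4 * T)); last by apply: leq_trans nT; rewrite leq_mul2r orbT.
by rewrite /m -mul2n expnS -/T -[4%N]/(2 * 2)%N -mulnA leq_mul2l leq_pred.
Qed.

Section Construction.
Variables (alpha : 'I_n.+1 -> R).
Hypotheses (alpha1 : forall j, `|alpha j| = 1)
  (alpha_far : forall i j : 'I_n.+1, bad i -> bad j -> alpha j != alpha i -> (A < (j - i) + (i - j))%N).

Let D (k : nat) : R := \sum_(j in B) alpha j * sin (k%:R * grid R n j).

Hypothesis D_bound : forall k : nat, (k <= n)%N -> `|D k| <= Num.sqrt n%:R / (6 * S0).

Let tg := target q B alpha.

Lemma target_fourier x : tg x =
  \sum_(p < q) 2 * odd_coef R q p * D (2 * p + 1) * sin ((2 * p + 1)%:R * x).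
Proof.
rewrite /tg /target; under eq_bigr do rewrite odd_kernel_diff mulr_sumr.
rewrite exchange_big/=; apply: eq_bigr => p _.
rewrite /D mulr_sumr mulr_suml; apply: eq_bigr => j _; ring.
Qed.

(* The Fourier coefficients of S0 sqrt(n)/2 times the target. *)
Definition sine_coef (k : nat) : R :=
  if odd k && (k < q.*2)%N then S0 * Num.sqrt n%:R * odd_coef R q k./2 * D k else 0.

Lemma sine_coef_le1 k : `|sine_coef k| <= 1.
Proof.
rewrite /sine_coef; case: ifP => [/andP[ok kq]|_]; last by rewrite normr0 ler01.
have kq' : (k./2 < q)%N by rewrite ltn_half_double.
have kn : (k <= n)%N by rewrite (leq_trans (ltnW kq)).
have c0 : 0 <= odd_coef R q k./2 by exact: odd_coef_ge0.
have qR : 0 < q%:R :> R by rewrite ltr0n.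
have e0 : 0 <= S0 * Num.sqrt n%:R * odd_coef R q k./2 by rewrite mulr_ge0 ?S0n.
rewrite normrM (ger0_norm e0).
apply: le_trans (_ : S0 * Num.sqrt n%:R * (2 / q%:R) * (Num.sqrt n%:R / (6 * S0)) <= _).
  apply: ler_pM => //; last exact: D_bound.
  by rewrite ler_wpM2l ?odd_coef_le ?S0n.
have -> : S0 * Num.sqrt n%:R * (2 / q%:R) * (Num.sqrt n%:R / (6 * S0)) =
   (Num.sqrt n%:R ^+ 2) / (3 * q%:R) by field; rewrite !gt_eqF.
by rewrite sqr_sqrtr// ler_pdivrMr ?mulr_gt0// mul1r -natrM ler_nat.
Qed.

Lemma sine_coef_sum x y s : (forall k, odd k -> sin (k%:R * y) = s * sin (k%:R * x)) ->
  2 * \sum_(k < n.+1 | ~~ is_cos m k) sine_coef k * sin (k%:R * y) =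
  S0 * Num.sqrt n%:R * (s * tg x).
Proof.
move=> sy.
have -> : \sum_(k < n.+1 | ~~ is_cos m k) sine_coef k * sin (k%:R * y) =
    \sum_(k < n.+1 | odd k && (k < q.*2)%N) sine_coef k * sin (k%:R * y).
  rewrite [LHS]big_mkcond [RHS]big_mkcond; apply: eq_bigr => k _.
  rewrite /is_cos /sine_coef; case: (boolP (odd k)) => ok /=; last first.
    by case: ifP; rewrite ?mul0r.
  by case: ifP; rewrite ?mul0r.
rewrite (sum_odd_ord (fun k => sine_coef k * sin (k%:R * y)) q2n).
rewrite target_fourier !mulr_sumr; apply: eq_bigr => p _.
have pq : (p.*2.+1 < q.*2)%N by rewrite ltn_Sdouble.
have op : odd p.*2.+1 by rewrite /= odd_double.
rewrite sy// /sine_coef pq op /= uphalf_double addn1 mul2n.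
by ring.
Qed.

Variable f : nat -> bool.
Hypothesis fP : forall x, `|\sum_(k < n.+1 | ~~ is_cos m k) (sine_coef k - sgb R (f k)) * sin (k%:R * x)|
  <= 3 * (1922 * Num.sqrt n%:R).

Definition large_sign (k : nat) : int := if is_cos m k then rs_sign t.+1 k./2 else (-1) ^+ f k.

Lemma large_cos_part x y : (forall k, ~~ odd k -> cos (k%:R * y) = cos (k%:R * x)) ->
  cos_part n m large_sign y = 2 * Re (rs R t.+1).1.[expi (2 * x)] - (large_sign 0)%:~R.
Proof.
move=> cy; rewrite /cos_part; congr (2 * _ - _).
have [sF _] := size_rs R t.+1; rewrite (Re_horner_expi _ sF).
rewrite (sum_even_ord (fun k => (large_sign k)%:~R * cos (k%:R * y)) mn).
rewrite prednK ?expn_gt0//; apply: eq_bigr => l _.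
have [-> ->] := rs_signE (ltn_ord l).
rewrite cy ?odd_double// mul0r subr0 /large_sign /is_cos odd_double /= doubleK.
rewrite leq_double -ltnS prednK ?expn_gt0// ltn_ord.
by congr (_ * cos _); rewrite -muln2 natrM; ring.
Qed.

Lemma large_sin_part x y s : `|s| = 1 -> (forall k, odd k -> sin (k%:R * y) = s * sin (k%:R * x)) ->
  `|sin_part n m large_sign y - S0 * Num.sqrt n%:R * (s * tg x)| <= 6 * 1922 * Num.sqrt n%:R.
Proof.
move=> s1 sy; rewrite -(sine_coef_sum sy).
have -> : sin_part n m large_sign y -
    2 * \sum_(k < n.+1 | ~~ is_cos m k) sine_coef k * sin (k%:R * y) =
    - (2 * \sum_(k < n.+1 | ~~ is_cos m k) (sine_coef k - sgb R (f k)) * sin (k%:R * y)).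
  rewrite /sin_part -mulrBr -mulrN -sumrB -sumrN; congr (_ * _).
  apply: eq_bigr => k /negbTE kc; rewrite /large_sign kc /sgb rmorphXn /= rmorphN1; ring.
by rewrite normrN normrM ger0_norm//; have := fP y; lra.
Qed.

Lemma large_bounds z : nrm z = 1 ->
  (delta * Num.sqrt (2 ^+ t) <= nrm (poly_of_coefs R (skew_coef n m large_sign) (2 * n)).[z] \/
   Num.sqrt n%:R <= nrm (poly_of_coefs R (skew_coef n m large_sign) (2 * n)).[z]) /\
  nrm (poly_of_coefs R (skew_coef n m large_sign) (2 * n)).[z] <=
    (5 + S0 * (4 * (9 * 24 ^+ 2)) + 6 * 1922) * Num.sqrt n%:R.
Proof.
move=> /unit_circle_quarter[x [y [s [xr -> s1 sy cy]]]].
rewrite skew_coef_eval nrmM nrm_expi mul1r.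
have Ce := large_cos_part cy; have Se := large_sin_part s1 sy.
have n_gt0 : (0 < n)%N by apply: leq_trans n128.
have [j0 j0n xj0] := nearest_grid n_gt0 xr.
have q2n' : (2 * q <= n)%N by rewrite mul2n.
have up := target_upper q0 n3q q2n' xr j0n xj0 B alpha1.
have b01 : `|(large_sign 0)%:~R| <= 1 :> R.
  by rewrite /large_sign /is_cos /= /rs_sign; case: ifP; rewrite ?normrN normr1.
set C := cos_part _ _ _ _ in Ce *; set S := sin_part _ _ _ _ in Se *.
set u := Re (rs R t.+1).1.[_] in Ce.
have st : `|s * tg x| = `|tg x| by rewrite normrM s1 mul1r.
have SS : `|S0 * Num.sqrt n%:R * (s * tg x)| = S0 * Num.sqrt n%:R * `|tg x|.
  by rewrite normrM st ger0_norm ?S0n.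
have CN : `|C| <= nrm (C +i* S) by have := normr_Re_le (C +i* S).
have SN : `|S| <= nrm (C +i* S) by have := normr_Im_le (C +i* S).
split.
  have [ux|ux] := lerP (delta * Num.sqrt (2 ^+ t)) `|u|.
    left; apply: le_trans CN.
    have : 2 * `|u| <= `|C| + `|(large_sign 0)%:~R|.
      have := ler_normD (2 * u - (large_sign 0)%:~R) (large_sign 0)%:~R.
      by rewrite subrK normrM ger0_norm// -Ce.
    by move: dT ux b01; move: (delta * _) (`|u|) (`|C|) (`|_%:~R|) => a1 a2 a3 a4; lra.
  right; apply: le_trans SN.
  have badj0 : bad j0 by apply/asboolP; exists x.
  have low : 1 / 2 - 5 * 24 ^+ 2 / A%:R <= `|tg x|.
    apply: (target_lower q0 n3q q2n' xr j0n xj0 alpha1 A0) => [j e|j|i j e jB].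
    - by rewrite inE e.
    - rewrite inE => bj; apply: (bad_cell_far d2 n_gt0 _ bj).
      by apply: leq_trans nG; rewrite leq_mul2r G1 orbT.
    - move=> ji; rewrite -e; apply: alpha_far => //; first by rewrite e.
      by move: jB; rewrite inE.
  have {}low : 1 / 4 <= `|tg x|.
    apply: le_trans low; rewrite /A natrX; lra.
  have : S0 * Num.sqrt n%:R * (1 / 4) <= S0 * Num.sqrt n%:R * `|tg x|.
    by rewrite ler_wpM2l ?S0n.
  have := ler_normB S (S - S0 * Num.sqrt n%:R * (s * tg x)); rewrite subKr SS.
  have e : S0 * Num.sqrt n%:R * (1 / 4) = 6 * 1922 * Num.sqrt n%:R + Num.sqrt n%:R.
    by rewrite S0E; field.
  by move: Se; rewrite e; lra.
have T_le : Num.sqrt (2 ^+ t) <= Num.sqrt n%:R :> R.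
  by rewrite ler_wsqrtr// -natrX ler_nat (leq_trans _ nT)// leq_pmull.
have s1' : 1 <= Num.sqrt n%:R :> R.
  by rewrite -[leLHS]sqrtr1 ler_wsqrtr// ler1n.
have u_le : `|u| <= 2 * Num.sqrt (2 ^+ t).
  by apply: le_trans (normr_Re_le _) _; apply: nrm_rs_le_sqrt; exact: nrm_expi.
have C_le : `|C| <= 5 * Num.sqrt n%:R.
  rewrite Ce; apply: le_trans (ler_normB _ _) _; rewrite normrM ger0_norm//; lra.
have S_le : `|S| <= S0 * Num.sqrt n%:R * (4 * (9 * 24 ^+ 2)) + 6 * 1922 * Num.sqrt n%:R.
  have := ler_normD (S - S0 * Num.sqrt n%:R * (s * tg x)) (S0 * Num.sqrt n%:R * (s * tg x)).
  rewrite subrK SS.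
  have : S0 * Num.sqrt n%:R * `|tg x| <= S0 * Num.sqrt n%:R * (4 * (9 * 24 ^+ 2)).
    by rewrite ler_wpM2l ?S0n.
  by move: Se; lra.
by apply: le_trans (nrm_ReIm _) _ => /=; lra.
Qed.

End Construction.

Lemma large_case : exists b : nat -> int, (forall k, b k = -1 \/ b k = 1) /\
  forall z, nrm z = 1 ->
  (delta * Num.sqrt (2 ^+ t) <= nrm (poly_of_coefs R (skew_coef n m b) (2 * n)).[z] \/
   Num.sqrt n%:R <= nrm (poly_of_coefs R (skew_coef n m b) (2 * n)).[z]) /\
  nrm (poly_of_coefs R (skew_coef n m b) (2 * n)).[z] <=
    (5 + S0 * (4 * (9 * 24 ^+ 2)) + 6 * 1922) * Num.sqrt n%:R.
Proof.
have [alpha [alpha1 alpha_far D_le]] := cluster_signs R n few A0 rAw.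
have D_bound (k : nat) : (k <= n)%N ->
    `|\sum_(j in B) alpha j * sin (k%:R * grid R n j)| <= Num.sqrt n%:R / (6 * S0).
  by move=> kn; apply: le_trans (D_le k kn) disc_bound.
have n_gt0 : (0 < n)%N by apply: leq_trans n128.
have c1 k : `|sine_coef alpha k| <= 1 by exact: sine_coef_le1.
have [f fP] := sine_rounding (fun k => ~~ is_cos m k) n_gt0 c1.
exists (large_sign f); split; last by move=> z z1; apply: large_bounds fP z z1.
move=> k; rewrite /large_sign /rs_sign; do 2?case: ifP => _; [by right|by left|].
by case: (f k); [left|right].
Qed.

End Large.
End Assembly.

(** * Symmetry of the coefficients and choice of the constants *)

Section Final.
Variable R : realType.
Implicit Types (x y s : R) (z : R[i]).

Lemma skew_coef_sign n m b j : (forall k, b k = -1 \/ b k = 1) ->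
  skew_coef n m b j = -1 \/ skew_coef n m b j = 1.
Proof.
move=> b1; rewrite /skew_coef; case: ifP => _; first exact: b1.
case: ifP => _; first exact: b1.
by case: (b1 (n - j)%N) => ->; [right | left]; rewrite ?opprK.
Qed.

Lemma skew_coef_anti n m b j : (j < n - m)%N ->
  skew_coef n m b j = - skew_coef n m b (2 * n - j)%N.
Proof.
move=> jnm; rewrite /skew_coef /is_cos.
have -> : (n <= j)%N = false by lia.
have -> : (n <= 2 * n - j)%N by lia.
have -> : (n - j <= m)%N = false by lia.
by rewrite andbF; congr (- b _); lia.
Qed.

Lemma skew_coef_sym n m b j : (n - m <= j)%N -> (j <= n)%N ->
  skew_coef n m b j = (-1) ^+ (n - j) * skew_coef n m b (2 * n - j)%N.
Proof.
move=> jnm; rewrite leq_eqVlt => /predU1P[->|jn].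
  by rewrite subnn mul1r; congr (skew_coef _ _ _ _); lia.
rewrite /skew_coef /is_cos.
have -> : (n <= j)%N = false by lia.
have -> : (n <= 2 * n - j)%N by lia.
have -> : (n - j <= m)%N by lia.
have -> : (2 * n - j - n = n - j)%N by lia.
by rewrite andbT -signr_odd; case: (odd _); rewrite ?mulN1r ?mul1r.
Qed.

Lemma littlewood_le (a : nat -> int) d z : nrm z = 1 -> (forall j, a j = -1 \/ a j = 1) ->
  nrm (poly_of_coefs R a d).[z] <= d.+1%:R.
Proof.
move=> z1 a1; rewrite /poly_of_coefs horner_sum; apply: le_trans (nrm_sum _ _ _) _.
rewrite -[X in _ <= X%:R](card_ord d.+1) -sumr_const; apply: ler_sum => j _.
rewrite hornerZ hornerXn nrmM nrmX z1 expr1n mulr1.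
by case: (a1 j) => ->; rewrite ?rmorphN ?nrmN /= rmorph1 nrm_real normr1.
Qed.

(* With m = 1 the real part of z^(-n) P(z) is constant. *)
Lemma small_case n z : nrm z = 1 ->
  1 <= nrm (poly_of_coefs R (skew_coef n 1 (fun=> 1)) (2 * n)).[z].
Proof.
move=> /unit_circle_quarter[_ [y [_ [_ -> _ _ _]]]].
rewrite skew_coef_eval nrmM nrm_expi mul1r.
suff -> : cos_part n 1 (fun=> 1) y = 1.
  by apply: le_trans (normr_Re_le _); rewrite /= normr1.
rewrite /cos_part big_mkcond big_ord_recl /= big1 => [|k _].
  by rewrite mul0r cos0; ring.
rewrite /is_cos /bump /= add1n ltnS leqn0.
by case: (k : nat) => [|j] //=; rewrite andbF.
Qed.

Lemma sqrt_double_le (c x : R) : 1 <= c -> 0 <= x -> Num.sqrt (4 * c * x) <= 2 * c * Num.sqrt x.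
Proof.
move=> c1 x0; rewrite -(@ler_pXn2r _ 2) ?nnegrE ?sqrtr_ge0 ?mulr_ge0//; last 2 first.
- by lra.
- by rewrite sqrtr_ge0.
rewrite sqr_sqrtr ?mulr_ge0//; last by lra.
have h : 0 <= (c - 1) * (c * x) by rewrite !mulr_ge0//; lra.
by rewrite exprMn sqr_sqrtr//; lra.
Qed.

Lemma large_parameters : exists (UB delta : R) (G : nat),
  [/\ 0 <= UB, 0 < delta, delta <= 1 / 2, (4 <= G)%N &
   forall n t, (4 <= t)%N -> (G * 2 ^ t <= n)%N -> (n <= 2 * (G * 2 ^ t))%N ->
     1 <= delta * Num.sqrt (2 ^+ t) ->
   exists b : nat -> int, (forall k, b k = -1 \/ b k = 1) /\
     forall z, nrm z = 1 ->
     let v := nrm (poly_of_coefs R (skew_coef n (2 ^ t.+1).-1.*2 b) (2 * n)).[z] in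
     (delta * Num.sqrt (2 ^+ t) <= v \/ Num.sqrt n%:R <= v) /\ v <= UB * Num.sqrt n%:R].
Proof.
have [K K0 sepK] := separated_small_points R.
have [S0 S0E] : exists S0 : R, S0 = 4 * (6 * 1922 + 1) by eexists.
have S00 : 0 <= S0 by rewrite S0E; lra.
have [UB UBE] : exists UB, UB = 5 + S0 * (4 * (9 * 24 ^+ 2)) + 6 * 1922 by eexists.
have UB0 : 0 <= UB by rewrite UBE; lra.
have [A AE] : exists A, A = (2 ^ 14)%N by eexists.
pose r := (2 * K)%N.
pose g3 : R := 16 * r%:R * (2880 * S0 * r%:R) ^+ 4.
have g30 : 0 <= g3.
  apply: mulr_ge0; first exact: mulr_ge0.
  by apply: exprn_ge0; apply: mulr_ge0 => //; exact: mulr_ge0.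
have [G [G0 G1 G2 G3]] : exists G, [/\ (0 < G)%N, (128 * A.+1 <= G)%N,
    (4 * (r * A) <= G)%N & g3 <= G%:R].
  have /andP[_ /ltW h] := truncn_itv g30.
  exists (128 * A.+1 + 4 * (r * A) + (Num.truncn g3).+1)%N; split.
  - by rewrite addnS.
  - by rewrite -addnA leq_addr.
  - by rewrite addnAC leq_addl.
  - by apply: le_trans h _; rewrite ler_nat leq_addl.
have GR : 1 <= G%:R :> R by rewrite ler1n.
rewrite AE in G1 G2.
(* The separation is fixed only now, after [G], which depends on [K]. *)
have [|delta1 d10 sep1] := sepK (1 / G%:R); first by rewrite divr_gt0//; lra.
pose delta := Num.min delta1 (1 / 2).
have d0 : 0 < delta by rewrite lt_min d10/=; lra.
have d2 : delta <= 1 / 2 by rewrite ge_min lexx orbT.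
have d1 : delta <= delta1 by rewrite ge_min lexx.
exists UB, delta, G; split=> //.
  by apply: leq_trans G1; rewrite -[4%N]/(4 * 1)%N leq_mul.
move=> n t t4 nG nG' dT.
have sep (x : 'I_K -> R) : (forall i j, `|x i - x j| <= 1 / 2 ^+ t) ->
    (forall i j, i != j -> 1 / G%:R / 2 ^+ t <= `|x i - x j|) ->
    exists i, delta * Num.sqrt (2 ^+ t) <= `|Re (rs R t.+1).1.[expi (x i)]|.
  move=> x1 x2; have [i h] := sep1 t x t4 x1 x2; exists i.
  by apply: le_trans h; rewrite ler_wpM2r ?sqrtr_ge0.
by rewrite UBE; exact: large_case K0 d2 sep G1 G2 G3 S0E nG nG' dT.
Qed.

Lemma flat_skew_exists : exists (eta1 eta2 eta : R),
  [/\ 0 < eta1, eta1 < eta2, 0 < eta & forall n, (0 < n)%N ->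
    exists bm : (nat -> int) * nat,
    [/\ forall k, bm.1 k = -1 \/ bm.1 k = 1, eta * n%:R <= bm.2%:R, (bm.2 <= n)%N &
      forall z, nrm z = 1 ->
       eta1 * Num.sqrt (2 * n)%:R <= nrm (poly_of_coefs R (skew_coef n bm.2 bm.1) (2 * n)).[z]
         <= eta2 * Num.sqrt (2 * n)%:R]].
Proof.
have [UB [delta [G [UB0 d0 d2 G4 large]]]] := large_parameters.
have G0 : (0 < G)%N by apply: leq_trans G4.
have GR : 1 <= G%:R :> R by rewrite ler1n.
pose N1 := (Num.truncn (delta ^- 2)).+1.
have N1P : 1 <= delta ^+ 2 * N1%:R.
  have : 0 <= delta ^- 2 by rewrite invr_ge0 sqr_ge0.
  move=> /truncn_itv/andP[_ /ltW h]; rewrite mulrC -ler_pdivrMr ?exprn_gt0// mul1r.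
  exact: h.
(* From [n0] on, the first bound gives t >= 4 and the second gives delta sqrt(2^t) >= 1. *)
have [n0 n01 n02] : exists2 n0, (G * 2 ^ 4 <= n0)%N & (2 * G * N1 <= n0)%N.
  by exists (G * 2 ^ 4 + 2 * G * N1)%N; rewrite ?leq_addl ?leq_addr.
have n0R : 0 <= n0%:R :> R by [].
(* The factor 2G compares sqrt(2n) with sqrt(2^t) for large n; 2 n0 + 1 covers n < n0, where only
   the lower bound 1 is known. *)
pose eta1 := delta / (2 * G%:R * (2 * n0%:R + 1)).
have den0 : 0 < 2 * G%:R * (2 * n0%:R + 1) :> R by apply: mulr_gt0; lra.
have e10 : 0 < eta1 by rewrite divr_gt0.
have e1d : eta1 * (2 * G%:R) <= delta.
  have n1 : 0 < 2 * n0%:R + 1 :> R by lra.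
  have -> : eta1 * (2 * G%:R) = delta / (2 * n0%:R + 1).
    by rewrite /eta1; field; rewrite !gt_eqF//; lra.
  by rewrite ler_pdivrMr// ler_peMr ?(ltW d0)//; lra.
have e12 : eta1 * 2 <= 1 by nra.
have e1n : eta1 * (2 * n0%:R) <= 1 by
  rewrite /eta1 mulrAC ler_pdivrMr//; nra.
exists eta1, (UB + 2 * n0%:R + 1), (1 / (G%:R + n0%:R + 1)); split=> //.
- by lra.
- by rewrite divr_gt0//; lra.
move=> n n_gt0.
have nR : 1 <= n%:R :> R by rewrite ler1n.
have s2n : 1 <= Num.sqrt (2 * n)%:R :> R.
  by rewrite -[leLHS]sqrtr1 ler_wsqrtr// ler1n muln_gt0.
have eden : 0 < G%:R + n0%:R + 1 :> R by lra.
case: (ltnP n n0) => nn0.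
  have nn0R : n%:R <= n0%:R :> R by rewrite ler_nat ltnW.
  exists (fun=> 1, 1%N); split=> //=; first by right.
    by rewrite mulrAC mul1r ler_pdivrMr// mul1r; lra.
  move=> z z1; apply/andP; split.
    apply: le_trans (small_case n z1); apply: le_trans e1n.
    rewrite ler_pM2l//; apply: le_trans (_ : 2 * n%:R <= _); last by lra.
    rewrite -(@ler_pXn2r _ 2) ?nnegrE ?sqrtr_ge0 ?mulr_ge0// sqr_sqrtr// natrM.
    by rewrite expr2 ler_peMl ?mulr_ge0//; lra.
  apply: le_trans (littlewood_le _ z1 (fun j => skew_coef_sign n 1 j (fun=> or_intror erefl))) _.
  rewrite -[(2 * n).+1%:R]natr1 natrM; apply: le_trans (_ : UB + 2 * n0%:R + 1 <= _); first by lra.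
  have h : 0 <= (UB + 2 * n0%:R + 1) * (Num.sqrt (2 * n)%:R - 1) by apply: mulr_ge0; lra.
  by rewrite natrM in h; lra.
(* The largest power of two with G T <= n, hence n < 2 G T. *)
pose t := trunc_log 2 (n %/ G); pose T := (2 ^ t)%N.
have nG16 : (2 ^ 4 <= n %/ G)%N.
  by rewrite leq_divRL// mulnC (leq_trans n01).
have nG_gt0 : (0 < n %/ G)%N by apply: leq_trans nG16.
have t4 : (4 <= t)%N by apply: trunc_log_max.
have /andP[Tle Tgt] := trunc_log_bounds (isT : (1 < 2)%N) nG_gt0.
have nG : (G * T <= n)%N by rewrite mulnC -leq_divRL.
have nG' : (n <= 2 * (G * T))%N.
  by rewrite mulnCA -expnS mulnC ltnW// -ltn_divLR.
have TR : T%:R = 2 ^+ t :> R by rewrite natrX.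
have T0 : 0 < 2 ^+ t :> R by rewrite exprn_gt0.
have dT : 1 <= delta * Num.sqrt (2 ^+ t).
  have N1T : (N1 <= T)%N.
    have : (2 * G * N1 <= 2 * (G * T))%N.
      by apply: leq_trans nG'; apply: leq_trans nn0.
    by rewrite mulnA leq_pmul2l// muln_gt0.
  rewrite -(@ler_pXn2r _ 2) ?nnegrE ?mulr_ge0 ?sqrtr_ge0 ?(ltW d0)// expr1n exprMn sqr_sqrtr ?(ltW T0)//.
  by apply: le_trans N1P _; rewrite ler_pM2l ?exprn_gt0// -TR ler_nat.
have [b [b1 bz]] := large n t t4 nG nG' dT.
pose m := ((2 ^ t.+1).-1.*2)%N.
have T1 : (0 < T)%N by rewrite expn_gt0.
have m_ge : (2 * T <= m)%N.
  rewrite /m expnS -/T -mul2n leq_mul2l /= -ltnS prednK ?muln_gt0//.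
  by rewrite mul2n -addnn -[X in (X < _)%N]addn0 ltn_add2l.
have m_le : (m <= n)%N.
  apply: (@leq_trans (4 * T)); first by rewrite /m -mul2n expnS -/T -[4%N]/(2 * 2)%N -mulnA leq_mul2l leq_pred.
  by apply: leq_trans nG; rewrite leq_mul2r G4 orbT.
exists (b, m); split=> //=.
  rewrite mulrAC mul1r ler_pdivrMr//; apply: le_trans (_ : m%:R * G%:R <= _).
    by rewrite -natrM ler_nat; apply: leq_trans nG' _; rewrite mulnCA mulnC leq_mul2r m_ge orbT.
  by rewrite ler_wpM2l//; lra.
move=> z z1; have [lo up] := bz z z1.
have nsq : Num.sqrt n%:R <= Num.sqrt (2 * n)%:R :> R.
  by rewrite ler_wsqrtr// ler_nat leq_pmull.
apply/andP; split; last first.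
  by apply: le_trans up _; apply: ler_pM; rewrite ?sqrtr_ge0//; move: UB0 n0R; lra.
case: lo => h; apply: le_trans h.
  have : Num.sqrt (2 * n)%:R <= 2 * G%:R * Num.sqrt (2 ^+ t) :> R.
    apply: le_trans (sqrt_double_le GR (ltW T0)); rewrite ler_wsqrtr// -TR -!natrM ler_nat.
    by rewrite -[4%N]/(2 * 2)%N -!mulnA leq_mul2l.
  move=> h; apply: le_trans (_ : eta1 * (2 * G%:R * Num.sqrt (2 ^+ t)) <= _).
    by rewrite ler_pM2l.
  by rewrite mulrA ler_wpM2r ?sqrtr_ge0.
have : Num.sqrt (2 * n)%:R <= 2 * Num.sqrt n%:R :> R.
  have := sqrt_double_le (lexx 1) (ler0n R n); rewrite !mulr1; apply: le_trans.
  by rewrite ler_wsqrtr// -natrM ler_nat leq_mul2r orbT.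
have := sqrtr_ge0 (n%:R : R); nra.
Qed.

End Final.

Theorem theorem1p2 (R : realType) :
  exists (eta1 eta2 eta : R) (a : nat -> nat -> int) (m : nat -> nat),
    [/\ 0 < eta1, eta1 < eta2, 0 < eta &
      forall n : nat, (1 <= n)%N ->
        (forall j : nat, (j <= 2 * n)%N -> (a n j = -1 \/ a n j = 1)) /\
        (0 <= eta * n%:R /\ eta * n%:R <= (m n)%:R /\ (m n <= n)%N) /\
        (forall z : R[i], `|z| = 1 ->
           (eta1 * Num.sqrt (2 * n)%:R)%:C <= `|(poly_of_coefs R (a n) (2 * n)).[z]|
           /\ `|(poly_of_coefs R (a n) (2 * n)).[z]|
              <= (eta2 * Num.sqrt (2 * n)%:R)%:C) /\
        (forall j : nat, (j < n - m n)%N -> a n j = - a n (2 * n - j)%N) /\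
        (forall j : nat, (n - m n <= j)%N -> (j <= n)%N ->
           a n j = (-1) ^+ (n - j) * a n (2 * n - j)%N)].
Proof.
have [eta1 [eta2 [eta [e1 e12 e0 H]]]] := flat_skew_exists R.
have /choice[bm bmP] : forall n : nat, exists bm : (nat -> int) * nat, (0 < n)%N ->
    [/\ forall k, bm.1 k = -1 \/ bm.1 k = 1, eta * n%:R <= bm.2%:R, (bm.2 <= n)%N &
      forall z, nrm z = 1 ->
       eta1 * Num.sqrt (2 * n)%:R <= nrm (poly_of_coefs R (skew_coef n bm.2 bm.1) (2 * n)).[z]
         <= eta2 * Num.sqrt (2 * n)%:R].
  move=> n; case: (posnP n) => [_|n0]; first by exists (fun=> 1, 0%N).
  by have [bm h] := H n n0; exists bm.
exists eta1, eta2, eta, (fun n => skew_coef n (bm n).2 (bm n).1), (fun n => (bm n).2).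
split=> // n n0; have [b1 me mn bz] := bmP n n0.
split; first by move=> j _; exact: skew_coef_sign.
split; first by split=> //; rewrite mulr_ge0// ltW.
split.
  move=> z; rewrite nrm_normr => /complexI/bz/andP[h1 h2].
  by rewrite nrm_normr !lecR.
by split=> j; [exact: skew_coef_anti | exact: skew_coef_sym].
Qed.
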